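(* One-tape double-head infinite time Turing machines with a one-cell scratch pad compute exactly the same partial functions $\mathbb{R}\to\mathbb{R}$ and have exactly the same clockable ordinals as ordinary (three-tape) infinite time Turing machines.
   Context: $\mathbb{R}=2^\omega$. An infinite time Turing machine (ITTM) has three tapes (input, scratch, output) of cells indexed by $\omega$ with values in $\{0,1\}$, one head scanning a column of all three tapes, and a program with finitely many states including start, halt and a limit state. Successor steps are as for ordinary Turing machines (moving left from the leftmost cell leaves the head in place); at limit stages the head returns to the leftmost cell, the state becomes the limit state, and each cell takes the $\limsup$ of its earlier values. On input $a$, $a$ is on the input tape and other tapes are $0$; upon halting the output is the output tape; $f$ is computable if some program on input $a$ halts iff $a\in\mathrm{dom}(f)$, with output $f(a)$. An ordinal is clockable for a class of machines if some program of that class on input $0=\langle000\cdots\rangle$ first reaches the halt state at exactly that stage. A one-tape double-head ITTM with a one-cell scratch pad has a single tape with cells indexed by $\{-1\}\cup\omega$, cell $-1$ being the scratch pad; its head reads and writes two adjacent cells at once and moves one cell left or right per step; it starts on, and at limit stages returns to, the leftmost position, with cells taking $\limsup$ values at limits; the input is written on cells $0,1,2,\dots$ (pad initially $0$), and upon halting the output is the contents of cells $0,1,2,\dots$. *)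

(* Defs.v *)
From mathcomp Require Import all_boot.
Set Implicit Arguments. Unset Strict Implicit. Unset Printing Implicit Defensive.

(* Reals are R = 2^omega, i.e. infinite bit sequences. *)
Definition real := nat -> bool.

(* Strict well-orders, used as (representatives of) ordinals.           *)
Record WO := {
  wcar :> Type;
  wlt : wcar -> wcar -> Prop;
  wlt_wf : well_founded wlt;
  wlt_trans : forall x y z, wlt x y -> wlt y z -> wlt x z;
  wlt_total : forall x y, wlt x y \/ x = y \/ wlt y x }.
Arguments wlt {w} _ _.

Definition iso_below (A W : WO) (top : W) : Prop :=
  exists f : A -> W,
    (forall a, wlt (f a) top) /\
    (forall a b, wlt a b <-> wlt (f a) (f b)) /\
    (forall v, wlt v top -> exists a, f a = v).

Record config (S C : Type) := Config {
  cstate : S; chead : nat; ctape : C -> bool }.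

Definition limsup_below (W : WO) (w : W) (f : W -> bool) : Prop :=
  forall v, wlt v w -> exists u, (u = v \/ wlt v u) /\ wlt u w /\ f u = true.

Definition is_run (S C : Type) (init : config S C)
    (step : config S C -> config S C) (limst : S)
    (W : WO) (c : W -> config S C) : Prop :=
  forall w : W,
    ((forall v, ~ wlt v w) -> c w = init) /\
    (forall v, wlt v w -> (forall u, ~ (wlt v u /\ wlt u w)) ->
        c w = step (c v)) /\
    ((exists v, wlt v w) -> (forall v, wlt v w -> exists u, wlt v u /\ wlt u w) ->
        cstate (c w) = limst /\ chead (c w) = 0 /\
        forall i, (ctape (c w) i = true <-> limsup_below w (fun u => ctape (c u) i))).

(* the computation first reaches the halt state at stage top
   (W is then a well-order of type top+1) *)
Definition halts_at (S C : Type) (init : config S C)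
    (step : config S C -> config S C) (limst halt : S)
    (W : WO) (top : W) (c : W -> config S C) : Prop :=
  (forall v, v = top \/ wlt v top) /\
  is_run init step limst c /\
  cstate (c top) = halt /\
  (forall v, wlt v top -> cstate (c v) <> halt).

Inductive tape3 := Inp | Scr | Out.

Record ittm := {
  ist : finType;
  istart : ist; ihalt : ist; ilim : ist;
  idistinct : [/\ istart != ihalt, ilim != ihalt & istart != ilim];
  (* (state, bits read on input/scratch/output) ->
     (new state, bits written on input/scratch/output, move right?) *)
  idelta : ist -> bool * bool * bool -> ist * (bool * bool * bool) * bool }.

Definition iconfig (p : ittm) := config (ist p) (tape3 * nat).

Definition iinit (p : ittm) (a : real) : iconfig p :=
  Config (istart p) 0 (fun x => match x with (Inp, n) => a n | _ => false end).

Definition istep (p : ittm) (c : iconfig p) : iconfig p :=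
  let h := chead c in
  let t := ctape c in
  match idelta (cstate c) (t (Inp, h), t (Scr, h), t (Out, h)) with
  | (s', (w0, w1, w2), mv) =>
      Config s' (if mv then h.+1 else h.-1)
        (fun x => match x with
                  | (k, n) => if n == h then
                                match k with Inp => w0 | Scr => w1 | Out => w2 end
                              else t (k, n) end)
  end.

Definition ioutput (p : ittm) (c : iconfig p) : real := fun n => ctape c (Out, n).

Definition ittm_halts_with (p : ittm) (a b : real) : Prop :=
  exists (W : WO) (top : W) (c : W -> iconfig p),
    halts_at (iinit p a) (@istep p) (ilim p) (ihalt p) top c /\ ioutput (c top) = b.

Definition ittm_halts (p : ittm) (a : real) : Prop :=
  exists (W : WO) (top : W) (c : W -> iconfig p),
    halts_at (iinit p a) (@istep p) (ilim p) (ihalt p) top c.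

Definition ittm_computes (p : ittm) (f : real -> option real) : Prop :=
  forall a, match f a with
            | Some b => ittm_halts_with p a b
            | None => ~ ittm_halts p a end.

Definition ittm_clockable (A : WO) : Prop :=
  exists (p : ittm) (W : WO) (top : W) (c : W -> iconfig p),
    halts_at (iinit p (fun _ => false)) (@istep p) (ilim p) (ihalt p) top c /\
    iso_below A top.

(* Cells: None = the scratch pad (cell -1), Some n = cell n.
   Head position k : nat stands for the paper's position k-1: the head
   reads/writes the two adjacent cells k-1 and k (position 0 = leftmost,
   reading the pad and cell 0). *)
Definition cellAt (k : nat) : option nat := if k is k'.+1 then Some k' else None.

Record ottm := {
  ost : finType;
  ostart : ost; ohalt : ost; olim : ost;
  odistinct : [/\ ostart != ohalt, olim != ohalt & ostart != olim];
  (* (state, left bit, right bit) -> (new state, (left, right) written, move right?) *)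
  odelta : ost -> bool * bool -> ost * (bool * bool) * bool }.

Definition oconfig (q : ottm) := config (ost q) (option nat).

Definition oinit (q : ottm) (a : real) : oconfig q :=
  Config (ostart q) 0 (fun x => match x with Some n => a n | None => false end).

Definition ostep (q : ottm) (c : oconfig q) : oconfig q :=
  let h := chead c in
  let t := ctape c in
  match odelta (cstate c) (t (cellAt h), t (cellAt h.+1)) with
  | (s', (wl, wr), mv) =>
      Config s' (if mv then h.+1 else h.-1)
        (fun x => if x == cellAt h then wl
                  else if x == cellAt h.+1 then wr else t x)
  end.

Definition ooutput (q : ottm) (c : oconfig q) : real := fun n => ctape c (Some n).

Definition ottm_halts_with (q : ottm) (a b : real) : Prop :=
  exists (W : WO) (top : W) (c : W -> oconfig q),
    halts_at (oinit q a) (@ostep q) (olim q) (ohalt q) top c /\ ooutput (c top) = b.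

Definition ottm_halts (q : ottm) (a : real) : Prop :=
  exists (W : WO) (top : W) (c : W -> oconfig q),
    halts_at (oinit q a) (@ostep q) (olim q) (ohalt q) top c.

Definition ottm_computes (q : ottm) (f : real -> option real) : Prop :=
  forall a, match f a with
            | Some b => ottm_halts_with q a b
            | None => ~ ottm_halts q a end.

Definition ottm_clockable (A : WO) : Prop :=
  exists (q : ottm) (W : WO) (top : W) (c : W -> oconfig q),
    halts_at (oinit q (fun _ => false)) (@ostep q) (olim q) (ohalt q) top c /\
    iso_below A top.

(* Main.v *)
Require Import Defs.
From HB Require Import structures.
From mathcomp Require Import all_boot zify boolp.

Set Implicit Arguments. Unset Strict Implicit. Unset Printing Implicit Defensive.

(** Write every stage as omega * b + m and describe a computation by its configurations at the
    beginnings of the omega-blocks. If every step of one machine is carried out by another one in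
    finitely many steps, intermediate cell values being old or new ones, then the two have the same
    limsups at the end of every block, so they stay synchronized at all limit stages.

    Double head on three tapes: pad and cells are kept on the scratch and output tapes. The input is
    first copied to the output tape. For clocks (input 0, no copying) the machine reads the first n
    columns at each limit; these decide whether the double-head machine halts n steps later.

    Three tapes on one: the input is spread out to one bit per five-cell column by omega passes,
    each shifting the remaining input; a flag that is switched on and off in each pass is on at
    omega^2 and only then. After the simulation the output is written back in omega steps, the pad
    telling at the next limit that all is done. For clocks, n columns are packed into one and the
    machine starts counting to n at the first limit at which column 0 shows the pattern it has when
    n steps remain. The two visible cells must suffice to see this at once: the pad is on when a
    cell outside the pattern is on, and cell 0 flashes whenever all cells of the pattern have been
    seen on since its last flash. *)

(** * Well-orders *)

Section WellOrders.
Variable W : WO.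
Implicit Types u v w x y : W.

Lemma wlt_ind (P : W -> Prop) :
  (forall w, (forall v, wlt v w -> P v) -> P w) -> forall w, P w.
Proof. exact: (well_founded_ind (@wlt_wf W)). Qed.

Lemma wlt_irr w : ~ wlt w w.
Proof. by elim/wlt_ind: w => w IH h; exact: (IH w h h). Qed.

Lemma wlt_asym u v : wlt u v -> ~ wlt v u.
Proof. by move=> uv vu; exact: wlt_irr (wlt_trans uv vu). Qed.

Definition wle v u := u = v \/ wlt v u.

Lemma wle_refl v : wle v v. Proof. by left. Qed.

Lemma wltW u v : wlt u v -> wle u v. Proof. by right. Qed.

Lemma wle_lt_trans v u w : wle u v -> wlt v w -> wlt u w.
Proof. by move=> [-> //|uv] vw; apply: wlt_trans vw. Qed.

Lemma wlt_le_trans v u w : wlt u v -> wle v w -> wlt u w.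
Proof. by move=> uv [-> //|vw]; apply: wlt_trans vw. Qed.

Lemma wle_trans v u w : wle u v -> wle v w -> wle u w.
Proof. by move=> uv [-> //|vw]; right; apply: wle_lt_trans vw. Qed.

Lemma wle_or_lt u v : wle u v \/ wlt v u.
Proof. by case: (wlt_total u v) => [|[]]; [left; right|left; left|right]. Qed.

Lemma wle_total u v : wle u v \/ wle v u.
Proof. by case: (wle_or_lt u v); [left|right; right]. Qed.

Lemma wlt_geF u v : wlt u v -> ~ wle v u.
Proof. by move=> uv [e|/wlt_asym //]; apply: (@wlt_irr v); rewrite -{1}e. Qed.

Lemma wlt_least (P : W -> Prop) :
  (exists w, P w) -> exists2 w, P w & forall v, P v -> wle w v.
Proof.
case=> w; elim/wlt_ind: w => w IH Pw.
have [[v vw Pv]|no] := EM (exists2 v, wlt v w & P v); first exact: IH vw Pv.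
by exists w => // v Pv; case: (wle_or_lt w v) => // vw; case: no; exists v.
Qed.

Definition is_min w := forall v, ~ wlt v w.
Definition nonmin w := exists v, wlt v w.
Definition is_succ v w := wlt v w /\ forall u, ~ (wlt v u /\ wlt u w).
Definition is_limit w := nonmin w /\ forall v, wlt v w -> exists u, wlt v u /\ wlt u w.

Lemma min_or_nonmin w : is_min w \/ nonmin w.
Proof. by have [|no] := EM (nonmin w); [right|left=> v vw; apply: no; exists v]. Qed.

Lemma min_exists w : exists2 v, is_min v & wle v w.
Proof.
have [|v _ least_v] := @wlt_least (fun=> True); first by exists w.
by exists v; [move=> u uv; apply: (wlt_geF uv); apply: least_v|apply: least_v].
Qed.

Lemma min_le v w : is_min v -> wle v w.
Proof. by move=> min_v; case: (wle_or_lt v w) => // /min_v. Qed.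

Lemma succ_le v w x : is_succ v w -> wlt v x -> wle w x.
Proof. by move=> [_ no] vx; case: (wle_or_lt w x) => // xw; case: (no x). Qed.

Lemma le_pred v w x : is_succ v w -> wlt x w -> wle x v.
Proof. by move=> [_ no] xw; case: (wle_or_lt x v) => // vx; case: (no x). Qed.

Lemma succ_uniq v w w' : is_succ v w -> is_succ v w' -> w = w'.
Proof.
move=> vw vw'; case: (succ_le vw (proj1 vw')) => // ww'.
by case: (wlt_geF ww'); apply: succ_le vw' (proj1 vw).
Qed.

Lemma succ_exists v x : wlt v x -> exists2 w, is_succ v w & wle w x.
Proof.
move=> vx; have [|w vw least_w] := @wlt_least (wlt v); first by exists x.
exists w; last exact: least_w.
by split=> // u [vu uw]; apply: (wlt_geF uw); apply: least_w.
Qed.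

Lemma limit_succ v w : is_limit w -> wlt v w -> exists2 u, is_succ v u & wlt u w.
Proof.
move=> [_ lim_w] /lim_w [x [vx xw]]; case: (succ_exists vx) => u vu ux.
by exists u => //; apply: wle_lt_trans xw.
Qed.

Lemma succ_not_limit v w : is_succ v w -> ~ is_limit w.
Proof. by move=> [vw no] [_ /(_ v vw) [u]]; apply: no. Qed.

Variant order_position w : Prop :=
| PosMin of is_min w
| PosSucc v of is_succ v w
| PosLimit of is_limit w.

Lemma order_positionP w : order_position w.
Proof.
case: (min_or_nonmin w) => [|nm]; first exact: PosMin.
have [[v vw]|no] := EM (exists v, is_succ v w); first exact: PosSucc vw.
apply: PosLimit; split=> // v vw; apply: contrapT => /forallNP no_u.
by apply: no; exists v.
Qed.

Fixpoint nth_succ (v : W) n w :=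
  if n is m.+1 then exists2 u, nth_succ v m u & is_succ u w else w = v.

Lemma nth_succ_uniq v n w w' : nth_succ v n w -> nth_succ v n w' -> w = w'.
Proof.
elim: n w w' => [|n IH] w w' /=; first by move=> -> ->.
by move=> [u vu uw] [u' vu' uw']; apply: succ_uniq uw _; rewrite (IH _ _ vu vu').
Qed.

Lemma nth_succ_mono v m n w w' : nth_succ v m w -> nth_succ v n w' -> m < n -> wlt w w'.
Proof.
elim: n w' => // n IH w' vw /= [u vu [uw' _]]; rewrite ltnS leq_eqVlt => /orP [/eqP mn|mn].
  by subst n; rewrite (nth_succ_uniq vw vu).
exact: wlt_trans (IH u vw vu mn) uw'.
Qed.

Lemma wle_persist (P : W -> Prop) v w : P v ->
  (forall u u', wle v u -> is_succ u u' -> wle u' w -> P u -> P u') ->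
  (forall u, is_limit u -> wlt v u -> wle u w ->
    (forall x, wle v x -> wlt x u -> P x) -> P u) ->
  wle v w -> P w.
Proof.
move=> Pv Psucc Plim vw.
suff : forall u, wle v u -> wle u w -> P u by apply=> //; apply: wle_refl.
elim/wlt_ind => u IH [-> //|vu] uw; case: (order_positionP u) => [/(_ _ vu) //|u' u'u|lim_u].
  have vu' := le_pred u'u vu; apply: (Psucc u') => //; apply: IH => //; first by case: u'u.
  by right; apply: wlt_le_trans uw; case: u'u.
by apply: Plim => // x vx xu; apply: IH => //; right; apply: wlt_le_trans uw.
Qed.

Lemma wlt_recursion T (t0 : T) (F : W -> (W -> T) -> T) :
  (forall w f g, (forall v, wlt v w -> f v = g v) -> F w f = F w g) ->
  exists s, forall w, s w = F w s.
Proof.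
move=> local; pose extend w (r : forall v, wlt v w -> T) v :=
  if pselect (wlt v w) is left vw then r v vw else t0.
exists (Fix (@wlt_wf W) _ (fun w r => F w (extend w r))) => w.
rewrite Fix_eq => [|{}w f g fg].
  by apply: local => v vw; rewrite /extend; case: pselect.
by apply: local => v _; rewrite /extend; case: pselect.
Qed.

End WellOrders.

Section Limsup.
Variable W : WO.
Implicit Types (v w : W) (f g : W -> bool).

Lemma limsup_mono f g w : (forall u, wlt u w -> f u -> g u) ->
  limsup_below w f -> limsup_below w g.
Proof.
by move=> fg sup_f v /sup_f [u [vu [uw fu]]]; exists u; split=> //; split=> //; apply: fg.
Qed.

Lemma not_limsup f w : ~ limsup_below w f ->
  exists2 v, wlt v w & forall u, wle v u -> wlt u w -> f u = false.
Proof.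
move=> no; apply: contrapT => no_v; apply: no => v vw; apply: contrapT => no_u.
apply: no_v; exists v => // u vu uw; apply/negbTE/negP => fu.
by apply: no_u; exists u.
Qed.

Lemma limsup_eventually f v w c : wlt v w ->
  (forall u, wle v u -> wlt u w -> f u = c) -> limsup_below w f <-> c.
Proof.
move=> vw fc; split=> [/(_ v vw) [u [vu [uw]]]|hc x xw]; first by rewrite fc.
case: (wle_total v x) => vx; first by exists x; split; [left|rewrite fc].
by exists v; split=> //; split=> //; rewrite fc //; apply: wle_refl.
Qed.

Lemma limsup_const c w : nonmin w -> limsup_below w (fun=> c) <-> c.
Proof. by case=> v vw; apply: (limsup_eventually vw). Qed.

Lemma limsup_or f g w : limsup_below w (fun u => f u || g u) ->
  limsup_below w f \/ limsup_below w g.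
Proof.
move=> sup_fg; apply: contrapT => /not_orP [/not_limsup [v vw f0] /not_limsup [x xw g0]].
have [y [vy [xy yw]]] : exists y, wle v y /\ wle x y /\ wlt y w.
  by case: (wle_total v x) => h; [exists x|exists v]; do 2?split=> //; left.
case: (sup_fg y yw) => u [yu [uw]].
by rewrite f0 ?g0 //; [apply: wle_trans xy yu|apply: wle_trans vy yu].
Qed.

Lemma limsup_has (I : eqType) (s : seq I) (f : I -> W -> bool) w : nonmin w ->
  limsup_below w (fun u => has (f^~ u) s) <-> exists2 i, i \in s & limsup_below w (f i).
Proof.
move=> nm; split=> [|[i si]]; last by apply: limsup_mono => u _ fi; apply/hasP; exists i.
elim: s => [/(limsup_const _ nm) //|i s IH] /limsup_or [sup_i|/IH [j js sup_j]].
  by exists i; rewrite ?mem_head.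
by exists j; rewrite // in_cons js orbT.
Qed.

End Limsup.

Section InitialEmbeddings.
Variables A B : WO.

Definition initial_embedding (g : A -> B) :=
  (forall u v, wlt u v <-> wlt (g u) (g v)) /\
  (forall u x, wlt x (g u) -> exists v, g v = x).

(* The value at [w] is the least strict upper bound of the values below [w]. *)
Lemma initial_embedding_exists (h : A -> B) : (forall u v, wlt u v -> wlt (h u) (h v)) ->
  exists g, initial_embedding g.
Proof.
move=> h_mono; case: (EM (exists w : A, True)) => [[w0 _]|empty]; last first.
  by exists h; split=> u; case: empty; exists u.
pose bound w (f : A -> B) x := forall v, wlt v w -> wlt (f v) x.
pose lub w f x := bound w f x /\ forall y, bound w f y -> wle x y.
have [w f f' ff'|g gE] := @wlt_recursion A B (h w0)
    (fun w f => if pselect (exists x, lub w f x) is left ex then sval (cid ex) else h w).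
  suff -> : lub w f = lub w f' by [].
  have e : bound w f = bound w f'.
    apply/funext => x; apply/propext.
    by split=> le v vw; [rewrite -ff'|rewrite ff'] => //; apply: le.
  by rewrite /lub e.
have g_lub w : lub w g (g w) /\ wle (g w) (h w).
  elim/wlt_ind: w => w IH.
  have h_bound : bound w g (h w).
    by move=> v vw; apply: wle_lt_trans (h_mono _ _ vw); case: (IH v vw).
  rewrite [g w]gE; case: pselect => [ex|[]]; last first.
    by case: (@wlt_least _ (bound w g)) => [|x]; [exists (h w)|exists x].
  by case: cid => x [xb x_least] /=; split; last exact: x_least.
have mono u v : wlt u v -> wlt (g u) (g v) by case: (g_lub v) => -[b _] _; apply: b.
exists g; split=> [u v|u x].
  split=> [|guv]; first exact: mono.
  case: (wlt_total u v) => [//|[uv|/mono vu]]; last by case: (wlt_asym guv vu).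
  by case: (@wlt_irr _ (g v)); rewrite -{1}uv.
elim/wlt_ind: u => u IH xu.
have [v vu] : exists2 v, wlt v u & wle x (g v).
  apply: contrapT => no; case: (g_lub u) => -[_ least_u] _; apply: (wlt_geF xu).
  apply: least_u => v vu; case: (wle_or_lt x (g v)) => // xv.
  by case: no; exists v.
by case=> [e|/IH]; [exists v|apply].
Qed.

Lemma iso_below_initial (C : WO) (g : A -> B) w : initial_embedding g ->
  iso_below C w <-> iso_below C (g w).
Proof.
move=> [mono down]; split=> -[f [f_lt [f_mono f_onto]]].
  exists (g \o f); split; first by move=> a; apply/mono.
  split=> [a b|x xw]; first by rewrite f_mono mono.
  case: (down w x xw) => v gv; subst x; case: (f_onto v); first exact/mono.
  by move=> a fa; exists a; rewrite /= fa.
have [k kE] := choice (fun a => down w (f a) (f_lt a)).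
exists k; split; first by move=> a; apply/mono; rewrite kE.
split=> [a b|v vw]; first by rewrite f_mono mono !kE.
case: (f_onto (g v)); first exact/mono.
move=> a fa; exists a; have ga : g (k a) = g v by rewrite kE.
by case: (wlt_total (k a) v) => [/mono|[//|/mono]]; rewrite ga => /wlt_irr.
Qed.

End InitialEmbeddings.

Definition WOsub (W : WO) (P : W -> Prop) : WO.
Proof.
refine (@Build_WO (sig P) (fun x y => wlt (sval x) (sval y)) _ _ _).
- move=> [x Px]; elim/wlt_ind: x Px => x IH Px.
  by constructor=> -[y Py] /= yx; apply: IH.
- by move=> x y z; apply: wlt_trans.
- move=> [x Px] [y Py]; case: (wlt_total x y) => [xy|[xy|xy]]; [by left| |by right; right].
  by right; left; apply: eq_exist.
Defined.

Definition WOlex (W : WO) : WO.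
Proof.
refine (@Build_WO (W * nat)%type (fun x y => wlt x.1 y.1 \/ x.1 = y.1 /\ x.2 < y.2) _ _ _).
- move=> [b n]; elim/wlt_ind: b n => b IH.
  elim/ltn_ind => n IHn; constructor=> -[u m] /= [ub|[-> mn]]; [exact: IH|exact: IHn].
- move=> [b n] [u m] [v l] /= [h1|[-> h1]] [h2|[<- h2]]; [left|left|left|right] => //.
    exact: wlt_trans h2.
  by split=> //; apply: ltn_trans h2.
- move=> [b n] [u m] /=; case: (wlt_total b u) => [h|[->|h]]; try by left; left.
    by case: (ltngtP n m) => h; [left; right|right; right; right|right; left; rewrite h].
  by right; right; left.
Defined.

Definition sum_lt (A B : WO) (x y : A + B) : Prop :=
  match x, y with
  | inl a, inl b => wlt a b
  | inl _, inr _ => True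
  | inr _, inl _ => False
  | inr a, inr b => wlt a b
  end.

Lemma sum_lt_wf (A B : WO) : well_founded (@sum_lt A B).
Proof.
have acc_inl a : Acc (@sum_lt A B) (inl a).
  by elim/wlt_ind: a => a IH; constructor; case=> [b ba|b []]; exact: IH.
case=> [a|b]; first exact: acc_inl.
elim/wlt_ind: b => b IH.
by constructor; case=> [a _|a ab]; [exact: acc_inl|exact: IH].
Qed.

Definition WOsum (A B : WO) : WO.
Proof.
refine (@Build_WO (A + B)%type (@sum_lt A B) (@sum_lt_wf A B) _ _).
- by move=> [x|x] [y|y] [z|z] //=; exact: wlt_trans.
- move=> [x|x] [y|y] /=; [|by left|by right; right|];
    by case: (wlt_total x y) => [h|[->|h]]; [left|right; left|right; right].
Defined.

Definition WOnat : WO.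
Proof.
refine (@Build_WO nat (fun m n => m < n) _ _ _).
- by elim/ltn_ind => n IH; constructor=> m; apply: IH.
- by move=> x y z; apply: ltn_trans.
- by move=> x y; case: (ltngtP x y) => h; auto.
Defined.

Definition WOupto (W : WO) (top : W) : WO := WOsub (fun x => wle x top).

Definition upto_top (W : WO) (top : W) : WOupto top :=
  exist (fun x => wle x top) top (wle_refl top).

Lemma initial_upto (W : WO) (top : W) : @initial_embedding (WOupto top) W sval.
Proof.
split=> // -[y y_top] x /= xy.
by exists (exist _ x (wle_trans (wltW xy) y_top)).
Qed.

Section Lexicographic.
Variable B : WO.
Implicit Types (b u : B) (x y : WOlex B).

Lemma lex_succ u m : is_succ ((u, m) : WOlex B) (u, m.+1).
Proof.
split=> [|[v l]] /=; first by right.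
case=> -[uv|[-> ml]] [vu|[e lm]]; [exact: wlt_asym uv vu| | |].
- by subst v; exact: wlt_irr uv.
- exact: wlt_irr vu.
- by move: (leq_trans ml lm); rewrite ltnn.
Qed.

Lemma lex_succ_pred x y : is_succ x y -> y = (x.1, x.2.+1).
Proof. by case: x => u m xy; apply: succ_uniq xy (lex_succ u m). Qed.

Lemma lex_lt_start u m b : wlt ((u, m) : WOlex B) (b, 0) <-> wlt u b.
Proof. by split=> [[//|[]]|]; [|left]. Qed.

Lemma lex_nonmin_start b : nonmin b <-> nonmin ((b, 0) : WOlex B).
Proof. by split=> [[u ub]|[[u m] /lex_lt_start ub]]; [exists (u, 0); left|exists u]. Qed.

Lemma lex_limit_start b : nonmin b -> is_limit ((b, 0) : WOlex B).
Proof.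
move=> nb; split; first exact/lex_nonmin_start.
move=> [v l] /lex_lt_start vb; exists (v, l.+1); split; first by case: (lex_succ v l).
by left.
Qed.

End Lexicographic.

(** * Runs in blocks of length omega *)

Record machine (S C : Type) := Machine {
  minit : config S C;
  mstep : config S C -> config S C;
  mlim : S;
  mhalt : S }.

Lemma config_eq (S C : Type) (y z : config S C) :
  cstate y = cstate z -> chead y = chead z -> ctape y =1 ctape z -> y = z.
Proof. by case: y z => [s h t] [s' h' t'] /= -> -> /funext ->. Qed.

Definition block_limsup (B : WO) (f : B -> nat -> bool) (b : B) :=
  @limsup_below (WOlex B) (b, 0) (fun x => f x.1 x.2).

Section BlockRuns.
Variables (S C : Type) (M : machine S C).
Local Notation iterates n y := (iter n (mstep M) y).

Definition mrun (W : WO) (c : W -> config S C) := is_run (minit M) (mstep M) (mlim M) c.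

Definition mhalts_at (W : WO) (top : W) (c : W -> config S C) :=
  halts_at (minit M) (mstep M) (mlim M) (mhalt M) top c.

Lemma mrun_uniq (W : WO) (c d : W -> config S C) : mrun c -> mrun d -> c =1 d.
Proof.
move=> run_c run_d w; elim/wlt_ind: w => w IH.
case: (run_c w) (run_d w) => [c_min [c_succ c_lim]] [d_min [d_succ d_lim]].
case: (order_positionP w) => [min_w|v [vw no]|[nw lim_w]].
- by rewrite c_min ?d_min.
- by rewrite (c_succ v) ?(d_succ v) ?IH.
case: (c_lim nw lim_w) (d_lim nw lim_w) => [cs [ch ct]] [ds [dh dt]].
apply: config_eq; rewrite ?cs ?ch // => i.
by apply/idP/idP => [/ct|/dt] h; [apply/dt|apply/ct]; apply: limsup_mono h => u uw; rewrite IH.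
Qed.

Lemma mrun_initial (V W : WO) (g : V -> W) (c : W -> config S C) :
  initial_embedding g -> mrun c -> mrun (c \o g).
Proof.
move=> [mono down] run_c v; case: (run_c (g v)) => [c_min [c_succ c_lim]]; split; last split.
- by move=> min_v; apply: c_min => x /[dup] /down [u gu]; subst x => /mono /min_v.
- move=> u uv no; apply: c_succ => [|x [ux xv]]; first exact/mono.
  by case: (down v x xv) => w gw; subst x; apply: (no w); split; apply/mono.
- move=> [u uv] lim_v; case: c_lim => [|x xv|cs [ch ct]].
  + by exists (g u); apply/mono.
  + case: (down v x xv) => w gw; subst x; case: (lim_v w) => [|y [wy yv]]; first exact/mono.
    by exists (g y); split; apply/mono.
  split=> //; split=> // i; rewrite /= ct; split=> [sup w /mono /sup|sup x xv].
    case=> x [wx [xv cx]]; case: (down v x xv) => y gy; subst x.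
    exists y; split; last by split=> //; apply/mono.
    case: wx => [e|/mono]; [left|by right].
    by case: (wlt_total y w) => [/mono|[//|/mono]]; rewrite e => /wlt_irr.
  case: (down v x xv) => w gw; subst x; case: (sup w) => [|y [wy [yv cy]]]; first exact/mono.
  exists (g y); split; last by split=> //; apply/mono.
  by case: wy => [->|/mono]; [left|right].
Qed.

(* [s b] is the configuration at the beginning of the [b]-th block, at stage [omega * b]. *)
Definition block_run (B : WO) (s : B -> config S C) := forall b : B,
  (is_min b -> s b = minit M) /\
  (nonmin b -> [/\ cstate (s b) = mlim M, chead (s b) = 0 &
     forall i, ctape (s b) i <-> block_limsup (fun u m => ctape (iterates m (s u)) i) b]).

Lemma block_run_min (B : WO) (s : B -> config S C) b :
  block_run s -> is_min b -> s b = minit M.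
Proof. by move=> run; case: (run b). Qed.

Lemma block_run_limit (B : WO) (s : B -> config S C) b (f : C -> bool) : block_run s -> nonmin b ->
  (forall i, block_limsup (fun u m => ctape (iterates m (s u)) i) b <-> f i) ->
  s b = Config (mlim M) 0 f.
Proof.
move=> run nb sup; case: (run b) => _ /(_ nb) [es eh et]; apply: config_eq => //= i.
by apply/idP/idP => [/et /sup|/sup /et].
Qed.

Lemma block_run_limitE (B : WO) (s : B -> config S C) b : block_run s -> nonmin b ->
  s b = Config (mlim M) 0 (ctape (s b)).
Proof. by move=> run nb; case: (run b) => _ /(_ nb) [es eh _]; apply: config_eq. Qed.

Lemma block_run_exists (B : WO) : exists s : B -> config S C, block_run s.
Proof.
pose next b (s : B -> config S C) := if pselect (nonmin b) is left _ then
  Config (mlim M) 0 (fun i => `[< block_limsup (fun u m => ctape (iterates m (s u)) i) b >])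
  else minit M.
have [b s s' ss'|s sE] := @wlt_recursion B (config S C) (minit M) next.
  rewrite /next; case: pselect => // _; congr Config; apply/funext => i; congr asbool.
  by apply/propext; split; apply: limsup_mono => -[u m] /lex_lt_start ub /=; rewrite ss'.
exists s => b; split=> [min_b|nb]; rewrite [s b]sE /next; case: pselect => //.
  by case=> v /min_b.
by move=> _; split=> // i; split=> /asboolP.
Qed.

Definition stages (B : WO) (s : B -> config S C) (x : WOlex B) := iterates x.2 (s x.1).

Lemma mrun_stages (B : WO) (s : B -> config S C) : block_run s -> mrun (stages s).
Proof.
move=> run [b n]; split; last split.
- case: n => [|n] min_b; last by case: (min_b (b, n)); case: (lex_succ b n).
  by apply: (block_run_min run) => u ub; apply: (min_b (u, 0)); left.
- by move=> x xb no; rewrite (lex_succ_pred (conj xb no)).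
- move=> nb lim_b; case: n nb lim_b => [|n] nb lim_b.
    by case: (run b) => _ /(_ (proj2 (lex_nonmin_start b) nb)) [].
  by case: (succ_not_limit (lex_succ b n)).
Qed.

Definition never_halts (y : config S C) := forall n, cstate (iterates n y) <> mhalt M.

Definition halts_in_block (B : WO) (s : B -> config S C) (b : B) (n : nat) :=
  [/\ block_run s, cstate (iterates n (s b)) = mhalt M &
      forall x : WOlex B, wlt x (b, n) -> cstate (stages s x) <> mhalt M].

Lemma halts_in_block_before (B : WO) (s : B -> config S C) b n :
  halts_in_block s b n -> forall u, wlt u b -> never_halts (s u).
Proof. by move=> [_ _ no] u ub m; apply: (no (u, m)); left. Qed.

Lemma halts_in_block_within (B : WO) (s : B -> config S C) b n : halts_in_block s b n ->
  forall m, m < n -> cstate (iterates m (s b)) <> mhalt M.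
Proof. by move=> [_ _ no] m mn; apply: (no (b, m)); right. Qed.

Lemma halts_in_blockI (B : WO) (s : B -> config S C) b n : block_run s ->
  cstate (iterates n (s b)) = mhalt M -> (forall u, wlt u b -> never_halts (s u)) ->
  (forall m, m < n -> cstate (iterates m (s b)) <> mhalt M) -> halts_in_block s b n.
Proof.
move=> run sn before within; split=> // -[u m] /= [ub|[-> mn]].
  exact: before.
exact: within.
Qed.

Lemma halts_in_block_exists (B : WO) (s : B -> config S C) b : block_run s ->
  ~ never_halts (s b) -> exists b n, halts_in_block s b n.
Proof.
move=> run halts.
case: (@wlt_least (WOlex B) (fun x => cstate (stages s x) = mhalt M)) => [|[u m] sx least_x].
  by apply: contrapT => /forallNP no; apply: halts => n; apply: (no (b, n)).
by exists u, m; split=> // y yx sy; apply: (wlt_geF yx); apply: least_x.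
Qed.

Lemma halts_in_block_gt0 (B : WO) (s : B -> config S C) b n :
  cstate (minit M) <> mhalt M -> mlim M <> mhalt M -> halts_in_block s b n -> 0 < n.
Proof.
move=> init_nh lim_nh [run]; case: n => // sb _.
case: (min_or_nonmin b) => [min_b|nb]; first by case: init_nh; rewrite -(block_run_min run min_b).
by case: lim_nh; rewrite -sb (block_run_limitE run nb).
Qed.

Lemma halts_at_of_blocks (B : WO) (s : B -> config S C) b n : halts_in_block s b n ->
  mhalts_at (@upto_top (WOlex B) (b, n)) (stages s \o sval).
Proof.
move=> [run sn before]; split; last split; last split.
- by move=> [x [e|lt]]; [left; apply: eq_exist|right].
- exact: mrun_initial (initial_upto _) (mrun_stages run).
- exact: sn.
- by move=> [x xb] /before.
Qed.

Lemma blocks_of_halts_at (W : WO) (top : W) (c : W -> config S C) : mhalts_at top c ->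
  exists (B : WO) (s : B -> config S C) (g : W -> WOlex B), [/\ initial_embedding g,
    c top = stages s (g top) & halts_in_block s (g top).1 (g top).2].
Proof.
move=> [_ [run [c_top c_before]]]; have [s run_s] := block_run_exists W.
have [|g init_g] := @initial_embedding_exists W (WOlex W) (fun w => (w, 0)).
  by move=> u v uv; left.
have e := mrun_uniq run (mrun_initial init_g (mrun_stages run_s)).
exists W, s, g; split=> //; split=> //; first by rewrite -c_top e.
rewrite -surjective_pairing => x xg; case: init_g => mono down.
case: (down _ _ xg) => v gv; subst x; rewrite -[stages s (g v)](e v).
by apply: c_before; apply/mono.
Qed.

Definition mhalts := exists (W : WO) (top : W) c, mhalts_at top c.

Definition mhalts_with (P : config S C -> Prop) :=
  exists (W : WO) (top : W) c, mhalts_at top c /\ P (c top).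

Definition mclockable (A : WO) :=
  exists (W : WO) (top : W) c, mhalts_at top c /\ iso_below A top.

Lemma mhaltsP : mhalts <-> exists (B : WO) (s : B -> config S C) b n, halts_in_block s b n.
Proof.
split=> [[W [top [c /blocks_of_halts_at [B [s [g [_ _ h]]]]]]]|[B [s [b [n h]]]]].
  by exists B, s, (g top).1, (g top).2.
by do 3!eexists; apply: (halts_at_of_blocks h).
Qed.

Lemma mhalts_withP P : mhalts_with P <->
  exists (B : WO) (s : B -> config S C) b n, halts_in_block s b n /\ P (iterates n (s b)).
Proof.
split=> [[W [top [c [/blocks_of_halts_at [B [s [g [_ e h]]]] Pc]]]]|[B [s [b [n [h Pn]]]]]].
  by exists B, s, (g top).1, (g top).2; split=> //; rewrite e in Pc.
by do 3!eexists; split; first exact: (halts_at_of_blocks h).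
Qed.

Lemma mclockableP A : mclockable A <-> exists (B : WO) (s : B -> config S C) b n,
  halts_in_block s b n /\ iso_below A ((b, n) : WOlex B).
Proof.
split=> [[W [top [c [/blocks_of_halts_at [B [s [g [init_g _ h]]]] iso]]]]|[B [s [b [n [h iso]]]]]].
  exists B, s, (g top).1, (g top).2; split=> //; rewrite -surjective_pairing.
  exact/(iso_below_initial _ _ init_g).
do 3!eexists; split; first exact: (halts_at_of_blocks h).
exact/(iso_below_initial A _ (initial_upto _)).
Qed.

Lemma never_halts_of_not_mhalts : ~ mhalts ->
  forall (B : WO) (s : B -> config S C), block_run s -> forall b, never_halts (s b).
Proof.
move=> no B s run b; apply: contrapT => /(halts_in_block_exists run) [u [n h]].
by apply: no; apply/mhaltsP; exists B, s, u, n.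
Qed.

End BlockRuns.

Definition imachine (p : ittm) a := Machine (iinit p a) (@istep p) (ilim p) (ihalt p).
Definition omachine (q : ottm) a := Machine (oinit q a) (@ostep q) (olim q) (ohalt q).

Lemma ittm_halts_withP p a r : ittm_halts_with p a r <-> exists (B : WO) (s : B -> iconfig p) b n,
  halts_in_block (imachine p a) s b n /\ ioutput (iter n (@istep p) (s b)) = r.
Proof. exact: (mhalts_withP (imachine p a) (fun y => ioutput y = r)). Qed.

Lemma ottm_halts_withP q a r : ottm_halts_with q a r <-> exists (B : WO) (s : B -> oconfig q) b n,
  halts_in_block (omachine q a) s b n /\ ooutput (iter n (@ostep q) (s b)) = r.
Proof. exact: (mhalts_withP (omachine q a) (fun y => ooutput y = r)). Qed.

Lemma ittm_clockableP A : ittm_clockable A <-> exists p (B : WO) (s : B -> iconfig p) b n,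
  halts_in_block (imachine p (fun=> false)) s b n /\ iso_below A ((b, n) : WOlex B).
Proof. by split=> -[p] h; exists p; apply/(mclockableP (imachine p (fun=> false))). Qed.

Lemma ottm_clockableP A : ottm_clockable A <-> exists q (B : WO) (s : B -> oconfig q) b n,
  halts_in_block (omachine q (fun=> false)) s b n /\ iso_below A ((b, n) : WOlex B).
Proof. by split=> -[q] h; exists q; apply/(mclockableP (omachine q (fun=> false))). Qed.

(** * Limits over a block *)

Definition infinitely_often (f : nat -> bool) := forall m, exists n, m <= n /\ f n.

Lemma infinitely_often_eventually (f : nat -> bool) m c :
  (forall n, m <= n -> f n = c) -> infinitely_often f <-> c.
Proof.
move=> fc; split=> [/(_ m) [n [mn]]|hc k]; first by rewrite fc.
by exists (maxn k m); rewrite leq_maxl fc // leq_maxr.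
Qed.

Section BlockLimsup.
Variable B : WO.
Implicit Types (u v b : B) (f : B -> nat -> bool).

Lemma block_limsup_succ f u b : is_succ u b -> block_limsup f b <-> infinitely_often (f u).
Proof.
move=> ub; split=> [sup m|inf_u [v l] /lex_lt_start vb].
  case: (sup (u, m)) => [|[v n] [mn [/lex_lt_start vb fvn]]]; first by left; case: ub.
  case: mn => [[e e']|/= [uv|[e mn]]]; first by subst v n; exists m.
    by case: (wlt_geF uv); apply: le_pred ub vb.
  by exists n; rewrite e; split=> //; apply: ltnW.
case: (inf_u l.+1) => n [ln fun_]; exists (u, n); split; last first.
  by split=> //; apply/lex_lt_start; case: ub.
by right; case: (le_pred ub vb) => [->|vu]; [right|left].
Qed.

Lemma block_limsup_limit f b : is_limit b -> block_limsup f b <->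
  (forall v, wlt v b -> exists u, [/\ wlt v u, wlt u b & exists m, f u m]).
Proof.
move=> lim_b; split=> [sup v vb|sup [v l] /lex_lt_start vb].
  case: (limit_succ lim_b vb) => w [vw _] wb.
  case: (sup (w, 0)) => [|[u m] [wu [/lex_lt_start ub fum]]]; first by left.
  exists u; split=> //; last by exists m.
  by case: wu => [[-> _] //|/= [wu|[<- _] //]]; apply: wlt_trans wu.
case: (sup v vb) => u [vu ub [m fum]]; exists (u, m); split; first by right; left.
by split=> //; left.
Qed.

End BlockLimsup.

Definition convex_embedding (B B' : WO) (e : B -> B') :=
  (forall u v, wlt u v -> wlt (e u) (e v)) /\
  (forall u v x, wlt (e u) x -> wlt x (e v) -> exists w, x = e w).

Lemma convex_embedding_id (B : WO) : convex_embedding (fun b : B => b).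
Proof. by split=> // u v x _ _; exists x. Qed.

Section ConvexEmbedding.
Variables (B B' : WO) (e : B -> B').
Hypothesis convex_e : convex_embedding e.

Lemma convex_mono u v : wlt u v -> wlt (e u) (e v).
Proof. by case: convex_e => mono _; apply: mono. Qed.

Lemma convex_reflect u v : wlt (e u) (e v) -> wlt u v.
Proof.
case: (wlt_total u v) => [//|[->|/convex_mono vu uv]]; first by move/wlt_irr.
by case: (wlt_asym vu uv).
Qed.

Lemma convex_between u v x : wlt (e u) x -> wlt x (e v) -> exists2 w, x = e w & wlt w v.
Proof.
by case: convex_e => _ conv ux xv; case: (conv u v x) => // w xw; exists w; rewrite ?xw // -?xw;
  apply: convex_reflect; rewrite -xw.
Qed.

Lemma convex_nonmin b : nonmin b -> nonmin (e b).
Proof. by case=> v /convex_mono; exists (e v). Qed.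

Lemma convex_succ u b : is_succ u b -> is_succ (e u) (e b).
Proof.
case=> ub no; split; first exact: convex_mono.
move=> x [ux xb]; case: (convex_between ux xb) => w xw wb; subst x.
by apply: (no w); split=> //; apply: convex_reflect.
Qed.

Lemma convex_cofinal b x : nonmin b -> wlt x (e b) -> exists2 v, wlt v b & wle x (e v).
Proof.
case=> v0 v0b xb; case: (wle_or_lt x (e v0)) => [xv0|v0x]; first by exists v0.
by case: (convex_between v0x xb) => w -> wb; exists w => //; left.
Qed.

Lemma convex_limit b : is_limit b -> is_limit (e b).
Proof.
move=> lim_b; split; first by apply: convex_nonmin; case: lim_b.
move=> x xb; case: (convex_cofinal (proj1 lim_b) xb) => v vb xv.
case: (limit_succ lim_b vb) => w [vw _] wb; exists (e w).
by split; [apply: wle_lt_trans xv (convex_mono vw)|apply: convex_mono].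
Qed.

Lemma block_limsup_transfer (f : B -> nat -> bool) (g : B' -> nat -> bool) b :
  (forall u, wlt u b -> infinitely_often (f u) <-> infinitely_often (g (e u))) ->
  (forall u, wlt u b -> nonmin u -> (exists n, f u n) <-> (exists n, g (e u) n)) ->
  nonmin b -> block_limsup f b <-> block_limsup g (e b).
Proof.
move=> inf_fg ex_fg nb; case: (order_positionP b) => [min_b|u ub|lim_b].
- by case: nb => v /min_b.
- rewrite (block_limsup_succ _ ub) (block_limsup_succ _ (convex_succ ub)).
  by apply: inf_fg; case: ub.
rewrite (block_limsup_limit _ lim_b) (block_limsup_limit _ (convex_limit lim_b)); split=> sup.
  move=> x /(convex_cofinal nb) [v vb xv]; case: (sup v vb) => u [vu ub fu].
  exists (e u); split; [|exact: convex_mono|by apply/ex_fg => //; exists v].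
  exact: wle_lt_trans xv (convex_mono vu).
move=> v vb; case: (sup (e v) (convex_mono vb)) => x [vx xb gx].
case: (convex_between vx xb) => u xu ub; subst x; have vu := convex_reflect vx.
by exists u; split=> //; apply/ex_fg => //; exists v.
Qed.

End ConvexEmbedding.

(** * Simulations *)

Section Paths.
Variables (S C : Type) (step : config S C -> config S C).
Implicit Types (x y z : config S C) (U V : config S C -> Prop).

Definition reaches U x y :=
  exists2 k, iter k step x = y & forall t, t < k -> U (iter t step x).

Definition progresses U x y := U x /\ reaches U (step x) y.

Lemma reaches_refl U x : reaches U x x. Proof. by exists 0. Qed.

Lemma progressesW U x y : progresses U x y -> reaches U x y.
Proof.
case=> Ux [k ky kU]; exists k.+1; first by rewrite iterSr.
by case=> // t tk; rewrite iterSr; apply: kU.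
Qed.

Lemma progresses1 U x : U x -> progresses U x (step x).
Proof. by split=> //; apply: reaches_refl. Qed.

Lemma reaches_trans U y x z : reaches U x y -> reaches U y z -> reaches U x z.
Proof.
move=> [k <- kU] [l <- lU]; exists (l + k); first by rewrite iterD.
move=> t tl; case: (ltnP t k) => [/kU //|kt].
by rewrite -(subnK kt) iterD; apply: lU; rewrite ltn_subLR // addnC.
Qed.

Lemma progresses_reaches U y x z : progresses U x y -> reaches U y z -> progresses U x z.
Proof. by case=> Ux xy yz; split=> //; apply: reaches_trans yz. Qed.

Lemma reaches_progresses U y x z : reaches U x y -> progresses U y z -> progresses U x z.
Proof.
case=> -[|k] <- kU yz; first exact: yz.
split; first exact: (kU 0).
apply: reaches_trans (progressesW yz); exists k; first by rewrite -iterSr.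
by move=> t tk; rewrite -iterSr; apply: kU.
Qed.

Lemma progresses_trans U y x z : progresses U x y -> progresses U y z -> progresses U x z.
Proof. by move=> xy yz; apply: progresses_reaches (progressesW yz). Qed.

Lemma reaches_walk (f : nat -> config S C) k U x y : f 0 = x -> f k = y ->
  (forall i, i < k -> U (f i) /\ step (f i) = f i.+1) -> reaches U x y.
Proof.
move=> <- <- walk; have walk_iter i : i <= k -> iter i step (f 0) = f i.
  by elim: i => //= i IH ik; rewrite IH ?(ltnW ik) //; case: (walk i ik).
exists k; first exact: walk_iter.
by move=> t tk; rewrite walk_iter ?(ltnW tk) //; case: (walk t tk).
Qed.

Lemma sub_reaches U V x y : (forall z, U z -> V z) -> reaches U x y -> reaches V x y.
Proof. by move=> UV [k ky kU]; exists k => // t /kU /UV. Qed.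

Lemma sub_progresses U V x y : (forall z, U z -> V z) -> progresses U x y -> progresses V x y.
Proof. by move=> UV [Ux xy]; split; [apply: UV|apply: sub_reaches xy]. Qed.

End Paths.

(* From stage [t0] on the computation passes through [R 0], [R 1], ..., and it satisfies [U n]
   from the stage at which it is in [R n] to the one at which it gets to [R n.+1]. *)
Section Waypoints.
Variables (S C : Type) (step : config S C -> config S C) (x : config S C).
Variables (R U : nat -> config S C -> Prop) (t0 : nat).
Hypothesis R_start : R 0 (iter t0 step x).

Lemma waypoint_reached N :
  (forall n z, n < N -> R n z -> exists2 z', progresses step (U n) z z' & R n.+1 z') ->
  exists t, [/\ t0 + N <= t, R N (iter t step x) &
    forall t', t0 <= t' < t -> exists2 n, n < N & U n (iter t' step x)].
Proof.
elim: N => [_|N IH next]; first by exists t0; rewrite addn0; split=> // t'; case: leqP.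
case: IH => [n z nN|t [Nt Rt Ut]]; first exact: next (ltnW nN).
case: (next N _ (ltnSn N) Rt) => _ [Ux [k <- kU]] Rk; exists (k + t.+1).
rewrite iterD; split=> //; first by rewrite addnS; lia.
move=> t' /andP [t0t' t'k]; case: (ltnP t' t) => [t't|].
  by case: (Ut t') => [|n nN]; rewrite ?t0t' //; exists n => //; apply: ltnW.
rewrite leq_eqVlt => /orP [/eqP <-|tt']; first by exists N.
by exists N => //; rewrite -(subnK tt') iterD; apply: kU; lia.
Qed.

Hypothesis R_next : forall n z, R n z -> exists2 z', progresses step (U n) z z' & R n.+1 z'.

Lemma waypoint_cover n t t1 : R n (iter t step x) -> t <= t1 ->
  exists2 m, n <= m & U m (iter t1 step x).
Proof.
move=> Rt; move: {2}(t1 - t).+1 (ltnSn (t1 - t)) => d; elim: d n t Rt => // d IH n t Rt td tt1.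
case: (R_next Rt) => z' [Ux [k kz kU]] Rz'.
move: tt1; rewrite leq_eqVlt => /orP [/eqP <-|tt1]; first by exists n.
case: (ltnP t1 (k + t.+1)) => [t1k|kt1].
  by exists n => //; rewrite -(subnK tt1) iterD; apply: kU; lia.
case: (IH n.+1 (k + t.+1)); rewrite ?iterD ?kz //; first lia.
by move=> m nm Um; exists m => //; apply: ltnW.
Qed.

Variables (j : C) (f : nat -> bool).
Hypothesis R_cell : forall n z, R n z -> ctape z j = f n.
Hypothesis U_cell : forall n z, U n z -> ctape z j = f n \/ ctape z j = f n.+1.

Lemma waypoint_infinitely_often :
  infinitely_often f <-> infinitely_often (fun t => ctape (iter t step x) j).
Proof.
split=> inf N.
  case: (inf N) => n [Nn fn].
  case: (@waypoint_reached n) => [m z _|t [nt Rt _]]; first exact: R_next.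
  by exists t; rewrite (R_cell Rt); split=> //; lia.
case: (@waypoint_reached N) => [m z _|t [Nt Rt _]]; first exact: R_next.
case: (inf t) => t1 [tt1 ft]; case: (waypoint_cover Rt tt1) => n Nn /U_cell [] e.
  by exists n; rewrite -e.
by exists n.+1; rewrite -e; split=> //; apply: leqW.
Qed.

Lemma waypoint_ex : (forall t, t < t0 -> ctape (iter t step x) j = f 0) ->
  (exists n, f n) <-> (exists t, ctape (iter t step x) j).
Proof.
move=> f_start; split=> [[n fn]|[t]].
  case: (@waypoint_reached n) => [m z _|t [_ Rt _]]; first exact: R_next.
  by exists t; rewrite (R_cell Rt).
case: (ltnP t t0) => [/f_start ->|t0t]; first by exists 0.
by case: (waypoint_cover R_start t0t) => n _ /U_cell [] ->; [exists n|exists n.+1].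
Qed.

End Waypoints.

(* A tape cell that copies a cell of the simulated machine or is constant. *)
Definition view (C : Type) (l : C + bool) (t : C -> bool) : bool :=
  match l with inl i => t i | inr c => c end.

Lemma block_limsup_view S C (M : machine S C) (B : WO) (s : B -> config S C) b l :
  block_run M s -> nonmin b ->
  block_limsup (fun u n => view l (ctape (iter n (mstep M) (s u)))) b <-> view l (ctape (s b)).
Proof.
move=> run nb; case: l => [i|c] /=; first by case: (run b) => _ /(_ nb) [_ _ ->].
exact: limsup_const (proj1 (lex_nonmin_start b) nb).
Qed.

(* The cells [cell j] of [M'] follow the cells of [M] named by [src j]. [R] relates the
   configurations of [M] to those by which [M'] represents them; between two of these, [M'] is
   in [Q] and each followed cell has its old or its new value. *)
Section Simulation.
Variables (S C S' C' J : Type) (M : machine S C) (M' : machine S' C').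
Variables (cell : J -> C') (src : J -> C + bool).
Local Notation step := (mstep M).
Local Notation step' := (mstep M').
Implicit Types (y : config S C) (z w : config S' C').

Definition agrees y z := forall j, ctape z (cell j) = view (src j) (ctape y).

Definition between y y' z := forall j,
  ctape z (cell j) = view (src j) (ctape y) \/ ctape z (cell j) = view (src j) (ctape y').

Variables (G : config S C -> Prop) (Q : config S' C' -> Prop).
Variable R : config S C -> config S' C' -> Prop.
Hypothesis R_agrees : forall y z, R y z -> agrees y z.
Hypothesis R_step : forall y z, G y -> R y z ->
  exists2 z', progresses step' (fun w => Q w /\ between y (step y) w) z z' & R (step y) z'.

Definition starts (P : config S' C' -> Prop) y z := exists2 z', reaches step' P z z' & R y z'.

Lemma simulated_reaches y z N : (forall n, n < N -> G (iter n step y)) ->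
  starts Q y z -> starts Q (iter N step y) z.
Proof.
move=> Gy [_ [t0 <- Qt0] R0].
have [||t [_ Rt Ut]] := @waypoint_reached _ _ step' z (fun n => R (iter n step y))
    (fun n w => Q w /\ between (iter n step y) (iter n.+1 step y) w) t0 _ N.
- exact: R0.
- by move=> n w nN Rw; apply: R_step Rw; apply: Gy.
exists (iter t step' z) => //; exists t => // t' t't.
by case: (ltnP t' t0) => [/Qt0 //|t0t']; case: (Ut t') => [|n _ []]; rewrite ?t0t'.
Qed.

Section Forever.
Variables (y : config S C) (z : config S' C').
Hypothesis Gy : forall n, G (iter n step y).

Let R_next n w : R (iter n step y) w ->
  exists2 w', progresses step' (fun v => Q v /\ between (iter n step y) (iter n.+1 step y) v) w w'
            & R (iter n.+1 step y) w'.
Proof. exact: R_step. Qed.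

Lemma simulated_forever : starts Q y z -> forall t, Q (iter t step' z).
Proof.
move=> [_ [t0 <- Qt0] R0] t; case: (ltnP t t0) => [/Qt0 //|t0t].
by case: (waypoint_cover (R := fun n => R (iter n step y)) R_next (n := 0) R0 t0t) => n _ [].
Qed.

Lemma simulated_infinitely_often j : starts Q y z ->
  infinitely_often (fun n => view (src j) (ctape (iter n step y))) <->
  infinitely_often (fun t => ctape (iter t step' z) (cell j)).
Proof.
move=> [_ [t0 <- _] R0].
apply: (waypoint_infinitely_often (R := fun n => R (iter n step y)) R0 R_next).
  by move=> n w /R_agrees.
by move=> n w [_].
Qed.

Lemma simulated_ex j : starts (fun w => Q w /\ agrees y w) y z ->
  (exists n, view (src j) (ctape (iter n step y))) <->
  (exists t, ctape (iter t step' z) (cell j)).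
Proof.
move=> [_ [t0 <- Qt0] R0].
apply: (waypoint_ex (R := fun n => R (iter n step y)) R0 R_next).
- by move=> n w /R_agrees.
- by move=> n w [_].
- by move=> t /Qt0 [_].
Qed.

End Forever.

Variables (B B' : WO) (e : B -> B').
Hypothesis convex_e : convex_embedding e.
Variables (s : B -> config S C) (s' : B' -> config S' C').
Hypothesis run : block_run M s.
Hypothesis run' : block_run M' s'.

Definition synced b := nonmin b -> agrees (s b) (s' (e b)).

Definition block_starts b :=
  starts (fun w => Q w /\ (nonmin b -> agrees (s b) w)) (s b) (s' (e b)).

Lemma block_startsW b : block_starts b -> starts Q (s b) (s' (e b)).
Proof. by case=> z' reach Rz'; exists z' => //; apply: sub_reaches reach => w []. Qed.

Variable good : B -> Prop.
Hypothesis good_G : forall b, good b -> forall n, G (iter n step (s b)).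
Hypothesis good_starts : forall b, good b -> synced b -> block_starts b.

Theorem simulation_synced b : (forall u, wlt u b -> good u) -> synced b.
Proof.
elim/wlt_ind: b => b IH good_below nb j.
have start u : wlt u b -> block_starts u.
  move=> ub; apply: good_starts (good_below u ub) _; apply: IH => // v vu.
  by apply: good_below; apply: wlt_trans ub.
have [] := run' (e b) => _ /(_ (convex_nonmin convex_e nb)) [_ _ /(_ (cell j)) lim'].
have lim := block_limsup_view (src j) run nb.
suff transfer : block_limsup (fun u n => view (src j) (ctape (iter n step (s u)))) b <->
    block_limsup (fun u n => ctape (iter n step' (s' u)) (cell j)) (e b).
  by apply/idP/idP => [/lim' /transfer /lim|/lim /transfer /lim'].
apply: (block_limsup_transfer convex_e) nb => [u ub|u ub nu].
  apply: simulated_infinitely_often; first exact: good_G (good_below u ub).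
  exact: block_startsW (start u ub).
apply: simulated_ex; first exact: good_G (good_below u ub).
case: (start u ub) => z' reach Rz'; exists z' => //.
by apply: sub_reaches reach => w [Qw /(_ nu)].
Qed.

Theorem simulation_forever b : (forall u, wle u b -> good u) ->
  forall n, Q (iter n step' (s' (e b))).
Proof.
move=> good_b; have gb := good_b b (wle_refl b).
apply: (simulated_forever (y := s b)); first exact: good_G.
apply/block_startsW/good_starts => //.
by apply: simulation_synced => u ub; apply: good_b; right.
Qed.

End Simulation.

Definition transit (S C S' C' : Type) (halt : S') (src : C' -> C + bool)
    (y y' : config S C) (w : config S' C') :=
  cstate w <> halt /\ between id src y y' w.

Lemma block_run_agrees S C S' C' (M' : machine S' C') (B' : WO) (s' : B' -> config S' C')
    (src : C' -> C + bool) (y : config S C) b : block_run M' s' -> nonmin b ->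
  agrees id src y (s' b) -> s' b = Config (mlim M') 0 (fun j => view (src j) (ctape y)).
Proof. by move=> run' nb agr; rewrite (block_run_limitE run' nb); congr Config; apply/funext. Qed.

Section EncodedSimulation.
Variables (S C S' C' : Type) (M : machine S C) (M' : machine S' C').
Variables (src : C' -> C + bool) (enc : config S C -> config S' C').
Variable G : config S C -> Prop.
Hypothesis enc_agrees : forall y, agrees id src y (enc y).
Hypothesis enc_step : forall y, G y ->
  progresses (mstep M') (transit (mhalt M') src y (mstep M y)) (enc y) (enc (mstep M y)).
Variables (B B' : WO) (e : B -> B').
Hypothesis convex_e : convex_embedding e.
Variables (s : B -> config S C) (s' : B' -> config S' C').
Hypothesis run : block_run M s.
Hypothesis run' : block_run M' s'.
Local Notation running := (fun w => cstate w <> mhalt M').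
Local Notation encodes := (fun y z => z = enc y).

Definition encoded_starts b :=
  reaches (mstep M') (fun w => running w /\ (nonmin b -> agrees id src (s b) w))
    (s' (e b)) (enc (s b)).

Let encodes_agrees y z : encodes y z -> agrees id src y z.
Proof. by move=> ->. Qed.

Let encodes_step y z : G y -> encodes y z ->
  exists2 z', progresses (mstep M') (transit (mhalt M') src y (mstep M y)) z z'
            & encodes (mstep M y) z'.
Proof. by move=> Gy ->; exists (enc (mstep M y)); first exact: enc_step. Qed.

Lemma encoded_reaches b n : encoded_starts b ->
  (forall m, m < n -> G (iter m (mstep M) (s b))) ->
  reaches (mstep M') running (s' (e b)) (enc (iter n (mstep M) (s b))).
Proof.
move=> start Gb; have [|z reach zE] := simulated_reaches (M' := M') encodes_step Gb (z := s' (e b)).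
  by exists (enc (s b)) => //; apply: sub_reaches start => w [].
by rewrite -zE.
Qed.

Variable good : B -> Prop.
Hypothesis good_G : forall b, good b -> forall n, G (iter n (mstep M) (s b)).
Hypothesis good_starts : forall b, good b -> synced id src e s s' b -> encoded_starts b.

Let good_block_starts b : good b -> synced id src e s s' b ->
  block_starts M' id src running encodes e s s' b.
Proof. by move=> good_b sync; exists (enc (s b)) => //; apply: good_starts. Qed.

Lemma encoded_synced b : (forall u, wlt u b -> good u) -> synced id src e s s' b.
Proof.
exact: (simulation_synced encodes_agrees encodes_step convex_e run run' good_G good_block_starts).
Qed.

Lemma encoded_limit b : (forall u, wlt u b -> good u) -> nonmin b ->
  s' (e b) = Config (mlim M') 0 (fun j => view (src j) (ctape (s b))).
Proof.
move=> good_below nb; apply: (block_run_agrees run' (convex_nonmin convex_e nb)).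
exact: encoded_synced.
Qed.

Lemma encoded_never_halts b : (forall u, wle u b -> good u) -> never_halts M' (s' (e b)).
Proof.
exact: (simulation_forever encodes_agrees encodes_step convex_e run run' good_G good_block_starts).
Qed.

End EncodedSimulation.

Section HaltingSimulation.
Variables (S C S' C' : Type) (M : machine S C) (M' : machine S' C').
Variables (src : C' -> C + bool) (enc : config S C -> config S' C').
Hypothesis enc_agrees : forall y, agrees id src y (enc y).
Hypothesis enc_step : forall y, cstate y <> mhalt M ->
  progresses (mstep M') (transit (mhalt M') src y (mstep M y)) (enc y) (enc (mstep M y)).
Variables (B B' : WO) (e : B -> B').
Hypothesis convex_e : convex_embedding e.
Variables (s : B -> config S C) (s' : B' -> config S' C').
Hypothesis run : block_run M s.
Hypothesis run' : block_run M' s'.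
Hypothesis synced_starts : forall b, synced id src e s s' b -> encoded_starts M' src enc e s s' b.

Lemma halting_simulation_never_halts b : (forall u, wle u b -> never_halts M (s u)) ->
  never_halts M' (s' (e b)).
Proof.
apply: (encoded_never_halts enc_agrees enc_step convex_e run run') => // u _.
exact: synced_starts.
Qed.

Lemma halting_simulation_reaches b n : halts_in_block M s b n ->
  reaches (mstep M') (fun w => cstate w <> mhalt M') (s' (e b)) (enc (iter n (mstep M) (s b))).
Proof.
move=> halts; have sync : synced id src e s s' b.
  apply: (encoded_synced enc_agrees enc_step convex_e run run') (halts_in_block_before halts) => //.
  by move=> u _; apply: synced_starts.
exact: (encoded_reaches (M := M) enc_step (synced_starts sync) (halts_in_block_within halts)).
Qed.

End HaltingSimulation.

(** * Startup blocks *)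

Definition nth_block (B : WO) m (x : B) := exists2 b0, is_min b0 & nth_succ b0 m x.

Lemma nth_blockS (B : WO) m (x y : B) : nth_block m x -> is_succ x y -> nth_block m.+1 y.
Proof. by case=> b0 min0 xm xy; exists b0 => //; exists x. Qed.

Lemma nth_block_mono (B : WO) m n (x y : B) :
  nth_block m x -> nth_block n y -> m < n -> wlt x y.
Proof.
move=> [b0 min0 xm] [b1 min1 yn]; apply: nth_succ_mono xm _.
by case: (min_le b1 min0) => [<- //|/min1].
Qed.

Lemma nth_block_uniq (B : WO) m (x y : B) : nth_block m x -> nth_block m y -> x = y.
Proof.
move=> [b0 min0 xm] [b1 min1 ym]; apply: nth_succ_uniq xm _.
by case: (min_le b1 min0) => [<- //|/min1].
Qed.

Section Startup.
Variable K : nat -> Prop.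
Hypothesis K_down : forall m, K m.+1 -> K m.

Definition startup_block (B : WO) (x : B) := exists2 m, K m & nth_block m x.

Record startup_embedding (B B' : WO) (e : B -> B') : Prop := {
  startup_convex : convex_embedding e;
  startup_below : forall b v, is_min b -> wlt v (e b) -> startup_block v;
  startup_all : forall b m, K m -> exists2 v, wlt v (e b) & nth_block m v }.

Lemma startup_cover (B B' : WO) (e : B -> B') b x : startup_embedding e -> wlt x (e b) ->
  startup_block x \/ exists2 u, x = e u & wlt u b.
Proof.
move=> emb xb; have [b0 min0 b0b] := min_exists b.
case: (wlt_total x (e b0)) => [xb0|[xb0|b0x]]; first by left; apply: startup_below emb _ _ min0 xb0.
  right; exists b0 => //; case: b0b => // bb0; subst b.
  by case: (@wlt_irr _ x); rewrite {2}xb0.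
by right; apply: (convex_between (startup_convex emb)) b0x xb.
Qed.

Lemma startup_embedding_sum (B : WO) : exists (B' : WO) (e : B -> B'),
  startup_embedding e /\ forall b, exists v, wlt (e b) v.
Proof.
pose B' := WOsum (@WOsub WOnat K) (WOsum B WOnat).
pose block m (Km : K m) : B' := inl (exist K m Km).
have nth_blockE m (Km : K m) : nth_block m (block m Km).
  elim: m Km => [|m IH] Km; first by exists (block 0 Km) => // -[[m Km']|x] [].
  apply: nth_blockS (IH (K_down Km)) _; split; first exact: ltnSn.
  by case=> [[l Kl] [/= h1 h2]|x [_ []]]; lia.
exists B', (fun b => inr (inl b)); split=> [|b]; last by exists (inr (inr (0 : WOnat))).
split=> [|b|b m Km].
- by split=> // u v [x|[w|x]] //; exists w.
- move=> v min_b; case: v => [[m Km] _|[u /min_b|x []]] //.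
  by exists m => //; apply: nth_blockE.
- by exists (block m Km); last exact: nth_blockE.
Qed.

Lemma startup_embedding_sub (B' : WO) :
  @startup_embedding (WOsub (fun x : B' => ~ startup_block x)) B' sval.
Proof.
have below (b : B') m : ~ startup_block b -> K m -> exists2 v, wlt v b & nth_block m v.
  move=> nb; elim: m => [|m IH] Km.
    have [v min_v [bv|vb]] := min_exists b; last by exists v => //; exists v.
    by case: nb; exists 0 => //; exists b; rewrite ?bv.
  have [v vb vm] := IH (K_down Km); have [w vw wb] := succ_exists vb.
  have wm := nth_blockS vm vw; exists w => //.
  by case: wb => // bw; case: nb; exists m.+1; rewrite ?bw.
split=> [|b v min_b vb|[b nb] m]; last exact: below.
- split=> // [[u nu]] [v nv] x ux _; suff nx : ~ startup_block x by exists (exist _ x nx).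
  case=> m Km xm; have [w wu wm] := below u m nu Km.
  by apply: (wlt_asym wu); rewrite (nth_block_uniq wm xm).
- by apply: contrapT => nv; apply: (min_b (exist _ v nv)).
Qed.

Section Transfer.
Variables (S C S' C' : Type) (M : machine S C) (M' : machine S' C').
Hypothesis startup_never_halts : forall (B' : WO) (s' : B' -> config S' C'),
  block_run M' s' -> forall x, startup_block x -> never_halts M' (s' x).
Hypothesis simulated_never_halts :
  forall (B B' : WO) (e : B -> B') (s : B -> config S C) (s' : B' -> config S' C'),
  startup_embedding e -> block_run M s -> block_run M' s' ->
  forall b, (forall u, wle u b -> never_halts M (s u)) -> never_halts M' (s' (e b)).

Lemma startup_not_mhalts : ~ mhalts M -> ~ mhalts M'.
Proof.
move=> no /mhaltsP [B' [s' [b' [n [run' halt' _]]]]].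
have [[m Km bm]|nb] := EM (startup_block b').
  by apply: (startup_never_halts run' _ halt'); exists m.
pose B := WOsub (fun x : B' => ~ startup_block x); pose b : B := exist _ b' nb.
have [s run] := block_run_exists M B.
apply: (simulated_never_halts (b := b) (startup_embedding_sub B') run run' _ halt').
by move=> u _; apply: (never_halts_of_not_mhalts no run).
Qed.

Lemma startup_halts (B : WO) (s : B -> config S C) b n : halts_in_block M s b n ->
  exists (B' : WO) (e : B -> B') (s' : B' -> config S' C'),
  [/\ startup_embedding e, exists v, wlt (e b) v, block_run M' s' &
      forall x, wlt x (e b) -> never_halts M' (s' x)].
Proof.
move=> halts; have [B' [e [emb room]]] := startup_embedding_sum B.
have [s' run'] := block_run_exists M' B'; exists B', e, s'; split=> // x xb.
case: (startup_cover emb xb) => [|[u -> ub]]; first exact: startup_never_halts.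
have run : block_run M s by case: halts.
apply: (simulated_never_halts emb run run') => v vu.
by apply: (halts_in_block_before halts); apply: wle_lt_trans ub.
Qed.

End Transfer.
End Startup.

(** * Finite clocks *)

Definition counter_next n (x : option 'I_n) : option 'I_n :=
  if x is Some i then insub i.+1 else None.

Lemma counter_halts_in_block n C (M : machine (option 'I_n.+2) C) (B : WO) (b : B) :
  (forall y, cstate (mstep M y) = counter_next (cstate y)) ->
  cstate (minit M) = Some ord0 -> mhalt M = Some ord_max ->
  is_min b -> exists s, halts_in_block M s b n.+1.
Proof.
move=> next start halt min_b; have [s run] := block_run_exists M B; exists s.
have count m : m <= n.+1 -> cstate (iter m (mstep M) (s b)) = Some (inord m).
  elim: m => [_|m IH mn] /=.
    by rewrite (block_run_min run min_b) start; congr Some; apply: val_inj; rewrite /= inordK.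
  rewrite next IH; last exact: ltnW.
  by rewrite /= inordK ?ltnS 1?ltnW // insubT; congr Some; apply: val_inj; rewrite /= inordK.
apply: halts_in_blockI => // [|u /min_b //|m mn].
  by rewrite count // halt; congr Some; apply: val_inj; rewrite /= inordK.
by rewrite count 1?ltnW // halt => -[/(congr1 val)]; rewrite /= inordK; lia.
Qed.

Lemma counter_distinct n : [/\ Some ord0 != Some (@ord_max n.+1),
  None != Some (@ord_max n.+1) & Some (@ord0 n.+1) != None].
Proof. by []. Qed.

Definition icounter n : ittm :=
  @Build_ittm (option 'I_n.+2) _ _ _ (counter_distinct n) (fun x b => (counter_next x, b, true)).

Definition ocounter n : ottm :=
  @Build_ottm (option 'I_n.+2) _ _ _ (counter_distinct n) (fun x b => (counter_next x, b, true)).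

Lemma icounter_halts n (B : WO) (b : B) : is_min b ->
  exists s, halts_in_block (imachine (icounter n) (fun=> false)) s b n.+1.
Proof. exact: counter_halts_in_block. Qed.

Lemma ocounter_halts n (B : WO) (b : B) : is_min b ->
  exists s, halts_in_block (omachine (ocounter n) (fun=> false)) s b n.+1.
Proof. exact: counter_halts_in_block. Qed.

Lemma ittm_halts_gt0 (p : ittm) a (B : WO) (s : B -> iconfig p) b n :
  halts_in_block (imachine p a) s b n -> 0 < n.
Proof. by case: (idistinct p) => /eqP ? /eqP ? _; apply: halts_in_block_gt0. Qed.

Lemma ottm_halts_gt0 (q : ottm) a (B : WO) (s : B -> oconfig q) b n :
  halts_in_block (omachine q a) s b n -> 0 < n.
Proof. by case: (odistinct q) => /eqP ? /eqP ? _; apply: halts_in_block_gt0. Qed.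

(** * Double-head machines on three tapes *)

Inductive sim_state (T : Type) := Sim of T | SimLeft of T & bool | SimRight of T & bool & bool.
Arguments Sim {T}. Arguments SimLeft {T}. Arguments SimRight {T}.

Definition sim_state_encode T (x : sim_state T) : T + T * bool + T * bool * bool :=
  match x with
  | Sim s => inl (inl s) | SimLeft s r => inl (inr (s, r)) | SimRight s w mv => inr (s, w, mv)
  end.
Definition sim_state_decode T (x : T + T * bool + T * bool * bool) : sim_state T :=
  match x with
  | inl (inl s) => Sim s | inl (inr (s, r)) => SimLeft s r | inr (s, w, mv) => SimRight s w mv
  end.
Lemma sim_state_encodeK T : cancel (@sim_state_encode T) (@sim_state_decode T). Proof. by case. Qed.
HB.instance Definition _ (T : finType) :=
  Finite.copy (sim_state T) (can_type (@sim_state_encodeK T)).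

Inductive mode := MStart | MLimit | MHalt.
Definition mode_encode x : 'I_3 :=
  match x with MStart => inord 0 | MLimit => inord 1 | MHalt => inord 2 end.
Definition mode_decode (x : 'I_3) := match val x with 0 => MStart | 1 => MLimit | _ => MHalt end.
Lemma mode_encodeK : cancel mode_encode mode_decode.
Proof. by case; rewrite /mode_decode /= inordK. Qed.
HB.instance Definition _ := Finite.copy mode (can_type mode_encodeK).

(* The pad is cell 0 of the scratch tape, cell n is cell n of the output tape, and
   the input tape marks the leftmost column. *)
Definition olink (x : tape3 * nat) : option nat + bool :=
  match x with
  | (Inp, n) => inr (n == 0)
  | (Scr, n) => if n == 0 then inl None else inr false
  | (Out, n) => inl (Some n)
  end.

Definition otape (t : option nat -> bool) (x : tape3 * nat) : bool := view (olink x) t.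

(* Away from column 0 the left cell is one column to the left of the head: [SimLeft] goes
   there with the right cell in memory, [SimRight] comes back with its new value. *)
Definition sim_delta (q : ottm) (T : Type) (inj : sim_state (ost q) -> T) (tgt : ost q -> T)
    (x : sim_state (ost q)) (b : bool * bool * bool) : T * (bool * bool * bool) * bool :=
  let: (i, z, o) := b in
  match x with
  | Sim s =>
      if i then let: (s', (wl, wr), mv) := odelta s (z, o) in (tgt s', (true, wl, wr), mv)
      else (inj (SimLeft s o), b, false)
  | SimLeft s r =>
      let: (s', (wl, wr), mv) := odelta s (o, r) in (inj (SimRight s' wr mv), (i, z, wl), true)
  | SimRight s wr mv => (tgt s, (i, z, wr), mv)
  end.

Section OttmOnIttm.
Variables (q : ottm) (p : ittm) (inj : sim_state (ost q) -> ist p) (tgt : ost q -> ist p).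
Hypothesis idelta_inj : forall x b, idelta (inj x) b = sim_delta inj tgt x b.
Hypothesis inj_not_halt : forall x, inj x <> ihalt p.

Definition oenc (y : oconfig q) : iconfig p :=
  Config (tgt (cstate y)) (chead y) (otape (ctape y)).

Lemma oenc_step_leftmost s t : tgt s = inj (Sim s) ->
  istep (oenc (Config s 0 t)) = oenc (ostep (Config s 0 t)).
Proof.
move=> ts; rewrite /istep /ostep /oenc /= ts idelta_inj /= /otape /=.
by case: odelta => -[s' [wl wr]] mv; apply: config_eq => //= -[[] [|n]].
Qed.

Lemma oenc_step_inner s h t : tgt s = inj (Sim s) ->
  let y := Config s h.+1 t : oconfig q in
  progresses (@istep p) (transit (ihalt p) olink y (ostep y)) (oenc y) (oenc (ostep y)).
Proof.
move=> ts y; case ed : (odelta s (t (Some h), t (Some h.+1))) => [[s' [wl wr]] mv].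
pose t_left x := if x == Some h then wl else t x.
have fetch : istep (oenc y) =
    Config (inj (SimLeft s (t (Some h.+1)))) h (otape t).
  rewrite /oenc /istep /= ts idelta_inj; apply: config_eq => //= -[k n].
  by case: eqP => [->|] //; case: k.
have put_left : istep (Config (inj (SimLeft s (t (Some h.+1)))) h (otape t)) =
    Config (inj (SimRight s' wr mv)) h.+1 (otape t_left).
  rewrite /istep /= idelta_inj /= ed; apply: config_eq => //= -[k n].
  rewrite /t_left /otape; case: k => /=; [by case: eqP => [->|]| |].
    by case: eqP => [->|_]; case: ifP.
  by case: eqP => [->|ne]; [rewrite eqxx|case: eqP => // -[]].
have put_right : istep (Config (inj (SimRight s' wr mv)) h.+1 (otape t_left)) =
    oenc (ostep y).
  rewrite /istep /ostep /= idelta_inj /= ed; apply: config_eq => //= -[k n].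
  rewrite /t_left /otape; case: k => /=; [by case: eqP => [->|]| |].
    by case: eqP => [->|] //; case: ifP.
  case: eqP => [->|ne]; first by case: eqP => [[]|_]; [lia|rewrite eqxx].
  by case: eqP => // ne'; case: eqP => // -[].
have old u h' : transit (ihalt p) olink y (ostep y) (Config (inj u) h' (otape t)).
  by split=> [|j]; [exact: inj_not_halt|left].
split; first by rewrite /oenc ts; exact: old.
rewrite fetch; apply: progressesW; split; first exact: old.
rewrite put_left -put_right; apply/progressesW/progresses1.
split=> [|[k n]]; first exact: inj_not_halt.
rewrite /ostep /= ed /t_left /otape; case: k => /=; [by left|by case: ifP; left|].
by case: eqP => // _; [right|left].
Qed.

Lemma oenc_step y : tgt (cstate y) = inj (Sim (cstate y)) ->
  progresses (@istep p) (transit (ihalt p) olink y (ostep y)) (oenc y) (oenc (ostep y)).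
Proof.
case: y => s [|h] t /= ts; last exact: oenc_step_inner.
rewrite -oenc_step_leftmost //; apply: progresses1; split=> [|j]; last by left.
by rewrite /= ts; exact: inj_not_halt.
Qed.

End OttmOnIttm.

Section Copier.
Variable q : ottm.
Local Notation copier_state := (sim_state (ost q) + mode)%type.

Definition copier_target (s : ost q) : copier_state :=
  if s == ohalt q then inr MHalt else inl (Sim s).

(* In its first block the copier moves the input to the output tape. *)
Definition copier_delta (x : copier_state) (b : bool * bool * bool) :
    copier_state * (bool * bool * bool) * bool :=
  let: (i, z, o) := b in
  match x with
  | inl y => sim_delta inl copier_target y b
  | inr MStart => (inr MStart, (false, z, i), true)
  | inr MLimit => if i then (inl (Sim (olim q)), b, false)
                  else (inl (Sim (ostart q)), (true, z, o), false)
  | inr MHalt => (inr MHalt, b, false)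
  end.

Definition copier : ittm.
Proof.
refine (@Build_ittm copier_state (inr MStart) (inr MHalt) (inr MLimit) _ copier_delta).
by split; apply/eqP.
Defined.

Definition copier_enc (y : oconfig q) : iconfig copier := @oenc q copier copier_target y.

Lemma copier_enc_agrees y : agrees id olink y (copier_enc y).
Proof. by []. Qed.

Lemma copier_enc_step y : cstate y <> ohalt q ->
  progresses (@istep copier) (transit (ihalt copier) olink y (ostep y))
    (copier_enc y) (copier_enc (ostep y)).
Proof.
move=> /eqP/negbTE not_halt; apply: (@oenc_step q copier inl copier_target) => //.
  by move=> x [[i z] o].
by rewrite /copier_target not_halt.
Qed.

Section Run.
Variable a : real.

Lemma copy_input n : iter n (@istep copier) (iinit copier a) =
  Config (inr MStart : ist copier) n (fun x => match x with
    | (Inp, m) => if m < n then false else a m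
    | (Scr, _) => false
    | (Out, m) => if m < n then a m else false end).
Proof.
elim: n => [|n IH]; first by apply: config_eq => //= -[[] m].
rewrite iterS IH /istep /=; apply: config_eq => //= -[k m].
rewrite ltnS [m <= n]leq_eqVlt.
by case: eqP => [->|ne]; case: k; rewrite ?ltnn.
Qed.

Local Notation M := (omachine q a).
Local Notation M' := (imachine copier a).
Local Notation first_block := (fun m => m = 0).

Lemma copier_startup_never_halts (B' : WO) (s' : B' -> iconfig copier) :
  block_run M' s' -> forall x, startup_block first_block x -> never_halts M' (s' x).
Proof.
move=> run' x [_ -> [b0 min0 /= ->]] n.
by rewrite (block_run_min run' min0) /= copy_input.
Qed.

Variables (B B' : WO) (e : B -> B') (s : B -> oconfig q) (s' : B' -> iconfig copier).
Hypothesis emb : startup_embedding first_block e.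
Hypothesis run : block_run M s.
Hypothesis run' : block_run M' s'.

Lemma copier_first_limit b : is_min b -> s' (e b) =
  Config (inr MLimit : ist copier) 0 (fun x => match x with (Out, m) => a m | _ => false end).
Proof.
move=> min_b; have [u ub [u0 min_u /= eu]] := startup_all emb b (erefl 0); subst u0.
have u_b : is_succ u (e b).
  split=> // x [ux xb]; have [_ -> [b0 min0 /= ex]] := startup_below emb min_b xb.
  by subst b0; case: (min0 u).
apply: (block_run_limit run'); first by exists u.
move=> i; rewrite (block_limsup_succ _ u_b) (block_run_min run' min_u).
apply: (infinitely_often_eventually (m := i.2.+1)) => n; case: i => -[] m /= mn;
  by rewrite copy_input /= ?mn.
Qed.

Lemma copier_starts b : synced id olink e s s' b -> encoded_starts M' olink copier_enc e s s' b.
Proof.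
move=> sync; case: (min_or_nonmin b) => [min_b|nb].
  have first := copier_first_limit min_b; exists 1; last first.
    by case=> // _; split; [rewrite first|exact: sync].
  rewrite /= first (block_run_min run min_b) /istep /=; apply: config_eq => //=.
    by rewrite /copier_target; case: (odistinct q) => /negbTE ->.
  by move=> [[] n] /=; rewrite /otape /=; case: eqP => //= ->.
have lim' := block_run_agrees run' (convex_nonmin (startup_convex emb) nb) (sync nb).
exists 1; last by case=> // _; split; [rewrite lim'|exact: sync].
rewrite /= lim' (block_run_limitE run nb) /istep /=; apply: config_eq => //=.
  by rewrite /copier_target; case: (odistinct q) => _ /negbTE ->.
by move=> [[] n] /=; rewrite /otape /=; case: eqP => //= ->.
Qed.

Lemma copier_never_halts b : (forall u, wle u b -> never_halts M (s u)) ->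
  never_halts M' (s' (e b)).
Proof.
exact: (halting_simulation_never_halts (M := M) (M' := M') copier_enc_agrees copier_enc_step
  (startup_convex emb) run run' copier_starts).
Qed.

Lemma copier_halts b n : halts_in_block M s b n ->
  reaches (@istep copier) (fun w => cstate w <> ihalt copier) (s' (e b))
    (copier_enc (iter n (@ostep q) (s b))).
Proof.
exact: (halting_simulation_reaches (M := M) (M' := M') copier_enc_agrees copier_enc_step
  (startup_convex emb) run run' copier_starts).
Qed.

End Run.
End Copier.

Theorem ottm_to_ittm_computes (q : ottm) (f : real -> option real) :
  ottm_computes q f -> ittm_computes (copier q) f.
Proof.
move=> comp a; have first_down m : m.+1 = 0 -> m = 0 by [].
have := comp a; case: (f a) => [r|not_halts].
  case/ottm_halts_withP => B [s [b [n [halts out]]]]; apply/ittm_halts_withP.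
  have [B' [e [s' [emb _ run' before]]]] :=
    startup_halts first_down (@copier_startup_never_halts q a) (@copier_never_halts q a) halts.
  have [run sn _] := halts; have [t et running] := copier_halts emb run run' halts.
  exists B', s', (e b), t; split; last by rewrite et.
  by apply: halts_in_blockI => //; rewrite et /= sn /copier_target eqxx.
exact: (startup_not_mhalts first_down (@copier_startup_never_halts q a)
  (@copier_never_halts q a) not_halts).
Qed.

(** * Double-head clocks on three tapes *)

Lemma ostep_local (q : ottm) N k (y z : oconfig q) : chead y + k <= N ->
  cstate y = cstate z -> chead y = chead z ->
  (forall c, c <= N -> ctape y (cellAt c) = ctape z (cellAt c)) ->
  cstate (iter k (@ostep q) y) = cstate (iter k (@ostep q) z).
Proof.
elim: k y z => // k IH y z hk es eh et; rewrite !iterSr.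
case: y z es eh et hk => [s h t] [s' h' t'] /= <- <- et hk.
have el : t (cellAt h) = t' (cellAt h) by apply: et; lia.
have er : t (cellAt h.+1) = t' (cellAt h.+1) by apply: et; lia.
rewrite /ostep /= -!/(cellAt h.+1) -el -er; case: odelta => -[s2 [wl wr]] mv.
apply: IH => //=; first by case: mv; lia.
by move=> c cN; rewrite et.
Qed.

Lemma istep_id (p : ittm) s h t s' mv :
  idelta s (t (Inp, h), t (Scr, h), t (Out, h)) =
    (s', (t (Inp, h), t (Scr, h), t (Out, h)), mv) ->
  istep (Config s h t) = Config s' (if mv then h.+1 else h.-1) t :> iconfig p.
Proof.
move=> e; rewrite /istep /= e; apply: config_eq => //= -[k m].
by case: eqP => [->|] //; case: k.
Qed.

(* At each limit the peeker reads all cells that the double-head machine can see in its next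
   [n.+1] steps, and halts exactly when that machine is about to halt at the [n.+1]-st. *)
Section Peeker.
Variables (q : ottm) (n : nat).
Local Notation buffer := {ffun 'I_n.+2 -> bool}.
Local Notation peeker_state := (sim_state (ost q) + (mode + unit + 'I_n.+1 * buffer))%type.

Definition peek_mode m : peeker_state := inr (inl (inl m)).
Definition peek_return : peeker_state := inr (inl (inr tt)).
Definition peek_at j f : peeker_state := inr (inr (j, f)).

Definition buffer_tape (f : buffer) (x : option nat) : bool :=
  if x is Some m then if m < n.+1 then f (inord m.+1) else false else f ord0.

Definition predicts_halt (f : buffer) :=
  cstate (iter n.+1 (@ostep q) (Config (olim q) 0 (buffer_tape f))) == ohalt q.

Definition buffer_add (j : nat) (z o : bool) (f : buffer) : buffer :=
  [ffun c : 'I_n.+2 => if c == 0 :> nat then if j == 0 then z else f c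
                       else if c == j.+1 :> nat then o else f c].

Definition peeker_delta (x : peeker_state) (b : bool * bool * bool) :
    peeker_state * (bool * bool * bool) * bool :=
  let: (i, z, o) := b in
  match x with
  | inl y => sim_delta inl (fun s => inl (Sim s)) y b
  | inr (inl (inl MStart)) => (inl (Sim (ostart q)), (true, z, o), false)
  | inr (inl (inl _)) => (peek_mode MHalt, b, false)
  | inr (inl (inr _)) => if i then (inl (Sim (olim q)), b, false) else (peek_return, b, false)
  | inr (inr (j, f)) =>
      let f' := buffer_add j z o f in
      (if j.+1 == n.+1 then if predicts_halt f' then peek_mode MHalt else peek_return
       else peek_at (inord j.+1) f', b, true)
  end.

Definition peeker : ittm.
Proof.
refine (@Build_ittm peeker_state (peek_mode MStart) (peek_mode MHalt)
  (peek_at ord0 [ffun=> false]) _ peeker_delta).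
by split; apply/eqP.
Defined.

Local Notation running := (fun w : iconfig peeker => cstate w <> ihalt peeker).

Definition peek_enc (y : oconfig q) : iconfig peeker := @oenc q peeker (fun s => inl (Sim s)) y.

Lemma peek_enc_agrees y : agrees id olink y (peek_enc y).
Proof. by []. Qed.

Lemma peek_enc_step y :
  progresses (@istep peeker) (transit (ihalt peeker) olink y (ostep y))
    (peek_enc y) (peek_enc (ostep y)).
Proof. by apply: (@oenc_step q peeker inl) => // x [[i z] o]. Qed.

Section Peek.
Variable t : option nat -> bool.

Definition buffered (i : nat) : buffer := [ffun c : 'I_n.+2 => [&& 0 < i, c <= i & t (cellAt c)]].

Let limit_config : iconfig peeker := Config (ilim peeker) 0 (otape t).

Lemma buffered_next j : j < n.+1 ->
  buffer_add j (otape t (Scr, j)) (otape t (Out, j)) (buffered j) = buffered j.+1.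
Proof.
move=> jn; apply/ffunP => c; rewrite !ffunE /otape /=.
case: (c : nat) (ltn_ord c) => [|m] _ /=; first by case: j jn.
rewrite eqSS ltnS; case: (ltngtP m j) => [mj|mj|->] //=; last by rewrite andbF.
by rewrite (leq_ltn_trans _ mj).
Qed.

Lemma peek_iter i : i <= n -> iter i (@istep peeker) limit_config =
  Config (peek_at (inord i) (buffered i) : ist peeker) i (otape t).
Proof.
elim: i => [_|i IH lt_in].
  have -> : inord 0 = ord0 :> 'I_n.+1 by apply: val_inj; rewrite /= inordK.
  by have -> : buffered 0 = [ffun=> false] by apply/ffunP => c; rewrite !ffunE.
rewrite iterS IH ?(ltnW lt_in) //.
rewrite (@istep_id peeker _ _ _ (peek_at (inord i.+1) (buffered i.+1)) true) //=.
rewrite inordK ?ltnS 1?ltnW // -buffered_next ?ltnS 1?ltnW //.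
by rewrite eqSS; case: eqP => // e; move: lt_in; rewrite e ltnn.
Qed.

Lemma predicts_haltE : predicts_halt (buffered n.+1) =
  (cstate (iter n.+1 (@ostep q) (Config (olim q) 0 t)) == ohalt q).
Proof.
congr (_ == _); apply: (@ostep_local q n.+1) => //= -[|c] cn; rewrite /buffer_tape /= ?cn ffunE //.
by rewrite (inordK (cn : c.+1 < n.+2)) cn.
Qed.

Lemma peek_verdict : iter n.+1 (@istep peeker) limit_config =
  Config (if predicts_halt (buffered n.+1) then peek_mode MHalt else peek_return : ist peeker)
    n.+1 (otape t).
Proof.
rewrite iterS peek_iter // (@istep_id peeker _ _ _
  (if predicts_halt (buffered n.+1) then peek_mode MHalt else peek_return) true) //= inordK //.
by rewrite -buffered_next // eqxx.
Qed.

Lemma peek_resumes : ~~ predicts_halt (buffered n.+1) ->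
  reaches (@istep peeker) (fun w => running w /\ ctape w = otape t) limit_config
    (peek_enc (Config (olim q) 0 t)).
Proof.
move=> /negbTE no_halt.
apply: (@reaches_trans _ _ _ _ (Config (peek_return : ist peeker) n.+1 (otape t))).
  exists n.+1; first by rewrite peek_verdict no_halt.
  by move=> i lt_in; rewrite peek_iter.
apply: (@reaches_trans _ _ _ _ (Config (peek_return : ist peeker) 0 (otape t))).
  apply: (reaches_walk (f := fun i => Config peek_return (n.+1 - i) (otape t)) (k := n.+1));
    rewrite ?subnn // => i lt_in; split=> //.
  rewrite (@istep_id peeker _ _ _ peek_return false) ?subnS //=.
  by rewrite /otape /= subn_eq0 leqNgt lt_in.
apply/progressesW; split=> //.
by rewrite (@istep_id peeker _ _ _ (inl (Sim (olim q))) false) //; apply: reaches_refl.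
Qed.

End Peek.

Section Run.
Local Notation M := (omachine q (fun=> false)).
Local Notation M' := (imachine peeker (fun=> false)).
Variables (B : WO) (s : B -> oconfig q) (s' : B -> iconfig peeker).
Hypothesis run : block_run M s.
Hypothesis run' : block_run M' s'.

Lemma predicts_halt_block b : nonmin b ->
  predicts_halt (buffered (ctape (s b)) n.+1) = (cstate (iter n.+1 (@ostep q) (s b)) == ohalt q).
Proof. by move=> nb; rewrite predicts_haltE {2}(block_run_limitE run nb). Qed.

Lemma peeker_starts b : never_halts M (s b) -> synced id olink id s s' b ->
  encoded_starts M' olink peek_enc id s s' b.
Proof.
move=> never sync; rewrite /encoded_starts; case: (min_or_nonmin b) => [min_b|nb].
  rewrite (block_run_min run' min_b) (block_run_min run min_b); exists 1; last first.
    by case=> // _; split=> // -[v /min_b].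
  by rewrite /= /istep /=; apply: config_eq => //= -[[] [|m]].
have no_halt : ~~ predicts_halt (buffered (ctape (s b)) n.+1).
  by rewrite predicts_halt_block //; apply/eqP; apply: never.
have -> : peek_enc (s b) = peek_enc (Config (olim q) 0 (ctape (s b))).
  by rewrite {1}(block_run_limitE run nb).
rewrite (block_run_agrees run' nb (sync nb)).
by apply: sub_reaches (peek_resumes no_halt) => w [nh wt]; split=> // _ j; rewrite wt.
Qed.

Lemma peeker_halts b : nonmin b -> halts_in_block M s b n.+1 -> halts_in_block M' s' b n.+1.
Proof.
move=> nb halts; have before := halts_in_block_before halts.
have step y : True -> _ := fun _ => peek_enc_step y.
have lim' := encoded_limit (M := M) (M' := M') peek_enc_agrees step (convex_embedding_id B) run run'
  (fun _ _ _ => I) peeker_starts before nb.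
apply: halts_in_blockI => // [|u ub|m mn].
- by rewrite lim' peek_verdict predicts_halt_block //; case: halts => _ ->; rewrite eqxx.
- apply: (encoded_never_halts (M := M) (M' := M') peek_enc_agrees step (convex_embedding_id B)
    run run' (fun _ _ _ => I) peeker_starts) => v vu.
  by apply: before; apply: wle_lt_trans ub.
- by rewrite lim' peek_iter.
Qed.

End Run.
End Peeker.

Theorem ottm_to_ittm_clockable (A : WO) : ottm_clockable A -> ittm_clockable A.
Proof.
case/ottm_clockableP => q [B [s [b [[|n] [halts iso]]]]].
  by have := ottm_halts_gt0 halts.
apply/ittm_clockableP; case: (min_or_nonmin b) => [min_b|nb].
  by have [s' halts'] := icounter_halts n min_b; exists (icounter n), B, s', b, n.+1.
have [s' run'] := block_run_exists (imachine (peeker q n) (fun=> false)) B.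
have [run _ _] := halts; exists (peeker q n), B, s', b, n.+1; split=> //.
exact: (peeker_halts run run').
Qed.

(** * Multi-track machines on the double-head tape *)

Definition cell_index (x : option nat) : nat := if x is Some n then n.+1 else 0.

Lemma cellAtK : cancel cellAt cell_index. Proof. by case. Qed.
Lemma cell_indexK : cancel cell_index cellAt. Proof. by case. Qed.

(* The double-head tape with its cells counted from the pad. *)
Definition ntape (g : nat -> bool) (x : option nat) : bool := g (cell_index x).

Lemma ntape_at g c : ntape g (cellAt c) = g c. Proof. by rewrite /ntape cellAtK. Qed.

Lemma eq_ntape g g' : g =1 g' -> ntape g = ntape g'.
Proof. by move=> gg'; apply/funext => x; apply: gg'. Qed.

Section NatTapeSteps.
Variable q : ottm.

Lemma ostep_ntape s c g s' wl wr mv g' :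
  odelta s (g c, g c.+1) = (s', (wl, wr), mv) -> wl = g' c -> wr = g' c.+1 ->
  (forall j, j != c -> j != c.+1 -> g' j = g j) ->
  ostep (Config s c (ntape g)) = Config s' (if mv then c.+1 else c.-1) (ntape g') :> oconfig q.
Proof.
move=> ed el er same; rewrite /ostep /= -/(cellAt c.+1) !ntape_at ed; apply: config_eq => //= x.
have cellE d : (x == cellAt d) = (cell_index x == d).
  by apply/eqP/eqP => [->|<-]; rewrite ?cellAtK ?cell_indexK.
rewrite -/(cellAt c.+1) !cellE /ntape.
case: eqP => [-> //|/eqP nl]; case: eqP => [-> //|/eqP nr].
by rewrite same.
Qed.

Lemma ostep_ntape_left s c g s' w mv g' : odelta s (g c, g c.+1) = (s', (w, g c.+1), mv) ->
  w = g' c -> (forall j, j != c -> g' j = g j) ->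
  ostep (Config s c (ntape g)) = Config s' (if mv then c.+1 else c.-1) (ntape g') :> oconfig q.
Proof.
move=> ed ew same; apply: (ostep_ntape ed) => // [|j nj _]; last exact: same.
by rewrite same //; lia.
Qed.

Lemma ostep_ntape_id s c g s' mv : odelta s (g c, g c.+1) = (s', (g c, g c.+1), mv) ->
  ostep (Config s c (ntape g)) = Config s' (if mv then c.+1 else c.-1) (ntape g) :> oconfig q.
Proof. by move=> ed; apply: (ostep_ntape_left ed). Qed.

End NatTapeSteps.

(* A column of a multi-track machine holds [k >= 2] bits; its head moves right, left, or
   (with [None]) stays. *)
Definition track_step (S : Type) k
    (d : S -> {ffun 'I_k -> bool} -> S * {ffun 'I_k -> bool} * option bool)
    (y : config S ('I_k * nat)) : config S ('I_k * nat) :=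
  let h := chead y in
  let: (s', w, mv) := d (cstate y) [ffun i => ctape y (i, h)] in
  Config s' (match mv with Some true => h.+1 | Some false => h.-1 | None => h end)
    (fun x => if x.2 == h then w x.1 else ctape y x).

(* One step of a multi-track machine: read the column from left to right, write it from right
   to left, and travel to the next column. *)
Inductive track_state K (S : Type) :=
  | TRead of S & 'I_K.+2 & {ffun 'I_K.+2 -> bool}
  | TWrite of S & {ffun 'I_K.+2 -> bool} & option bool & 'I_K.+2
  | TTravel of bool & S & 'I_K.+2.
Arguments TTravel {K S}.

Definition track_state_encode K S (x : track_state K S) :
    S * 'I_K.+2 * {ffun 'I_K.+2 -> bool} + S * {ffun 'I_K.+2 -> bool} * option bool * 'I_K.+2
    + bool * S * 'I_K.+2 :=
  match x with
  | TRead s i f => inl (inl (s, i, f))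
  | TWrite s w m i => inl (inr (s, w, m, i))
  | TTravel b s i => inr (b, s, i)
  end.
Definition track_state_decode K S x : track_state K S :=
  match x with
  | inl (inl (s, i, f)) => TRead s i f
  | inl (inr (s, w, m, i)) => TWrite s w m i
  | inr (b, s, i) => TTravel b s i
  end.
Lemma track_state_encodeK K S : cancel (@track_state_encode K S) (@track_state_decode K S).
Proof. by case. Qed.
HB.instance Definition _ K (S : finType) :=
  Finite.copy (track_state K S) (can_type (@track_state_encodeK K S)).

Section Tracks.
Variables (K : nat) (S : Type).
Local Notation k := K.+2.
Local Notation bits := {ffun 'I_k -> bool}.
Variable d : S -> bits -> S * bits * option bool.

Definition TEnter (s : S) : track_state K S := TRead s ord0 [ffun=> false].

Definition track_delta (c : track_state K S) (b : bool * bool) :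
    track_state K S * (bool * bool) * bool :=
  let: (l, r) := b in
  match c with
  | TRead s i f =>
      let f' : bits := [ffun j => if j == i then l else f j] in
      if i == K.+1 :> nat then
        let: (s', w, mv) := d s f' in (TWrite s' w mv (inord K), (w i, r), false)
      else (TRead s (inord i.+1) f', (l, r), true)
  | TWrite s w mv i =>
      if i == 0 :> nat then
        match mv with
        | Some m => (TTravel m s (inord K.+1), (w i, r), m)
        | None => (TTravel false s (inord 1), (w i, r), true)
        end
      else (TWrite s w mv (inord i.-1), (w i, r), false)
  | TTravel dir s j => (if j == 1 :> nat then TEnter s else TTravel dir s (inord j.-1), (l, r), dir)
  end.

(* Track [i] of column [h] is cell [h * k + i], counting the pad as cell 0. *)
Definition track_cell (x : option nat) : 'I_k * nat :=
  (inord (cell_index x %% k), cell_index x %/ k).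

Definition track_tape (t : 'I_k * nat -> bool) (c : nat) : bool := t (inord (c %% k), c %/ k).

Lemma track_tape_at t h i : i < k -> track_tape t (h * k + i) = t (inord i, h).
Proof. by move=> ik; rewrite /track_tape modnMDl modn_small // divnMDl // divn_small // addn0. Qed.

(* [stop s l] says that the simulation is broken off on entering a column whose track 0 holds
   [l] in state [s]. *)
Variables (q : ottm) (inj : track_state K S -> ost q) (stop : S -> bool -> bool).
Hypothesis odelta_inj : forall c b, (forall s, c = TEnter s -> ~~ stop s b.1) ->
  odelta (inj c) b = let: (c', w, mv) := track_delta c b in (inj c', w, mv).
Hypothesis inj_not_halt : forall c, inj c <> ohalt q.

Definition track_enc (y : config S ('I_k * nat)) : oconfig q :=
  Config (inj (TEnter (cstate y))) (chead y * k) (ntape (track_tape (ctape y))).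

Definition track_link (x : option nat) : 'I_k * nat + bool := inl (track_cell x).

Section Step.
Variables (s : S) (h : nat) (t : 'I_k * nat -> bool) (s' : S) (w : bits) (mv : option bool).
Hypothesis dE : d s [ffun i => t (i, h)] = (s', w, mv).
Hypothesis not_stop : ~~ stop s (t (ord0, h)).
Hypothesis left_ok : mv = Some false -> 0 < h.

Let y := Config s h t.
Let y' := track_step d y.

Local Notation passing := (transit (ohalt q) track_link y y').

Let written j c := if (c %/ k == h) && (j <= c %% k) then w (inord (c %% k)) else track_tape t c.

Lemma written_at j i : i < k ->
  written j (h * k + i) = if j <= i then w (inord i) else t (inord i, h).
Proof.
move=> ik; rewrite /written track_tape_at // divnMDl // divn_small // addn0 eqxx.
by rewrite modnMDl modn_small.
Qed.

Lemma written_none : ntape (written k) = ntape (track_tape t).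
Proof. by apply: eq_ntape => c; rewrite /written leqNgt ltn_mod andbF. Qed.

Lemma written_all : ntape (written 0) = ntape (track_tape (ctape y')).
Proof. by apply: eq_ntape => c; rewrite /written /track_tape /y' /track_step /= dE andbT. Qed.

Lemma writtenS j c : j < k -> c != h * k + j -> written j c = written j.+1 c.
Proof.
move=> jk; rewrite /written {1}(divn_eq c k); case: (c %/ k =P h) => //= ->.
by rewrite eqn_add2l [j <= _]leq_eqVlt eq_sym => /negbTE ->.
Qed.

Lemma passing_written c p j : passing (Config (inj c) p (ntape (written j))).
Proof.
split=> [|x]; first exact: inj_not_halt.
rewrite /ntape /written /=; case: ifP => [/andP [eh _]|_]; [right|by left].
by rewrite /y' /track_step /= dE /= eh.
Qed.

Let column i : bits := [ffun j : 'I_k => (j < i) && t (j, h)].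

Lemma column_next i : i < k ->
  [ffun j => if j == inord i then t (inord i, h) else column i j] = column i.+1.
Proof.
move=> ik; apply/ffunP => j; rewrite !ffunE ltnS [j <= i]leq_eqVlt -val_eqE /= inordK //.
by case: eqP => //= ji; rewrite -ji inord_val.
Qed.

Lemma read_column : reaches (@ostep q) passing (track_enc y)
  (Config (inj (TRead s (inord K.+1) (column K.+1))) (h * k + K.+1) (ntape (written k))).
Proof.
apply: (reaches_walk (k := K.+1) (f := fun i =>
  Config (inj (TRead s (inord i) (column i))) (h * k + i) (ntape (written k)))) => //.
  have -> : inord 0 = ord0 :> 'I_k by apply: val_inj; rewrite /= inordK.
  have -> : column 0 = [ffun=> false] by apply/ffunP => j; rewrite !ffunE.
  by rewrite addn0 written_none.
move=> i iK; have ik : i < k by apply: ltnW.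
split; first exact: passing_written.
rewrite (@ostep_ntape_id q _ _ _ (inj (TRead s (inord i.+1) (column i.+1))) true) ?addnS //.
rewrite written_at // leqNgt ik odelta_inj => [|s0 [<- i0 _]]; last first.
  by rewrite i0.
by rewrite /track_delta inordK // ltn_eqF // column_next.
Qed.

Lemma turn_back :
  ostep (Config (inj (TRead s (inord K.+1) (column K.+1))) (h * k + K.+1) (ntape (written k))) =
  Config (inj (TWrite s' w mv (inord K))) (h * k + K) (ntape (written K.+1)).
Proof.
rewrite (@ostep_ntape_left q _ _ _ (inj (TWrite s' w mv (inord K))) (w (inord K.+1)) false
  (written K.+1)) ?addnS //.
- rewrite -addnS odelta_inj => [|s0 [_ /(congr1 val)]]; last by rewrite /= inordK.
  rewrite /track_delta inordK // eqxx written_at // ltnn column_next //.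
  have -> : column k = [ffun i => t (i, h)] by apply/ffunP => j; rewrite !ffunE ltn_ord.
  by rewrite dE.
- by rewrite -addnS written_at // leqnn.
- by move=> j nj; apply: writtenS; rewrite // addnS.
Qed.

Lemma write_column : reaches (@ostep q) passing
  (Config (inj (TWrite s' w mv (inord K))) (h * k + K) (ntape (written K.+1)))
  (Config (inj (TWrite s' w mv (inord 0))) (h * k) (ntape (written 1))).
Proof.
apply: (reaches_walk (k := K) (f := fun i =>
  Config (inj (TWrite s' w mv (inord (K - i)))) (h * k + (K - i)) (ntape (written (K - i).+1)))).
- by rewrite subn0.
- by rewrite subnn addn0.
move=> i iK; split; first exact: passing_written.
have -> : K - i = (K - i.+1).+1 by lia.
have jk : (K - i.+1).+1 < k by lia.
move: (K - i.+1) jk => j jk.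
rewrite (@ostep_ntape_left q _ _ _ (inj (TWrite s' w mv (inord j))) (w (inord j.+1)) false
  (written j.+1)) ?addnS //.
- by rewrite odelta_inj // /track_delta inordK.
- by rewrite -addnS written_at // leqnn.
- by move=> i' ni'; apply: writtenS; rewrite // addnS.
Qed.

Let departs_right := mv != Some false.
Let travel_dir := mv == Some true.
Let travel_length := if mv is Some _ then K.+1 else 1.

Lemma depart : ostep (Config (inj (TWrite s' w mv (inord 0))) (h * k) (ntape (written 1))) =
  Config (inj (TTravel travel_dir s' (inord travel_length)))
    (if departs_right then (h * k).+1 else (h * k).-1) (ntape (written 0)).
Proof.
apply: (@ostep_ntape_left q _ _ _ _ (w (inord 0))).
- rewrite odelta_inj // /track_delta inordK //.
  by rewrite /travel_dir /travel_length /departs_right; case: (mv) => [[]|].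
- by rewrite -[h * k]addn0 written_at.
- by move=> j nj; apply: writtenS; rewrite // addn0.
Qed.

Lemma travel dir p l : 0 < l < k -> (dir = false -> l <= p) ->
  reaches (@ostep q) passing (Config (inj (TTravel dir s' (inord l))) p (ntape (written 0)))
    (Config (inj (TEnter s')) (if dir then p + l else p - l) (ntape (written 0))).
Proof.
move=> /andP [l_gt0 lk] room.
apply: (reaches_walk (k := l) (f := fun i =>
  Config (inj (if i == l then TEnter s' else TTravel dir s' (inord (l - i))))
    (if dir then p + i else p - i) (ntape (written 0)))).
- by rewrite ltn_eqF // addn0 !subn0 if_same.
- by rewrite eqxx.
move=> i il; rewrite ltn_eqF //; split; first exact: passing_written.
rewrite (@ostep_ntape_id q _ _ _
  (inj (if i.+1 == l then TEnter s' else TTravel dir s' (inord (l - i.+1)))) dir).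
  by congr Config; case: (dir) => //=; lia.
rewrite odelta_inj // /track_delta inordK; last by lia.
rewrite -subnS (_ : (l - i == 1) = (i.+1 == l)) //.
by apply/eqP/eqP; lia.
Qed.

Lemma travel_to_next_column : reaches (@ostep q) passing
  (Config (inj (TTravel travel_dir s' (inord travel_length)))
    (if departs_right then (h * k).+1 else (h * k).-1) (ntape (written 0))) (track_enc y').
Proof.
have -> : track_enc y' = Config (inj (TEnter s'))
    (match mv with Some true => h.+1 | Some false => h.-1 | None => h end * k) (ntape (written 0)).
  by rewrite written_all /track_enc /y' /track_step /= dE.
rewrite /departs_right /travel_dir /travel_length.
case: (mv) left_ok => [[]|] left_room /=.
- rewrite (_ : h.+1 * k = (h * k).+1 + K.+1); last by rewrite mulSn; lia.
  by apply: (travel (dir := true)) => //; rewrite ltnSn.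
- have h_gt0 := left_room erefl; have hk : h * k = k + h.-1 * k by rewrite -mulSn prednK.
  rewrite (_ : h.-1 * k = (h * k).-1 - K.+1); last first.
    by rewrite hk; move: (h.-1 * k) => x; lia.
  apply: (travel (dir := false)) => [|_]; first by rewrite ltnSn.
  by rewrite hk; move: (h.-1 * k) => x; lia.
- rewrite (_ : h * k = (h * k).+1 - 1) ?subn1 //=.
  by rewrite -{2}[h * k]/((h * k).+1.-1) -subn1; apply: (travel (dir := false)).
Qed.

Lemma track_enc_step_config : progresses (@ostep q) passing (track_enc y) (track_enc y').
Proof.
apply: reaches_progresses read_column _; split; first exact: passing_written.
rewrite turn_back; apply: reaches_trans write_column _.
apply: progressesW; split; first exact: passing_written.
by rewrite depart; exact: travel_to_next_column.
Qed.

End Step.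

Lemma track_enc_step y : ~~ stop (cstate y) (ctape y (ord0, chead y)) ->
  (forall s' w, d (cstate y) [ffun i => ctape y (i, chead y)] = (s', w, Some false) ->
    0 < chead y) ->
  progresses (@ostep q) (transit (ohalt q) track_link y (track_step d y))
    (track_enc y) (track_enc (track_step d y)).
Proof.
case: y => s h t /= not_stop left_ok.
case dE : (d s [ffun i => t (i, h)]) => [[s' w] mv].
by apply: (track_enc_step_config dE) => // mvE; apply: (left_ok s' w); rewrite dE mvE.
Qed.

End Tracks.

(** * A flag whose limsup is a conjunction of limsups *)

(* [test] holds at the stages at which it is tested whether each of [ones] has been seen on since
   the last reset of the memory [seen]: if so, [flash] goes on and [seen] is reset. [tested] holds
   at the next stages, which are the only ones to change the cells [on]. *)
Section Flags.
Variables (W : WO) (ones : seq nat) (on seen : nat -> W -> bool) (flash test tested : W -> bool).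
Implicit Types (v w u x y : W) (i : nat).

Definition all_seen w := all (fun i => seen i w || on i w) ones.

Hypothesis test_start : forall w, (forall v, ~ is_succ v w) -> test w.
Hypothesis tested_start : forall w, (forall v, ~ is_succ v w) -> ~~ tested w.
Hypothesis test_next : forall v w, is_succ v w -> test v ->
  [/\ forall i, on i w = on i v, flash w = all_seen v,
      forall i, seen i w = if all_seen v then false else seen i v || on i v & tested w].
Hypothesis tested_next : forall v w, is_succ v w -> tested v ->
  [/\ flash w = all (on^~ w) ones, forall i, seen i w = seen i v & ~~ tested w].
Hypothesis idle_next : forall v w, is_succ v w -> ~~ test v -> ~~ tested v ->
  [/\ forall i, on i w = on i v, flash w = flash v, forall i, seen i w = seen i v & ~~ tested w].
Hypothesis on_limit : forall i w, is_limit w -> on i w <-> limsup_below w (on i).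
Hypothesis seen_limit : forall i w, is_limit w -> seen i w <-> limsup_below w (seen i).
Hypothesis flash_limit : forall w, is_limit w -> flash w <-> limsup_below w flash.

Lemma succ_of_not_test w : ~~ test w -> exists v, is_succ v w.
Proof.
move=> not_test; apply: contrapT => no; move: not_test; rewrite test_start // => v vw.
by apply: no; exists v.
Qed.

Lemma tested_pred w : tested w -> exists2 v, is_succ v w & test v.
Proof.
move=> tested_w; have [v vw] : exists v, is_succ v w.
  by apply: contrapT => no; move: tested_w; apply/negP/tested_start => v vw; apply: no; exists v.
exists v => //; case test_v : (test v) => //; case tested_v : (tested v).
  by case: (tested_next vw tested_v) => _ _; rewrite tested_w.
by case: (idle_next vw (negbT test_v) (negbT tested_v)) => _ _ _; rewrite tested_w.
Qed.

Lemma flash_succ v w : is_succ v w -> ~~ tested w -> flash w = all (on^~ w) ones.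
Proof.
elim/wlt_ind: w v => w IH v vw not_tested.
case test_v : (test v); first by case: (test_next vw test_v) => _ _ _; rewrite (negbTE not_tested).
case tested_v : (tested v); first by case: (tested_next vw tested_v).
have [u uv] := succ_of_not_test (negbT test_v).
case: (idle_next vw (negbT test_v) (negbT tested_v)) => onE -> _ _.
rewrite (IH v (proj1 vw) u uv (negbT tested_v)).
by apply: eq_all => i; rewrite onE.
Qed.

Lemma persist_const (f : W -> bool) c v w : f v = c ->
  (forall u u', wle v u -> is_succ u u' -> wle u' w -> f u = c -> f u' = c) ->
  (forall u, is_limit u -> f u <-> limsup_below u f) ->
  wle v w -> f w = c.
Proof.
move=> fv f_next f_limit; apply: (wle_persist (P := fun u => f u = c)) => // u lim_u vu _ fc.
have sup := limsup_eventually vu fc.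
by apply/idP/idP => [/(f_limit u lim_u) /sup|/sup /(f_limit u lim_u)].
Qed.

Lemma on_idle v w i : (forall u, wle v u -> wlt u w -> ~~ test u /\ ~~ tested u) ->
  wle v w -> on i w = on i v.
Proof.
move=> idle; apply: persist_const => // [u u' vu uu' u'w <-|u]; last exact: on_limit.
case: (idle u vu) => [|not_test not_tested]; first by apply: wlt_le_trans u'w; case: uu'.
by case: (idle_next uu' not_test not_tested).
Qed.

Section AtLimit.
Variable w : W.
Hypothesis lim_w : is_limit w.

Section Sound.
Variables (v : W) (i : nat).
Hypothesis i_ones : i \in ones.
Hypothesis i_off : forall u, wle v u -> wlt u w -> on i u = false.

Lemma not_all_on u : wle v u -> wlt u w -> all (on^~ u) ones = false.
Proof. by move=> vu uw; apply/negbTE/allPn; exists i; rewrite ?i_off. Qed.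

Lemma not_all_seen u : wle v u -> wlt u w -> seen i u = false -> all_seen u = false.
Proof. by move=> vu uw seen_u; apply/negbTE/allPn; exists i; rewrite ?seen_u ?i_off. Qed.

Lemma seen_stays_off x u : wle v x -> seen i x = false -> wle x u -> wlt u w -> seen i u = false.
Proof.
move=> vx seen_x xu uw; apply: persist_const seen_x _ (seen_limit i) xu => y y' xy yy' y'u seen_y.
have yw : wlt y w by apply: wlt_trans (proj1 yy') (wle_lt_trans y'u uw).
case test_y : (test y).
  case: (test_next yy' test_y) => _ _ -> _.
  by rewrite not_all_seen ?seen_y ?i_off //; apply: wle_trans xy.
case tested_y : (tested y); first by case: (tested_next yy' tested_y) => _ ->.
by case: (idle_next yy' (negbT test_y) (negbT tested_y)) => _ _ ->.
Qed.

Lemma flash_stays_off x u : wle v x -> seen i x = false -> flash x = false -> wle x u -> wlt u w ->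
  flash u = false.
Proof.
move=> vx seen_x flash_x xu uw.
apply: persist_const flash_x _ flash_limit xu => y y' xy yy' y'u flash_y.
have y'w := wle_lt_trans y'u uw; have yw := wlt_trans (proj1 yy') y'w.
have vy := wle_trans vx xy; case test_y : (test y).
  by case: (test_next yy' test_y) => _ -> _ _; rewrite not_all_seen // (seen_stays_off vx seen_x).
case tested_y : (tested y); last by case: (idle_next yy' (negbT test_y) (negbT tested_y)) => _ ->.
case: (tested_next yy' tested_y) => -> _ _; rewrite not_all_on //.
by apply: wle_trans vy (wltW (proj1 yy')).
Qed.

(* The first flash after [v] resets the memory, which then never gets complete again. *)
Lemma flash_not_cofinal : wlt v w -> ~ limsup_below w flash.
Proof.
move=> vw sup_flash; have [v1 vv1 v1w] := limit_succ lim_w vw.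
have [x [vx xw flash_x] least_x] : exists2 x, [/\ wlt v x, wlt x w & flash x] &
    forall y, [/\ wlt v y, wlt y w & flash y] -> wle x y.
  apply: wlt_least; case: (sup_flash v1 v1w) => x [v1x [xw flash_x]]; exists x; split=> //.
  exact: wlt_le_trans (proj1 vv1) v1x.
have [u ux] : exists u, is_succ u x.
  case: (order_positionP x) => [/(_ v) //|u|lim_x]; first by exists u.
  have [v2 vv2 v2x] := limit_succ lim_x vx.
  case: (proj1 (flash_limit lim_x) flash_x v2 v2x) => y [v2y [yx flash_y]].
  case: (wlt_geF yx); apply: least_x; split=> //; last exact: wlt_trans xw.
  exact: wlt_le_trans (proj1 vv2) v2y.
have [u' u'x test_u'] : exists2 u', is_succ u' x & test u'.
  apply: tested_pred; apply: contraT => not_tested.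
  by move: flash_x; rewrite (flash_succ ux not_tested) not_all_on //; right.
case: (test_next u'x test_u') => _ flashE seen_x tested_x.
have i_unseen : seen i x = false by rewrite seen_x -flashE flash_x.
have [x1 xx1 x1w] := limit_succ lim_w xw; case: (tested_next xx1 tested_x) => flash_x1 seen_x1 _.
have vx1 : wle v x1 by right; apply: wlt_trans vx (proj1 xx1).
case: (sup_flash x1 x1w) => y [x1y [yw]].
by rewrite (flash_stays_off vx1) ?seen_x1 // flash_x1 not_all_on.
Qed.

End Sound.

Section Complete.
Variable v : W.
Hypothesis vw : wlt v w.
Hypothesis no_flash : forall u, wle v u -> wlt u w -> flash u = false.
Hypothesis on_cofinal : forall i, i \in ones -> limsup_below w (on i).

Lemma all_seen_off u : test u -> wle v u -> wlt u w -> all_seen u = false.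
Proof.
move=> test_u vu uw; have [u1 uu1 u1w] := limit_succ lim_w uw.
case: (test_next uu1 test_u) => _ <- _ _; apply: no_flash => //.
by apply: wle_trans vu (wltW (proj1 uu1)).
Qed.

Lemma test_cofinal : limsup_below w test.
Proof.
apply: contrapT => /not_limsup [v1 v1w no_test_from].
have [v2 [vv2 [v12 v2w]]] : exists v2, wle v v2 /\ wle v1 v2 /\ wlt v2 w.
  by case: (wle_total v v1) => h; [exists v1|exists v]; do 2?split=> //; left.
have [x v2x xw] := limit_succ lim_w v2w.
have idle y : wle x y -> wlt y w -> ~~ test y /\ ~~ tested y.
  move=> xy yw; have v2y := wlt_le_trans (proj1 v2x) xy.
  split; first by rewrite no_test_from //; apply: wle_trans v12 (wltW v2y).
  apply/negP => /tested_pred [u uy]; apply/negP; rewrite no_test_from //.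
    exact: wle_trans v12 (le_pred uy v2y).
  by apply: wlt_trans yw; case: uy.
have flash_x : flash x = all (on^~ x) ones.
  by apply: flash_succ v2x _; case: (idle x (wle_refl x) xw).
suff : all (on^~ x) ones.
  by rewrite -flash_x no_flash //; apply: wle_trans vv2 (wltW (proj1 v2x)).
apply/allP => i /on_cofinal /(_ x xw) [u [xu [uw]]].
rewrite (on_idle _ _ xu) // => y xy yu.
by apply: idle => //; apply: wlt_trans uw.
Qed.

Lemma seen_stays i u u' : wle v u -> seen i u -> wle u u' -> wlt u' w -> seen i u'.
Proof.
move=> vu seen_u uu' u'w.
apply: (persist_const (c := true)) seen_u _ (seen_limit i) uu' => y y' uy yy' y'u' seen_y.
have yw : wlt y w by apply: wlt_trans (proj1 yy') (wle_lt_trans y'u' u'w).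
case test_y : (test y).
  by case: (test_next yy' test_y) => _ _ -> _; rewrite all_seen_off ?seen_y //; apply: wle_trans uy.
case tested_y : (tested y); first by case: (tested_next yy' tested_y) => _ ->.
by case: (idle_next yy' (negbT test_y) (negbT tested_y)) => _ _ ->.
Qed.

(* A change of [on] is only possible at the stage after a test. *)
Lemma on_at_test i : i \in ones -> exists u, [/\ wle v u, wlt u w, test u & on i u].
Proof.
move=> i_ones; have [v1 vv1 v1w] := limit_succ lim_w vw.
case: (on_cofinal i_ones v1w) => u [v1u [uw on_u]]; have vu := wlt_le_trans (proj1 vv1) v1u.
case tested_u : (tested u).
  have [u' u'u test_u'] := tested_pred tested_u; exists u'.
  case: (test_next u'u test_u') => onE _ _ _.
  by split; rewrite -?onE //; [apply: le_pred u'u vu|apply: wlt_trans uw; case: u'u].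
have [y [uy yw test_y] least_y] : exists2 y, [/\ wle u y, wlt y w & test y] &
    forall x, [/\ wle u x, wlt x w & test x] -> wle y x.
  by apply: wlt_least; case: (test_cofinal uw) => y [uy [yw test_y]]; exists y.
have no_test x : wle u x -> wlt x y -> ~~ test x.
  move=> ux xy; apply/negP => test_x; apply: (wlt_geF xy); apply: least_y.
  by split=> //; apply: wlt_trans yw.
exists y; split=> //; first by apply: wle_trans uy; right.
rewrite (on_idle _ _ uy) // => x ux xy; split; first exact: no_test.
apply/negP; case: ux => [->|ux]; first by rewrite tested_u.
move=> /tested_pred [z zx]; apply/negP/no_test; first exact: le_pred zx ux.
by apply: wlt_trans xy; case: zx.
Qed.

Lemma all_seen_eventually (s : seq nat) : {subset s <= ones} ->
  exists u, [/\ wle v u, wlt u w & forall i, i \in s -> seen i u].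
Proof.
elim: s => [_|i s IH s_ones]; first by exists v; split=> //; apply: wle_refl.
have [|u [vu uw seen_u]] := IH; first by move=> j js; apply: s_ones; rewrite in_cons js orbT.
have [x [vx xw test_x on_x]] := on_at_test (s_ones i (mem_head i s)).
have [x1 xx1 x1w] := limit_succ lim_w xw.
have seen_x1 : seen i x1.
  by case: (test_next xx1 test_x) => _ _ -> _; rewrite all_seen_off // on_x orbT.
have vx1 : wle v x1 by apply: wle_trans vx (wltW (proj1 xx1)).
case: (wle_total u x1) => [ux1|x1u]; [exists x1|exists u]; split=> // j;
  rewrite in_cons => /orP [/eqP -> //|/seen_u seen_j] //.
  exact: seen_stays vu seen_j ux1 x1w.
exact: seen_stays vx1 seen_x1 x1u uw.
Qed.

Lemma all_seen_at_test : exists u, [/\ wle v u, wlt u w, test u & all_seen u].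
Proof.
have [//|u [vu uw seen_u]] := @all_seen_eventually ones.
have [x [ux [xw test_x]]] := test_cofinal uw; exists x; split=> //; first exact: wle_trans ux.
by apply/allP => i /seen_u seen_i; rewrite (seen_stays vu seen_i ux xw).
Qed.

End Complete.

Theorem flag_limit : flash w <-> (forall i, i \in ones -> on i w).
Proof.
rewrite (flash_limit lim_w); split=> [sup_flash i i_ones|on_w].
  apply/on_limit => //; apply: contrapT => /not_limsup [v vw i_off].
  exact: (flash_not_cofinal i_ones i_off vw sup_flash).
apply: contrapT => /not_limsup [v vw no_flash].
have on_cofinal i : i \in ones -> limsup_below w (on i) by move=> /on_w /on_limit; apply.
have [u [vu uw test_u]] := all_seen_at_test vw no_flash on_cofinal.
by rewrite (all_seen_off no_flash).
Qed.

End AtLimit.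
End Flags.

(** * Packing columns and detecting a pattern at limits *)

Lemma mrun_limit S C (M : machine S C) (W : WO) (c : W -> config S C) w : mrun M c -> is_limit w ->
  [/\ cstate (c w) = mlim M, chead (c w) = 0 &
      forall i, ctape (c w) i <-> limsup_below w (fun u => ctape (c u) i)].
Proof. by move=> run [nw lim_w]; case: (run w) => _ [_ /(_ nw lim_w) [? []]]. Qed.

Section Packed.
Variables (p : ittm) (m0 : nat) (pat : nat -> bool).
Local Notation N := m0.+1.

(* Column [h] of the packed machine holds the columns [h * N, ..., h * N + N - 1] of [p] on its
   data tracks, the cells of these columns being numbered by [3 * r + tape_code k]. *)
Definition pack_size := 3 * N.
Definition pack_tracks := pack_size + pack_size + 1.
Local Notation K := pack_tracks.
Local Notation bits := {ffun 'I_K.+2 -> bool}.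
Local Notation packed_state := (ist p * 'I_N * bool)%type.
Local Notation packed_config := (config packed_state ('I_K.+2 * nat)).

Definition stray_track : 'I_K.+2 := inord 0.
Definition flag_track : 'I_K.+2 := inord 1.
Definition mark_track : 'I_K.+2 := inord 2.
Definition data_track j : 'I_K.+2 := inord j.+3.
Definition memory_track j : 'I_K.+2 := inord (pack_size + j).+3.

Definition pack_bits stray flag mark (X M : nat -> bool) : bits :=
  [ffun i : 'I_K.+2 => match nat_of_ord i with
    | 0 => stray | 1 => flag | 2 => mark
    | j.+3 => if j < pack_size then X j else M (j - pack_size) end].

Lemma pack_bits_stray z e l X M : pack_bits z e l X M stray_track = z.
Proof. by rewrite ffunE inordK. Qed.

Lemma pack_bits_flag z e l X M : pack_bits z e l X M flag_track = e.
Proof. by rewrite ffunE inordK. Qed.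

Lemma pack_bits_mark z e l X M : pack_bits z e l X M mark_track = l.
Proof. by rewrite ffunE inordK //; rewrite /pack_tracks /pack_size; lia. Qed.

Lemma pack_bits_data z e l X M j : j < pack_size -> pack_bits z e l X M (data_track j) = X j.
Proof. by move=> jD; rewrite ffunE inordK ?jD //; rewrite /pack_tracks; lia. Qed.

Lemma pack_bits_memory z e l X M j : j < pack_size -> pack_bits z e l X M (memory_track j) = M j.
Proof.
move=> jD; rewrite ffunE inordK; last by rewrite /pack_tracks; lia.
by rewrite ltnNge leq_addr /= addKn.
Qed.

Definition pattern_ones := [seq j <- iota 0 pack_size | pat j].
Definition pattern_zeros := [seq j <- iota 0 pack_size | ~~ pat j].

Lemma mem_pattern_ones j : (j \in pattern_ones) = pat j && (j < pack_size).
Proof. by rewrite mem_filter mem_iota. Qed.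

Lemma mem_pattern_zeros j : (j \in pattern_zeros) = ~~ pat j && (j < pack_size).
Proof. by rewrite mem_filter mem_iota. Qed.

Definition tape_code (k : tape3) := match k with Inp => 0 | Scr => 1 | Out => 2 end.

Lemma cell_code_lt r k : r < N -> 3 * r + tape_code k < pack_size.
Proof. by rewrite /pack_size; case: k => /=; lia. Qed.

Lemma cell_code_inv j : j < pack_size -> exists k r, r < N /\ j = 3 * r + tape_code k.
Proof.
rewrite /pack_size => jD; have := ltn_pmod j (isT : 0 < 3); have := divn_eq j 3.
case: (j %% 3) => [|[|[|]]] // e _; [exists Inp|exists Scr|exists Out];
  by exists (j %/ 3) => /=; lia.
Qed.

Definition write_cells (X : nat -> bool) r w0 w1 w2 j :=
  if j == 3 * r then w0 else if j == (3 * r).+1 then w1 else if j == (3 * r).+2 then w2 else X j.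

Lemma write_cells_code X r w0 w1 w2 r' k : write_cells X r w0 w1 w2 (3 * r' + tape_code k) =
  if r' == r then match k with Inp => w0 | Scr => w1 | Out => w2 end else X (3 * r' + tape_code k).
Proof.
rewrite /write_cells; case: (r' =P r) => [->|ne].
  by case: k => /=; do 3?[case: eqP => ? //]; lia.
by case: k => /=; do 3![case: eqP => [|_]; first lia].
Qed.

Definition pack_move (leftmost mv : bool) (r : 'I_N) : 'I_N * option bool :=
  if mv then if r == m0 :> nat then (ord0, Some true) else (inord r.+1, None)
  else if r == 0 :> nat then if leftmost then (ord0, None) else (ord_max, Some false)
  else (inord r.-1, None).

(* In column 0 a step of [p] is preceded by a test of the memory (the third component of the
   state tells that it has been done); the stray bit and the flag are kept there only. *)
Definition pack_delta (x : packed_state) (f : bits) : packed_state * bits * option bool :=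
  let: (s, r, tested) := x in
  let leftmost := f mark_track in
  let X j := f (data_track j) in
  let M j := f (memory_track j) in
  if leftmost && ~~ tested then
    let all_seen := all (fun j => M j || X j) pattern_ones in
    ((s, r, true), pack_bits (f stray_track) all_seen leftmost X
      (fun j => if all_seen then false else M j || X j), None)
  else
    let: (s', (w0, w1, w2), mv) := idelta s (X (3 * r), X (3 * r).+1, X (3 * r).+2) in
    let X' := write_cells X r w0 w1 w2 in
    let: (r', m) := pack_move leftmost mv r in
    ((s', r', false), pack_bits (if leftmost then has X' pattern_zeros else f stray_track)
                        (if leftmost then all X' pattern_ones else f flag_track) leftmost X' M, m).

Local Notation pack_step := (track_step pack_delta).
Implicit Types (y : iconfig p) (z : packed_config).

Definition marked z := forall h, ctape z (mark_track, h) = (h == 0).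

Lemma marked_step z : marked z -> marked (pack_step z).
Proof.
case: z => [[[s r] tested] h t] mark_z h'; rewrite /track_step /=.
case: ifP => _ /=; first by case: eqP => [->|_]; rewrite ?pack_bits_mark ?ffunE; apply: mark_z.
case: idelta => -[s' [[w0 w1] w2]] mv; case: pack_move => r' m /=.
by case: eqP => [->|_]; rewrite ?pack_bits_mark ?ffunE; apply: mark_z.
Qed.

Lemma marked_iter z n : marked z -> marked (iter n pack_step z).
Proof. by move=> mark_z; elim: n => //= n; apply: marked_step. Qed.

Definition data_on j z := (j < pack_size) && ctape z (data_track j, 0).
Definition seen_on j z := (j < pack_size) && ctape z (memory_track j, 0).
Definition flag_on z := ctape z (flag_track, 0).
Definition stray_on z := ctape z (stray_track, 0).
Definition tested z := (cstate z).2.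
Definition testing z := (chead z == 0) && ~~ tested z.
Definition ones_seen z := all (fun j => seen_on j z || data_on j z) pattern_ones.

Lemma pack_step_testing z : marked z -> testing z ->
  [/\ tested (pack_step z), chead (pack_step z) = 0,
      forall j, data_on j (pack_step z) = data_on j z,
      flag_on (pack_step z) = ones_seen z /\ stray_on (pack_step z) = stray_on z &
      forall j, seen_on j (pack_step z) =
        if ones_seen z then false else seen_on j z || data_on j z].
Proof.
case: z => [[[s r] ph] h t] mark_z; rewrite /testing /tested /= => /andP [/eqP h0 nph]; subst h.
have first : t (mark_track, 0) = true by exact: (mark_z 0).
set z := Config _ _ _; set f := [ffun i => t (i, 0)].
have seenE : ones_seen z = all (fun j => f (memory_track j) || f (data_track j)) pattern_ones.
  apply: eq_in_all => j; rewrite mem_pattern_ones => /andP [_ jD].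
  by rewrite /seen_on /data_on jD /f !ffunE.
rewrite /track_step /= -/f {1 2}/f !ffunE first nph /= -seenE.
rewrite /data_on /seen_on /flag_on /stray_on /=; split=> //.
- by move=> j; case: ltnP => // jD; rewrite pack_bits_data // /f ffunE.
- by rewrite pack_bits_flag pack_bits_stray.
- by move=> j; case: ltnP => jD /=; [rewrite pack_bits_memory // /f !ffunE|case: ifP].
Qed.

Lemma pack_step_tested z : marked z -> tested z -> chead z = 0 ->
  [/\ ~~ tested (pack_step z), flag_on (pack_step z) = all (data_on^~ (pack_step z)) pattern_ones,
      stray_on (pack_step z) = has (data_on^~ (pack_step z)) pattern_zeros &
      forall j, seen_on j (pack_step z) = seen_on j z].
Proof.
case: z => [[[s r] ph] h t] mark_z; rewrite /tested /= => hph h0; subst h.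
have first : t (mark_track, 0) = true by exact: (mark_z 0).
rewrite /track_step /= ffunE first hph /=; set f := [ffun i => t (i, 0)].
case: idelta => -[s' [[w0 w1] w2]] mv; case: pack_move => r' m /=.
rewrite /data_on /seen_on /flag_on /stray_on /= pack_bits_flag pack_bits_stray; split=> //.
- by apply: eq_in_all => j; rewrite mem_pattern_ones => /andP [_ jD]; rewrite jD pack_bits_data.
- by apply: eq_in_has => j; rewrite mem_pattern_zeros => /andP [_ jD]; rewrite jD pack_bits_data.
- by move=> j; case: ltnP => // jD; rewrite pack_bits_memory // /f ffunE.
Qed.

Lemma pack_step_away z : marked z -> chead z != 0 ->
  [/\ ~~ tested (pack_step z), forall j, data_on j (pack_step z) = data_on j z,
      flag_on (pack_step z) = flag_on z /\ stray_on (pack_step z) = stray_on z &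
      forall j, seen_on j (pack_step z) = seen_on j z].
Proof.
case: z => [[[s r] ph] h t] mark_z /= h0.
have not_first : t (mark_track, h) = false by rewrite -(negbTE h0); exact: (mark_z h).
rewrite /track_step /= ffunE not_first /=; set f := [ffun i => t (i, h)].
case: idelta => -[s' [[w0 w1] w2]] mv; case: pack_move => r' m /=.
by rewrite /data_on /seen_on /flag_on /stray_on /= eq_sym (negbTE h0).
Qed.

Definition pack_cell (x : tape3 * nat) : 'I_K.+2 * nat :=
  (data_track (3 * (x.2 %% N) + tape_code x.1), x.2 %/ N).

Lemma pack_cell_at h r k : r < N ->
  pack_cell (k, h * N + r) = (data_track (3 * r + tape_code k), h).
Proof.
by move=> rN; rewrite /pack_cell /= modnMDl divnMDl // modn_small // divn_small // addn0.
Qed.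

Definition followed (x : tape3 * nat + nat) : 'I_K.+2 * nat :=
  match x with inl c => pack_cell c | inr h => (mark_track, h) end.

Definition followed_src (x : tape3 * nat + nat) : tape3 * nat + bool :=
  match x with inl c => inl c | inr h => inr (h == 0) end.

Definition packs y z := [/\ (cstate z).1.1 = cstate y,
  chead y = chead z * N + (cstate z).1.2 & agrees followed followed_src y z].

Lemma packs_marked y z : packs y z -> marked z.
Proof. by move=> [_ _ agr] h; apply: (agr (inr h)). Qed.

Lemma packsI y z : (cstate z).1.1 = cstate y -> chead y = chead z * N + (cstate z).1.2 ->
  marked z -> (forall k h r, r < N ->
    ctape z (data_track (3 * r + tape_code k), h) = ctape y (k, h * N + r)) -> packs y z.
Proof.
move=> es eh mark_z data_z; split=> // -[[k j]|h]; last exact: mark_z.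
by rewrite /= {2}(divn_eq j N) -data_z // ltn_mod.
Qed.

Lemma packs_data y z k h r : packs y z -> r < N ->
  ctape z (data_track (3 * r + tape_code k), h) = ctape y (k, h * N + r).
Proof. by move=> [_ _ agr] rN; rewrite -pack_cell_at //; apply: (agr (inl _)). Qed.

Lemma pack_moveE leftmost mv (r : 'I_N) h : leftmost = (h == 0) ->
  (if mv then (h * N + r).+1 else (h * N + r).-1) =
  match (pack_move leftmost mv r).2 with Some true => h.+1 | Some false => h.-1 | None => h end * N
    + (pack_move leftmost mv r).1.
Proof.
move=> ->; rewrite /pack_move; have rN := ltn_ord r; case: mv.
  case: eqP => [-> |ne] /=; first by lia.
  by rewrite inordK; lia.
case: eqP => [-> |ne] /=; last by rewrite inordK; lia.
by case: eqP => [->|h0] /=; [|case: h h0 => //= h _; lia].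
Qed.

Lemma packs_step y z : packs y z -> ~~ testing z ->
  packs (istep y) (pack_step z) /\ ~~ tested (pack_step z).
Proof.
move=> pk nT; have mark' := marked_step (packs_marked pk).
have mark := packs_marked pk (chead z); have data k h r : r < N -> _ := @packs_data y z k h r pk.
case: z pk nT mark' mark data => [[[s r] ph] h t] [es eh _] nT mark' mark data.
rewrite /= in es eh mark data *; have rN := ltn_ord r.
have rd k : t (data_track (3 * r + tape_code k), h) = ctape y (k, chead y) by rewrite data // -eh.
move: mark'; rewrite /track_step /= ffunE mark.
move: nT; rewrite /testing /tested /= => /negbTE ->; rewrite !ffunE.
have := rd Inp; have := rd Scr; have := rd Out; rewrite /= addn0 addn1 addn2 => -> -> ->.
rewrite /istep es; case: idelta => -[s' [[w0 w1] w2]] mv.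
have := @pack_moveE _ mv r h (erefl (h == 0)); case ep : (pack_move _ _ _) => [r' m] /= headE mark'.
split=> //; apply: packsI => //=; first by rewrite eh.
move=> k a b bN; rewrite eh; case: (a =P h) => [->|ne].
  rewrite pack_bits_data ?cell_code_lt // write_cells_code eqn_add2l.
  by case: eqP => // _; rewrite ffunE data.
rewrite data //; case: eqP => // e; case: ne.
by have := congr1 (divn^~ N) e; rewrite /= !divnMDl // !divn_small // !addn0.
Qed.

Lemma packs_testing y z : packs y z -> testing z -> packs y (pack_step z).
Proof.
move=> pk; have mark' := marked_step (packs_marked pk).
have mark := packs_marked pk (chead z); have data k h r : r < N -> _ := @packs_data y z k h r pk.
case: z pk mark' mark data => [[[s r] ph] h t] [es eh _] mark' mark data.
rewrite /= in es eh mark data *.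
move: mark'; rewrite /testing /tested /track_step /= ffunE mark => mark' T; rewrite T /= in mark' *.
apply: packsI => //= k a b bN; rewrite -data //; case: eqP => // ->.
by rewrite pack_bits_data ?cell_code_lt // ffunE.
Qed.

Definition packed := Machine
  (Config (istart p, ord0, false) 0 (fun x => (x.1 == mark_track) && (x.2 == 0)) : packed_config)
  pack_step (ilim p, ord0, false) (ihalt p, ord0, false).

Lemma data_track_neq_mark j : j < pack_size -> (data_track j == mark_track) = false.
Proof.
by move=> jD; apply/eqP => /(congr1 val); rewrite /= !inordK // /pack_tracks; lia.
Qed.

Lemma stray_track_neq_mark : (stray_track == mark_track) = false.
Proof. by apply/eqP => /(congr1 val); rewrite /= !inordK // /pack_tracks /pack_size; lia. Qed.

Section Run.
Local Notation M := (imachine p (fun=> false)).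
Variables (B : WO) (s : B -> iconfig p) (sp : B -> packed_config).
Hypothesis run : block_run M s.
Hypothesis runp : block_run packed sp.

Lemma block_start_untested b : chead (sp b) = 0 /\ ~~ tested (sp b).
Proof.
by case: (min_or_nonmin b) => [/(block_run_min runp) ->|/(block_run_limitE runp) ->].
Qed.

Lemma packs_block b : packs (s b) (sp b).
Proof.
have packs_next y z : True -> packs y z /\ ~~ tested z -> exists2 z',
    progresses pack_step (fun w => True /\ between followed followed_src y (istep y) w) z z' &
    packs (istep y) z' /\ ~~ tested z'.
  move=> _ [pk nt]; have agr w : packs y w -> True /\ between followed followed_src y (istep y) w.
    by case=> _ _ agr; split=> // j; left; apply: agr.
  case T : (testing z); last first.
    exists (pack_step z); last by apply: packs_step; rewrite ?T.
    by apply: progresses1; apply: agr.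
  have pk' := packs_testing pk T.
  have [tested' _ _ _ _] := pack_step_testing (packs_marked pk) T.
  exists (pack_step (pack_step z)); last by apply: packs_step; rewrite // /testing tested' andbF.
  by split; [apply: agr|apply/progressesW/progresses1/agr].
have starts_packs u : synced followed followed_src id s sp u -> packs (s u) (sp u).
  move=> sync; case: (min_or_nonmin u) => [min_u|nu].
    rewrite (block_run_min run min_u) (block_run_min runp min_u); apply: packsI => //.
      by move=> h; rewrite /= eqxx.
    by move=> k h r rN; rewrite /= data_track_neq_mark ?cell_code_lt //; case: k.
  by have := sync nu; rewrite (block_run_limitE run nu) (block_run_limitE runp nu).
apply: (starts_packs b).
apply: (simulation_synced (M := M) (M' := packed) (Q := fun=> True) _ packs_next
  (convex_embedding_id B) run runp (good := fun=> True)) => // [y z [[]]//|u _ sync].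
exists (sp u); last by split; [apply: (starts_packs u)|case: (block_start_untested u)].
exact: reaches_refl.
Qed.

Local Notation stage := (stages packed sp).

Lemma marked_stage x : marked (stage x).
Proof. exact/marked_iter/(packs_marked (packs_block x.1)). Qed.

Lemma stage_succ v x : is_succ v x -> stage x = pack_step (stage v).
Proof. by move/lex_succ_pred ->. Qed.

Lemma stage_start x : (forall v, ~ is_succ v x) -> chead (stage x) = 0 /\ ~~ tested (stage x).
Proof.
case: x => b [|n] no; first exact: block_start_untested.
by case: (no (b, n)); apply: lex_succ.
Qed.

Lemma stage_limit c i x : is_limit x ->
  (c && ctape (stage x) i) <-> limsup_below x (fun u => c && ctape (stage u) i).
Proof.
move=> lim_x; case: c => /=; last by rewrite limsup_const //; case: lim_x.
by case: (mrun_limit (mrun_stages runp) lim_x).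
Qed.

Lemma tested_head x : tested (stage x) -> chead (stage x) = 0.
Proof.
case: (EM (exists v, is_succ v x)) => [[v vx]|/forallNP /stage_start [] //].
rewrite (stage_succ vx); have mark := marked_stage v.
case head_v : (chead (stage v) == 0); last first.
  by case: (pack_step_away mark (negbT head_v)) => /negbTE ->.
case test : (testing (stage v)); first by case: (pack_step_testing mark test).
move: test; rewrite /testing head_v /= => /negbFE tested_v.
by case: (pack_step_tested mark tested_v (eqP head_v)) => /negbTE ->.
Qed.

Lemma flag_stage x : is_limit x ->
  flag_on (stage x) <-> (forall j, j \in pattern_ones -> data_on j (stage x)).
Proof.
move=> lim_x.
apply: (@flag_limit _ pattern_ones (fun j u => data_on j (stage u)) (fun j u => seen_on j (stage u))
  (fun u => flag_on (stage u)) (fun u => testing (stage u)) (fun u => tested (stage u))) => //.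
- by move=> u /stage_start [h0 nt]; rewrite /testing h0 nt.
- by move=> u /stage_start [].
- move=> v u vu test; rewrite (stage_succ vu).
  by case: (pack_step_testing (marked_stage v) test) => tu _ dat [fl _] seen.
- move=> v u vu tst; rewrite (stage_succ vu).
  by case: (pack_step_tested (marked_stage v) tst (tested_head tst)).
- move=> v u vu ntest ntst; rewrite (stage_succ vu).
  have away : chead (stage v) != 0 by move: ntest; rewrite /testing ntst andbT.
  by case: (pack_step_away (marked_stage v) away) => nt dat [fl _] seen.
- by move=> j u; apply: stage_limit.
- by move=> j u; apply: stage_limit.
- by move=> u; apply: (@stage_limit true).
Qed.

Lemma stray_stage x : stray_on (stage x) = has (data_on^~ (stage x)) pattern_zeros.
Proof.
elim/wlt_ind: x => x IH; case: (order_positionP x) => [min_x|v vx|lim_x].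
- have min_b : is_min x.1 by move=> u ux; apply: (min_x (u, 0)); left.
  have -> : stage x = minit packed.
    case: x min_x min_b {IH} => b [|n] min_x min_b; first exact: (block_run_min runp).
    by case: (min_x (b, n)); case: (lex_succ b n).
  rewrite /stray_on /= stray_track_neq_mark; apply/esym/negbTE/hasPn => j.
  by rewrite mem_pattern_zeros => /andP [_ jD]; rewrite /data_on /= data_track_neq_mark ?andbF.
- have mark := marked_stage v; have := IH v (proj1 vx); rewrite (stage_succ vx) => IHv.
  case head_v : (chead (stage v) == 0); last first.
    case: (pack_step_away mark (negbT head_v)) => _ dat [_ ->] _; rewrite IHv.
    by apply: eq_has => j; rewrite dat.
  case test : (testing (stage v)).
    case: (pack_step_testing mark test) => _ _ dat [_ ->] _; rewrite IHv.
    by apply: eq_has => j; rewrite dat.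
  move: test; rewrite /testing head_v /= => /negbFE tst.
  by case: (pack_step_tested mark tst (eqP head_v)).
- have strayE : stray_on (stage x) <->
      limsup_below x (fun u => has (data_on^~ (stage u)) pattern_zeros).
    apply: (iff_trans (@stage_limit true _ _ lim_x)).
    by split; apply: limsup_mono => u ux /=; rewrite -[ctape _ _]/(stray_on (stage u)) IH.
  have sup := limsup_has pattern_zeros (fun j u => data_on j (stage u)) (proj1 lim_x).
  apply/idP/idP => [/strayE /sup [j j0 /(stage_limit _ _ lim_x) on]|/hasP [j j0 on]].
    by apply/hasP; exists j.
  by apply/strayE/sup; exists j => //; apply/(stage_limit _ _ lim_x).
Qed.

Lemma pattern_block b : nonmin b ->
  (~~ stray_on (sp b) && flag_on (sp b)) <->
  (forall k r, r < N -> ctape (s b) (k, r) = pat (3 * r + tape_code k)).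
Proof.
move=> nb; have := stray_stage (b, 0); rewrite {1 2}/stages /= => ->.
have flag := flag_stage (lex_limit_start nb); rewrite /stages /= in flag.
have data k r : r < N -> ctape (s b) (k, r) = data_on (3 * r + tape_code k) (sp b).
  move=> rN; have := packs_data k 0 (packs_block b) rN; rewrite mul0n add0n => <-.
  by rewrite /data_on cell_code_lt.
split=> [/andP [no_stray /flag on] k r rN|match_pat].
  rewrite data //; case pat_kr : (pat _).
    by apply: on; rewrite mem_pattern_ones pat_kr cell_code_lt.
  apply: contraNF no_stray => on_kr; apply/hasP; exists (3 * r + tape_code k) => //.
  by rewrite mem_pattern_zeros pat_kr cell_code_lt.
have dataE j : j < pack_size -> data_on j (sp b) = pat j.
  by case/cell_code_inv => k [r [rN ->]]; rewrite -data // match_pat.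
apply/andP; split.
  by apply/hasPn => j; rewrite mem_pattern_zeros => /andP [off jD]; rewrite dataE.
by apply/flag => j; rewrite mem_pattern_ones => /andP [on jD]; rewrite dataE.
Qed.

End Run.
End Packed.

(** * Three-tape clocks on the double-head tape *)

Lemma istep_local (p : ittm) N k (y z : iconfig p) : chead y + k <= N ->
  cstate y = cstate z -> chead y = chead z ->
  (forall c j, j < N -> ctape y (c, j) = ctape z (c, j)) ->
  cstate (iter k (@istep p) y) = cstate (iter k (@istep p) z).
Proof.
elim: k y z => // k IH y z hk es eh et; rewrite !iterSr.
case: y z es eh et hk => [s h t] [s' h' t'] /= <- <- et hk.
have e c : t (c, h) = t' (c, h) by apply: et; lia.
rewrite /istep /= -!e; case: idelta => -[s2 [[w0 w1] w2]] mv.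
apply: IH => //=; first by case: mv; lia.
by move=> c j jN; rewrite et.
Qed.

Section Clocker.
Variables (p : ittm) (m0 : nat) (pat : nat -> bool).
Local Notation K := (pack_tracks m0).
Local Notation packed_state := (ist p * 'I_m0.+1 * bool)%type.
Local Notation delta := (@pack_delta p m0 pat).
Local Notation pack_step := (track_step delta).
Local Notation clocker_state := (track_state K packed_state + (unit + mode + 'I_m0.+2))%type.

Definition clock_boot : clocker_state := inr (inl (inl tt)).
Definition clock_mode m : clocker_state := inr (inl (inr m)).
Definition clock_count i : clocker_state := inr (inr i).
Definition clock_enter (s : packed_state) : clocker_state := inl (TEnter K s).

(* The clocker marks column 0 and runs the packed machine. At a limit it sees the stray bit on
   the pad and the flag in cell 0: when the pattern is there, it counts to its halt. *)
Definition clocker_delta (x : clocker_state) (b : bool * bool) :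
    clocker_state * (bool * bool) * bool :=
  match x with
  | inl c => let: (c', w, mv) := track_delta delta c b in (inl c', w, mv)
  | inr (inl (inl _)) => (clock_enter (istart p, ord0, false), (b.1, true), false)
  | inr (inl (inr MStart)) => (clock_boot, b, true)
  | inr (inl (inr MLimit)) => if ~~ b.1 && b.2 then (clock_count (inord 1), b, false)
                              else (clock_enter (ilim p, ord0, false), b, false)
  | inr (inl (inr MHalt)) => (x, b, false)
  | inr (inr i) => (clock_count (inord i.+1), b, false)
  end.

Definition clocker : ottm.
Proof.
refine (@Build_ottm clocker_state (clock_mode MStart) (clock_count ord_max) (clock_mode MLimit)
  _ clocker_delta).
by split; apply/eqP.
Defined.

Definition clock_enc (z : config packed_state ('I_K.+2 * nat)) : oconfig clocker :=
  @track_enc K packed_state clocker inl z.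

Lemma pack_delta_left x f s w : delta x f = (s, w, Some false) -> f (mark_track m0) = false.
Proof.
case: x => [[s1 r] tested]; rewrite /pack_delta; case: ifP => // _.
case: idelta => -[s' [[w0 w1] w2]] mv; rewrite /pack_move.
by case: mv; case: ifP => //= _; case: ifP.
Qed.

Lemma clock_enc_agrees z : agrees id (@track_link K) z (clock_enc z).
Proof. by []. Qed.

Lemma clock_enc_step z : marked z ->
  progresses (@ostep clocker) (transit (ohalt clocker) (@track_link K) z (pack_step z))
    (clock_enc z) (clock_enc (pack_step z)).
Proof.
move=> mark_z.
apply: (@track_enc_step K _ _ clocker inl (fun _ _ => false)) => // s w /pack_delta_left.
by rewrite ffunE mark_z; case: (chead z).
Qed.

Lemma clocker_boots : iter 2 (@ostep clocker) (oinit clocker (fun=> false)) =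
  clock_enc (minit (packed p m0 pat)).
Proof.
rewrite /clock_enc /track_enc /ostep /=; apply: config_eq => //= x; rewrite /ntape /track_tape /=.
have -> : ((inord (cell_index x %% K.+2) : 'I_K.+2) == mark_track m0) && (cell_index x %/ K.+2 == 0)
    = (cell_index x == 2).
  rewrite -val_eqE /= inordK ?ltn_pmod // inordK; last by rewrite /pack_tracks /pack_size; lia.
  case: (ltnP (cell_index x) K.+2) => xK; first by rewrite modn_small // divn_small // andbT.
  have -> : (cell_index x == 2) = false by move: xK; rewrite /pack_tracks /pack_size; lia.
  by rewrite -leqn0 leqNgt divn_gt0 // xK andbF.
by case: x => [[|[|[|]]]|].
Qed.

Section Limit.
Variable z : config packed_state ('I_K.+2 * nat).
Let limit_config : oconfig clocker := Config (clock_mode MLimit) 0 (ntape (track_tape (ctape z))).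

Lemma clocker_resumes : z = Config (ilim p, ord0, false) 0 (ctape z) ->
  ~~ (~~ stray_on z && flag_on z) -> ostep limit_config = clock_enc z.
Proof.
move=> zE /negbTE no_match.
rewrite (@ostep_ntape_id clocker _ _ _ (clock_enter (ilim p, ord0, false)) false).
  by rewrite /clock_enc /track_enc zE.
by rewrite /= -[_ && _]/(~~ stray_on z && flag_on z) no_match.
Qed.

Lemma clocker_counts i : ~~ stray_on z && flag_on z -> 0 < i -> i <= m0.+1 ->
  iter i (@ostep clocker) limit_config =
  Config (clock_count (inord i) : ost clocker) 0 (ntape (track_tape (ctape z))).
Proof.
move=> match_z; elim: i => // -[|i] IH _ im0.
  rewrite /= (@ostep_ntape_id clocker _ _ _ (clock_count (inord 1)) false) //=.
  by rewrite -[_ && _]/(~~ stray_on z && flag_on z) match_z.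
rewrite iterS IH // 1?ltnW // (@ostep_ntape_id clocker _ _ _ (clock_count (inord i.+2)) false) //=.
by rewrite inordK // ltnW.
Qed.

End Limit.

Section Run.
Local Notation M := (imachine p (fun=> false)).
Local Notation P := (packed p m0 pat).
Local Notation M' := (omachine clocker (fun=> false)).
Variables (B : WO) (s : B -> iconfig p).
Variables (sp : B -> config packed_state ('I_K.+2 * nat)) (s' : B -> oconfig clocker).
Hypothesis run : block_run M s.
Hypothesis runp : block_run P sp.
Hypothesis run' : block_run M' s'.

Variable b0 : B.
Hypothesis no_match : forall b, wlt b b0 -> nonmin b -> ~~ (~~ stray_on (sp b) && flag_on (sp b)).

Lemma clocker_starts b : wlt b b0 -> synced id (@track_link K) id sp s' b ->
  encoded_starts M' (@track_link K) clock_enc id sp s' b.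
Proof.
move=> bb0 sync; rewrite /encoded_starts; case: (min_or_nonmin b) => [min_b|nb].
  rewrite (block_run_min run' min_b) (block_run_min runp min_b) -clocker_boots; exists 2 => //.
  by case=> [|[|]] // _; split=> // -[v /min_b].
have lim' := block_run_agrees run' nb (sync nb); exists 1.
  by rewrite /= lim'; apply: clocker_resumes; [exact: (block_run_limitE runp nb)|exact: no_match].
by case=> // _; split; [rewrite lim'|exact: sync].
Qed.

Let marked_before b : wlt b b0 -> forall n, marked (iter n pack_step (sp b)).
Proof. by move=> _ n; apply: (marked_stage run runp (b, n)). Qed.

Lemma clocker_before u : wlt u b0 -> never_halts M' (s' u).
Proof.
move=> ub0; apply: (encoded_never_halts (M := P) (M' := M') clock_enc_agrees clock_enc_step
  (convex_embedding_id B) runp run' marked_before clocker_starts) => v vu.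
exact: wle_lt_trans ub0.
Qed.

Lemma clocker_at_limit : nonmin b0 ->
  s' b0 = Config (clock_mode MLimit : ost clocker) 0 (ntape (track_tape (ctape (sp b0)))).
Proof.
exact: (encoded_limit (M := P) (M' := M') clock_enc_agrees clock_enc_step
  (convex_embedding_id B) runp run' marked_before clocker_starts).
Qed.

Lemma clocker_halts : nonmin b0 -> ~~ stray_on (sp b0) && flag_on (sp b0) ->
  halts_in_block M' s' b0 m0.+1.
Proof.
move=> nb match_b; have lim' := clocker_at_limit nb.
apply: halts_in_blockI => // [||[|m] mn].
- by rewrite lim' clocker_counts //; congr clock_count; apply: val_inj; rewrite /= inordK.
- exact: clocker_before.
- by rewrite lim'.
- rewrite lim' clocker_counts //; last exact: ltnW.
  by move=> [/(congr1 val)]; rewrite /= inordK; lia.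
Qed.

End Run.
End Clocker.

Definition tape_pattern (p : ittm) (y : iconfig p) j : bool :=
  ctape y (match j %% 3 with 0 => Inp | 1 => Scr | _ => Out end, j %/ 3).

Lemma tape_pattern_code (p : ittm) (y : iconfig p) k j :
  tape_pattern y (3 * j + tape_code k) = ctape y (k, j).
Proof. by rewrite /tape_pattern mulnC modnMDl divnMDl //; case: k => /=; rewrite addn0. Qed.

Theorem ittm_to_ottm_clockable (A : WO) : ittm_clockable A -> ottm_clockable A.
Proof.
case/ittm_clockableP => p [B [s [b [[|n] [halts iso]]]]].
  by have := ittm_halts_gt0 halts.
apply/ottm_clockableP; case: (min_or_nonmin b) => [min_b|nb].
  by have [s' halts'] := ocounter_halts n min_b; exists (ocounter n), B, s', b, n.+1.
pose pat := tape_pattern (s b); have [run sn _] := halts.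
have [sp runp] := block_run_exists (packed p n pat) B.
have [s' run'] := block_run_exists (omachine (clocker p n pat) (fun=> false)) B.
exists (clocker p n pat), B, s', b, n.+1; split=> //.
apply: (clocker_halts run runp run') => // [u ub nu|].
  apply/negP => /(pattern_block run runp nu) match_u.
  apply: (halts_in_block_before halts ub (n := n.+1)); rewrite -sn.
  apply: (@istep_local p n.+1) => [||| k j jn].
  - by rewrite (block_run_limitE run nu).
  - by rewrite (block_run_limitE run nu) (block_run_limitE run nb).
  - by rewrite (block_run_limitE run nu) (block_run_limitE run nb).
  - by rewrite match_u // /pat tape_pattern_code.
by apply/(pattern_block run runp nb) => k j jn; rewrite /pat tape_pattern_code.
Qed.

(** * Three tapes on five tracks of the double-head tape *)

Lemma ord5_ind (P : 'I_5 -> Prop) : P (inord 0) -> P (inord 1) -> P (inord 2) -> P (inord 3) ->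
  P (inord 4) -> forall i, P i.
Proof.
move=> P0 P1 P2 P3 P4 i; rewrite -(inord_val i).
by case: (nat_of_ord i) (ltn_ord i) => [|[|[|[|[|]]]]].
Qed.

Section FiveTracks.
Variable p : ittm.
Local Notation bits := {ffun 'I_5 -> bool}.

(* Tracks 0 and 1 tell the columns other than 0 from column 0; tracks 2, 3, 4 are scratch, output,
   input. Column [h] of [p] is column [h.+1]; column 0 only makes the head bounce, and its
   scratch bit tells whether the computation has begun. *)
Definition five_delta (s : ist p) (f : bits) : ist p * bits * option bool :=
  if f (inord 0) then
    let: (s', (w0, w1, w2), mv) := idelta s (f (inord 4), f (inord 2), f (inord 3)) in
    (s', [ffun i : 'I_5 => match nat_of_ord i with 2 => w1 | 3 => w2 | 4 => w0 | _ => f i end],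
     Some mv)
  else
    (if (s == ilim p) && ~~ f (inord 2) then istart p else s,
     [ffun i : 'I_5 => (i == 2 :> nat) || f i], Some true).

Local Notation five_step := (track_step five_delta).

Definition five_link (x : 'I_5 * nat) : tape3 * nat + bool :=
  match nat_of_ord x.1, x.2 with
  | 0, h => inr (h != 0)
  | 1, h => inr (h == 0)
  | 2, h.+1 => inl (Scr, h)
  | 2, 0 => inr true
  | 3, h.+1 => inl (Out, h)
  | 3, 0 => inr false
  | _, h.+1 => inl (Inp, h)
  | _, 0 => inr false
  end.

Definition five_tape (t : tape3 * nat -> bool) (x : 'I_5 * nat) : bool := view (five_link x) t.

Lemma five_tape_inner t h : five_tape t (inord 0, h) = (h != 0).
Proof. by rewrite /five_tape /five_link /= inordK. Qed.
Lemma five_tape_first t h : five_tape t (inord 1, h) = (h == 0).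
Proof. by rewrite /five_tape /five_link /= inordK. Qed.
Lemma five_tape_scr t h : five_tape t (inord 2, h) = if h is h'.+1 then t (Scr, h') else true.
Proof. by rewrite /five_tape /five_link /= inordK //; case: h. Qed.
Lemma five_tape_out t h : five_tape t (inord 3, h) = if h is h'.+1 then t (Out, h') else false.
Proof. by rewrite /five_tape /five_link /= inordK //; case: h. Qed.
Lemma five_tape_inp t h : five_tape t (inord 4, h) = if h is h'.+1 then t (Inp, h') else false.
Proof. by rewrite /five_tape /five_link /= inordK //; case: h. Qed.
Definition five_tapeE :=
  (five_tape_inner, five_tape_first, five_tape_scr, five_tape_out, five_tape_inp).

Definition five_enc (y : iconfig p) : config (ist p) ('I_5 * nat) :=
  Config (cstate y) (chead y).+1 (five_tape (ctape y)).

Lemma five_step_inner y : exists mv,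
  chead (istep y) = (if mv then (chead y).+1 else (chead y).-1) /\
  five_step (five_enc y) =
    Config (cstate (istep y)) (if mv then (chead y).+2 else chead y) (five_tape (ctape (istep y))).
Proof.
case: y => s h t; rewrite /five_enc /track_step /= /five_delta !ffunE !five_tapeE /=.
rewrite /istep /=; case: idelta => -[s' [[w0 w1] w2]] mv /=; exists mv; split=> //.
apply: config_eq => //= -[i [|j]] /=; elim/ord5_ind: i; rewrite !five_tapeE // eqSS;
  by case: eqP => // e; rewrite ?ffunE ?inordK ?five_tapeE ?e.
Qed.

Lemma five_step_bounce s (t : 'I_5 * nat -> bool) : t (inord 0, 0) = false -> t (inord 2, 0) ->
  five_step (Config s 0 t) = Config s 1 t.
Proof.
move=> t0 t2; rewrite /track_step /= /five_delta !ffunE t0 t2 andbF.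
apply: config_eq => //= -[i h] /=; case: eqP => // ->; rewrite !ffunE.
by elim/ord5_ind: i => //; rewrite inordK // t2.
Qed.

(* When the unfolding is finished, the scratch bit of column 0 is still off. *)
Definition five_input a (x : 'I_5 * nat) : bool :=
  (x != (inord 2, 0)) && five_tape (ctape (iinit p a)) x.

Lemma five_step_begin a : five_step (Config (ilim p) 0 (five_input a)) = five_enc (iinit p a).
Proof.
have inner : five_input a (inord 0, 0) = false by rewrite /five_input five_tapeE andbF.
have scr : five_input a (inord 2, 0) = false by rewrite /five_input eqxx.
rewrite /track_step /= /five_delta !ffunE inner scr eqxx; apply: config_eq => //= -[i h] /=.
rewrite /five_input xpair_eqE; case: eqP => [->|_]; last by rewrite andbF.
rewrite !ffunE; elim/ord5_ind: i; rewrite /five_input ?five_tapeE ?inordK ?andbF //=.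
by rewrite xpair_eqE -val_eqE /= !inordK.
Qed.

End FiveTracks.

(* [UFlash], [UScan], [UShift] insert one column header; the remaining states write the
   output back: [ULeft] returns to the left end, [UClear] clears column 0, [UFind] looks for
   the next column, [UErase] clears it keeping its output bit, [UCarry] carries that bit to
   the cell marked as the next output cell, and [USkip] passes over the new mark. *)
Inductive unfold_state :=
  | UMode of mode | UFlash | UScan of bool & 'I_5 | UShift of bool & bool & bool & bool
  | ULeft of 'I_5 | UClear of 'I_5 | UErase of 'I_5 & bool | UCarry of bool | USkip | UFind.

Definition unfold_code : finType := ((mode + 'I_3) + (bool * 'I_5 + bool * bool * bool * bool) +
  ('I_5 + 'I_5) + ('I_5 * bool + bool))%type.
Definition unfold_state_encode (x : unfold_state) : unfold_code :=
  match x with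
  | UMode m => inl (inl (inl (inl m)))
  | UFlash => inl (inl (inl (inr (inord 0))))
  | USkip => inl (inl (inl (inr (inord 1))))
  | UFind => inl (inl (inl (inr (inord 2))))
  | UScan f t => inl (inl (inr (inl (f, t))))
  | UShift x y z w => inl (inl (inr (inr (x, y, z, w))))
  | ULeft t => inl (inr (inl t))
  | UClear t => inl (inr (inr t))
  | UErase t o => inr (inl (t, o))
  | UCarry o => inr (inr o)
  end.
Definition unfold_state_decode (x : unfold_code) : unfold_state :=
  match x with
  | inl (inl (inl (inl m))) => UMode m
  | inl (inl (inl (inr i))) => match nat_of_ord i with 0 => UFlash | 1 => USkip | _ => UFind end
  | inl (inl (inr (inl (f, t)))) => UScan f t
  | inl (inl (inr (inr (x, y, z, w)))) => UShift x y z w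
  | inl (inr (inl t)) => ULeft t
  | inl (inr (inr t)) => UClear t
  | inr (inl (t, o)) => UErase t o
  | inr (inr o) => UCarry o
  end.
Lemma unfold_state_encodeK : cancel unfold_state_encode unfold_state_decode.
Proof. by case=> //=; rewrite inordK. Qed.
HB.instance Definition _ := Finite.copy unfold_state (can_type unfold_state_encodeK).

Section Unfolder.
Variable p : ittm.
Local Notation unfolder_state := (track_state 3 (ist p) + unfold_state)%type.

(* The simulation of [p] is broken off when [p] has halted and the head is not in column 0. *)
Definition unfolder_delta (x : unfolder_state) (b : bool * bool) :
    unfolder_state * (bool * bool) * bool :=
  let: (l, r) := b in
  match x with
  | inl c => if (c == TEnter 3 (ihalt p)) && l then (inr (ULeft (inord 4)), b, false)
             else let: (c', w, mv) := track_delta (@five_delta p) c b in (inl c', w, mv)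
  | inr (UMode MStart) => (inr (UShift false true false l), (false, r), true)
  | inr (UMode MLimit) => if l then (inr (UMode MHalt), b, false)
                          else if r then (inl (TEnter 3 (ilim p)), b, false)
                          else (inr UFlash, (l, true), false)
  | inr (UMode MHalt) => (x, b, false)
  | inr UFlash => (inr (UScan false (inord 1)), (l, false), true)
  | inr (UScan found t) =>
      if (t == 2 :> nat) && ~~ found && l then (inr (UScan true (inord 3)), (false, r), true)
      else (inr (if t == 4 :> nat then
                   if found then UShift true false true false else UScan false (inord 0)
                 else UScan found (inord t.+1)), b, true)
  | inr (UShift w x y z) => (inr (UShift x y z l), (w, r), true)
  | inr (ULeft t) =>
      if t != 0 :> nat then (inr (ULeft (inord t.-1)), b, false)
      else if l then (inr (ULeft (inord 4)), b, false)
      else (inr (UClear (inord 1)), (true, r), true)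
  | inr (UClear t) => (inr (if t == 4 :> nat then UFind else UClear (inord t.+1)),
                       (if t == 1 :> nat then l else false, r), true)
  | inr UFind => if l then (inr (UErase (inord 1) false), (false, r), true)
                 else (inr UFind, b, true)
  | inr (UErase t o) =>
      let o' := if t == 3 :> nat then l else o in
      (inr (if t == 4 :> nat then UCarry o' else UErase (inord t.+1) o'), (false, r), t != 4 :> nat)
  | inr (UCarry o) => if l then (inr USkip, (o, true), true) else (inr (UCarry o), b, false)
  | inr USkip => (inr UFind, b, true)
  end.

Definition unfolder : ottm.
Proof.
refine (@Build_ottm unfolder_state (inr (UMode MStart)) (inr (UMode MHalt)) (inr (UMode MLimit))
  _ unfolder_delta).
by split; apply/eqP.
Defined.

Local Notation five_step := (track_step (@five_delta p)).

Definition unfold_link (x : option nat) : tape3 * nat + bool := five_link (track_cell 3 x).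

Local Notation transit := (transit (ohalt unfolder)).

Definition five_track_enc (z : config (ist p) ('I_5 * nat)) : oconfig unfolder :=
  @track_enc 3 (ist p) unfolder inl z.

Definition unfold_enc (y : iconfig p) : oconfig unfolder := five_track_enc (five_enc y).

Lemma unfold_enc_agrees y : agrees id unfold_link y (unfold_enc y).
Proof. by []. Qed.

Lemma five_track_enc_step z : (cstate z <> ihalt p \/ ctape z (ord0, chead z) = false) ->
  (ctape z (inord 0, chead z) -> 0 < chead z) ->
  progresses (@ostep unfolder)
    (transit (@track_link 3) z (five_step z)) (five_track_enc z) (five_track_enc (five_step z)).
Proof.
move=> goes_on left_ok.
apply: (@track_enc_step 3 _ (@five_delta p) unfolder inl (fun s l => (s == ihalt p) && l)) => //.
- move=> c [l r] not_stop /=; case: eqP => //= ec; case: l not_stop => // /(_ _ ec) /=.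
  by rewrite eqxx.
- by apply/negP => /andP [/eqP halted inner]; case: goes_on; rewrite ?inner.
- move=> s w; rewrite /five_delta ffunE; case: ifP => [inner _|_ []] //; exact: left_ok.
Qed.

Lemma five_track_enc_bounce s (t : 'I_5 * nat -> bool) : t (inord 0, 0) = false ->
  progresses (@ostep unfolder)
    (transit (@track_link 3) (Config s 0 t) (five_step (Config s 0 t)))
    (five_track_enc (Config s 0 t)) (five_track_enc (five_step (Config s 0 t))).
Proof.
have ord0E : ord0 = inord 0 :> 'I_5 by apply: val_inj; rewrite /= inordK.
by move=> t0; apply: five_track_enc_step => /=; [right; rewrite ord0E|rewrite t0].
Qed.

Lemma unfold_enc_step y : cstate y <> ihalt p ->
  progresses (@ostep unfolder) (transit unfold_link y (istep y))
    (unfold_enc y) (unfold_enc (istep y)).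
Proof.
move=> not_halt; have [mv [eh step_y]] := five_step_inner y.
have body : progresses (@ostep unfolder)
    (transit unfold_link y (istep y))
    (unfold_enc y) (five_track_enc (five_step (five_enc y))).
  apply: sub_progresses (@five_track_enc_step (five_enc y) _ _); [|by left|by []].
  by move=> w [run_w btw]; split=> // x; have := btw x; rewrite step_y.
have [bounce|inner] := boolP (~~ mv && (chead y == 0)); last first.
  suff e : five_step (five_enc y) = five_enc (istep y) by rewrite {2}/unfold_enc -e.
  by rewrite step_y /five_enc eh; case: (mv) inner => //=; case: (chead y).
move: bounce => /andP [/negbTE mvE /eqP head0]; rewrite mvE head0 /= in eh step_y.
set t := five_tape (ctape (istep y)) in step_y.
apply: progresses_trans body _; rewrite step_y.
have t0 : t (inord 0, 0) = false by rewrite /t five_tapeE.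
have := five_track_enc_bounce (cstate (istep y)) t0.
rewrite five_step_bounce ?/t ?five_tapeE //.
have -> : unfold_enc (istep y) = five_track_enc (Config (cstate (istep y)) 1 t).
  by rewrite /unfold_enc /five_enc eh.
apply: sub_progresses => w [run_w btw]; split=> // x; right.
by case: (btw x).
Qed.

Lemma unfolder_enters t : t (inord 0, 0) = false -> t (inord 1, 0) ->
  ostep (Config (inr (UMode MLimit) : ost unfolder) 0 (ntape (track_tape t))) =
  five_track_enc (Config (ilim p) 0 t).
Proof.
move=> t0 t1; rewrite (@ostep_ntape_id unfolder _ _ _ (inl (TEnter 3 (ilim p))) false) //=.
by rewrite /track_tape /= t0 t1.
Qed.

End Unfolder.

(** * Unfolding the input onto five tracks *)

Section Unfolding.
Variables (p : ittm) (a : real).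
Local Notation U x := (inr x : ost (unfolder p)).
Local Notation ustep := (@ostep (unfolder p)).
Local Notation running := (fun w : oconfig (unfolder p) => cstate w <> ohalt (unfolder p)).

Definition input_cell c := if c is c'.+1 then a c' else false.

(* The tape after [m] passes: [m] columns, the last of which is marked on track 2, and then the
   rest of the input. *)
Definition unfolded m c :=
  if c < 5 * m then
    match c %% 5 with
    | 0 => c %/ 5 != 0 | 2 => (c %/ 5).+1 == m | 4 => input_cell (c %/ 5) | _ => false
    end
  else input_cell (c - 4 * m).

Lemma unfolded_rest m c : 5 * m <= c -> unfolded m c = input_cell (c - 4 * m).
Proof. by rewrite /unfolded leqNgt => /negbTE ->. Qed.

Lemma unfolded_at m h t : h < m -> t < 5 -> unfolded m (5 * h + t) =
  match t with 0 => h != 0 | 2 => h.+1 == m | 4 => input_cell h | _ => false end.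
Proof.
move=> hm t5; rewrite /unfolded (_ : _ < _ = true); last by lia.
by rewrite mulnC modnMDl divnMDl // modn_small // divn_small // addn0.
Qed.

Section Shift.
Variables (g : nat -> bool) (c0 : nat) (w : nat -> bool).

Definition shift_config : oconfig (unfolder p) :=
  Config (U (UShift (w 0) (w 1) (w 2) (w 3))) c0 (ntape g).

Definition stream j := if j < 4 then w j else g (c0 + (j - 4)).

Definition shifted i j := if (c0 <= j) && (j < c0 + i) then stream (j - c0) else g j.

Lemma shift_iter i : iter i ustep shift_config =
  Config (U (UShift (stream i) (stream i.+1) (stream i.+2) (stream i.+3))) (c0 + i)
    (ntape (shifted i)).
Proof.
elim: i => [|i IH].
  rewrite addn0 /=; congr Config; apply: eq_ntape => j; rewrite /shifted addn0.
  by case: leqP => //= cj; rewrite ltnNge cj.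
rewrite iterS IH addnS (@ostep_ntape (unfolder p) _ _ _
  (U (UShift (stream i.+1) (stream i.+2) (stream i.+3) (stream i.+4)))
  (stream i) (shifted i (c0 + i).+1) true (shifted i.+1)) //=.
- congr (_, _, _); congr inr; congr UShift.
  by rewrite /shifted ltnn andbF /stream /= addnC; congr g; lia.
- by rewrite /shifted leq_addr ltn_add2l ltnSn addKn.
- by rewrite /shifted; do 2!case: ifP => //; lia.
- by move=> j /eqP n1 /eqP n2; rewrite /shifted; do 2!case: ifP => //; lia.
Qed.

Lemma shift_infinitely_often P x c : reaches ustep P x shift_config ->
  infinitely_often (fun n => ctape (iter n ustep x) (cellAt c)) <->
  (if c < c0 then g c else stream (c - c0)).
Proof.
case=> t xt _; apply: (infinitely_often_eventually (m := c.+1 + t)) => n cn.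
rewrite -(subnK (leq_trans (leq_addl _ _) cn)) iterD xt shift_iter /= ntape_at /shifted.
by rewrite (_ : c < c0 + _) ?andbT; [rewrite leqNgt; case: ltnP|lia].
Qed.

End Shift.

Definition first_header j := j == 1.
Definition header j := (j == 0) || (j == 2).

Lemma unfold_init : oinit (unfolder p) a = Config (U (UMode MStart)) 0 (ntape (unfolded 0)).
Proof. by apply: config_eq => //= -[n|]; rewrite /ntape /unfolded. Qed.

Lemma first_pass_shifts : reaches ustep running (oinit (unfolder p) a)
  (shift_config (unfolded 0) 1 first_header).
Proof.
apply: progressesW; split=> //.
rewrite unfold_init.
rewrite (@ostep_ntape_id (unfolder p) _ _ _ (U (UShift false true false false)) true) //.
exact: reaches_refl.
Qed.

Lemma first_pass_result c :
  (if c < 1 then unfolded 0 c else stream (unfolded 0) 1 first_header (c - 1)) = unfolded 1 c.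
Proof.
case: c => [|c] //=; rewrite subn1 /= /stream.
case: ltnP => c4; first by case: c c4 => [|[|[|[|]]]].
by rewrite !unfolded_rest; first congr input_cell; lia.
Qed.

(* Pass [m.+1] clears the mark of column [m] before inserting column [m.+1]. *)
Definition unmarked m c := (c != 5 * m + 2) && unfolded m.+1 c.

Lemma unmarkedE m c : c < 5 * m.+1 -> unmarked m c = unfolded m.+2 c.
Proof.
rewrite /unmarked (divn_eq c 5) mulnC => cm; have t5 := ltn_pmod c (isT : 0 < 5).
move: (c %/ 5) (c %% 5) t5 cm => h t t5 cm; rewrite !unfolded_at //; try lia.
by case: t t5 cm => [|[|[|[|[|]]]]] // _ cm; lia.
Qed.

Lemma later_pass_result m c :
  (if c < 5 * m.+1 then unmarked m c else stream (unmarked m) (5 * m.+1) header (c - 5 * m.+1)) =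
  unfolded m.+2 c.
Proof.
case: ltnP => cm; first exact: unmarkedE.
rewrite -{2}(subnKC cm); move: (c - 5 * m.+1) => j; rewrite /stream; case: ltnP => j4.
  rewrite unfolded_at //; last by lia.
  by case: j j4 => [|[|[|[|]]]] //= _; rewrite eqxx.
rewrite /unmarked unfolded_rest; last by lia.
rewrite (_ : _ != _) /=; last by lia.
have [->|j5] := eqVneq j 4; first by rewrite unfolded_at //; congr input_cell; lia.
by rewrite unfolded_rest; first congr input_cell; lia.
Qed.

Section LaterPass.
Variable m : nat.

Definition pass_start : oconfig (unfolder p) :=
  Config (U (UMode MLimit)) 0 (ntape (unfolded m.+1)).

Definition flashing c := (c == 1) || unfolded m.+1 c.

Let quiet (z : oconfig (unfolder p)) :=
  running z /\ forall c, c < 5 * m -> c != 1 -> ctape z (cellAt c) = unfolded m.+1 c.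

Lemma unfolded_first : unfolded m.+1 0 = false /\ unfolded m.+1 1 = false.
Proof. by split; [exact: (@unfolded_at m.+1 0 0)|exact: (@unfolded_at m.+1 0 1)]. Qed.

Lemma pass_flash : ostep pass_start = Config (U UFlash) 0 (ntape flashing).
Proof.
have [u0 u1] := unfolded_first.
rewrite (@ostep_ntape (unfolder p) _ _ _ (U UFlash) (unfolded m.+1 0) true false flashing) //=.
  by rewrite u0 u1.
by move=> j _ /negbTE j1; rewrite /flashing j1.
Qed.

Lemma pass_unflash : ostep (Config (U UFlash) 0 (ntape flashing)) =
  Config (U (UScan false (inord 1))) 1 (ntape (unfolded m.+1)).
Proof.
have [_ u1] := unfolded_first.
rewrite (@ostep_ntape (unfolder p) _ _ _ (U (UScan false (inord 1))) (flashing 0) false true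
  (unfolded m.+1)) //=.
by move=> j _ /negbTE j1; rewrite /flashing j1.
Qed.

Lemma pass_scan : reaches ustep quiet
  (Config (U (UScan false (inord 1))) 1 (ntape (unfolded m.+1)))
  (Config (U (UScan false (inord 2))) (5 * m + 2) (ntape (unfolded m.+1))).
Proof.
apply: (reaches_walk (k := 5 * m + 1) (f := fun i =>
  Config (U (UScan false (inord (i.+1 %% 5)))) i.+1 (ntape (unfolded m.+1)))) => //.
  by rewrite -addnS mulnC modnMDl.
move=> i im; split; first by split=> // c _ _; apply: ntape_at.
rewrite (@ostep_ntape_id (unfolder p) _ _ _ (U (UScan false (inord (i.+2 %% 5)))) true) //=.
have t5 := ltn_pmod i.+1 (isT : 0 < 5); rewrite inordK // andbT.
have -> : (i.+1 %% 5 == 2) && unfolded m.+1 i.+1 = false.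
  apply/negP => /andP [/eqP t2]; rewrite (divn_eq i.+1 5) t2 mulnC unfolded_at //; lia.
have -> : i.+2 %% 5 = (if i.+1 %% 5 == 4 then 0 else (i.+1 %% 5).+1) by case: ifP; lia.
by case: ifP.
Qed.

Lemma quiet_unmarked s h : s <> UMode MHalt -> quiet (Config (U s) h (ntape (unmarked m))).
Proof.
move=> not_halt; split=> [[/not_halt]|c cm _] //=.
by rewrite ntape_at /unmarked (_ : _ != _) //; lia.
Qed.

Lemma pass_find : reaches ustep quiet
  (Config (U (UScan false (inord 2))) (5 * m + 2) (ntape (unfolded m.+1)))
  (shift_config (unmarked m) (5 * m.+1) header).
Proof.
have find : ostep (Config (U (UScan false (inord 2))) (5 * m + 2) (ntape (unfolded m.+1))) =
    Config (U (UScan true (inord 3))) (5 * m + 3) (ntape (unmarked m)).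
  rewrite [5 * m + 3]addnS.
  apply: (@ostep_ntape_left (unfolder p) _ _ _ _ false true).
  - by rewrite /= inordK // unfolded_at //= eqxx.
  - by rewrite /unmarked eqxx.
  - by move=> j nj; rewrite /unmarked nj.
have skip t : 2 < t < 5 ->
    ostep (Config (U (UScan true (inord t))) (5 * m + t) (ntape (unmarked m))) =
    Config (U (if t == 4 then UShift true false true false else UScan true (inord t.+1)))
      (5 * m + t.+1) (ntape (unmarked m)).
  move=> /andP [t2 t5]; rewrite addnS; apply: (@ostep_ntape_id (unfolder p) _ _ _ _ true).
  by rewrite /= inordK // andbF.
apply: progressesW; split; first by split=> // c _ _; apply: ntape_at.
rewrite find; apply: progressesW; split; first exact: quiet_unmarked.
rewrite skip //; apply: progressesW; split; first exact: quiet_unmarked.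
by rewrite skip // (_ : 5 * m + 5 = 5 * m.+1); [apply: reaches_refl|lia].
Qed.

Lemma later_pass_shifts :
  reaches ustep quiet pass_start (shift_config (unmarked m) (5 * m.+1) header).
Proof.
apply: progressesW; split; first by split=> // c _ _; apply: ntape_at.
rewrite pass_flash; apply: progressesW; split.
  by split=> //= c _ /negbTE c1; rewrite ntape_at /flashing c1.
by rewrite pass_unflash; apply: reaches_trans pass_scan pass_find.
Qed.

Lemma later_pass_quiet n : quiet (iter n ustep pass_start).
Proof.
case: later_pass_shifts => t xt quiet_t; case: (ltnP n t) => [/quiet_t //|tn].
rewrite -(subnK tn) iterD xt shift_iter; split=> //= c cm c1.
rewrite ntape_at /shifted (_ : _ <= c = false) /=; last by lia.
by rewrite /unmarked (_ : _ != _) //; lia.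
Qed.

End LaterPass.

Section Run.
Local Notation M' := (omachine (unfolder p) a).
Local Notation every := (fun _ : nat => True).
Variables (B' : WO) (s' : B' -> oconfig (unfolder p)).
Hypothesis run' : block_run M' s'.

Lemma unfolding_block m b : nth_block m b ->
  s' b = if m is m'.+1 then pass_start m' else oinit (unfolder p) a.
Proof.
case=> b0 min0; elim: m b => [|m IH] b /=; first by move=> ->; apply: block_run_min run' min0.
case=> v /IH ev vb; apply: (block_run_limit run'); first by exists v; case: vb.
move=> i; rewrite -(cell_indexK i) (block_limsup_succ _ vb) ev ntape_at.
case: m {IH ev} => [|m].
  by rewrite -first_pass_result; apply: shift_infinitely_often first_pass_shifts.
by rewrite -later_pass_result; apply: shift_infinitely_often (later_pass_shifts m).
Qed.

Lemma unfolding_never_halts x : startup_block every x -> never_halts M' (s' x).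
Proof.
case=> m _ mx; rewrite (unfolding_block mx); case: m mx => [|m] _ n.
  case: first_pass_shifts => t xt run_t; case: (ltnP n t) => [/run_t //|tn].
  by rewrite -(subnK tn) iterD xt shift_iter.
by case: (later_pass_quiet m n).
Qed.

(* Cell 1 marks column 0: it is on at this limit because every pass flashes it. *)
Lemma unfolding_done (B : WO) (e : B -> B') b : startup_embedding every e -> is_min b ->
  s' (e b) = Config (U (UMode MLimit)) 0 (ntape (track_tape (five_input p a))).
Proof.
move=> emb min_b; have below v : wlt v (e b) -> exists m, nth_block m v.
  by case/(startup_below emb min_b) => m _; exists m.
apply: (block_run_limit run').
  by case: (startup_all emb b (m := 0) I) => v; exists v.
move=> i; rewrite -(cell_indexK i) ntape_at; move: (cell_index i) => c.
have inputE : track_tape (five_input p a) c = (c == 1) ||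
    match c %% 5 with 0 => c %/ 5 != 0 | 4 => input_cell (c %/ 5) | _ => false end.
  have t5 := ltn_pmod c (isT : 0 < 5); rewrite {1 2}(divn_eq c 5) track_tape_at //.
  rewrite /five_input xpair_eqE -val_eqE /= !inordK //; move: (c %/ 5) (c %% 5) t5 => h t.
  by case: t => [|[|[|[|[|]]]]] // _; rewrite ?five_tapeE //; case: h.
rewrite inputE; have [->|c1] := eqVneq c 1.
  split=> // _ [v n] /lex_lt_start vb; have [m vm] := below v vb.
  have [u ub um] := startup_all emb b (m := m.+1) I; exists (u, 1).
  split; first by right; left; apply: nth_block_mono vm um _.
  split; first by left.
  by rewrite (unfolding_block um) /= pass_flash.
have [v vb vc] := startup_all emb b (m := c.+2) I.
apply: (@limsup_eventually (WOlex B') _ (v, 0)); first by left.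
move=> [u n] vu /lex_lt_start ub; have [m um] := below u ub.
have cm : c.+2 <= m.
  rewrite leqNgt; apply/negP => mc; apply: (wlt_geF (nth_block_mono um vc mc)).
  by case: vu => [[-> _]|/= [|[-> _]]]; [left|right|left].
rewrite /= (unfolding_block um); case: m cm {um} => // m cm.
case: (later_pass_quiet m n) => _ -> //; last by lia.
rewrite {1}(divn_eq c 5) mulnC unfolded_at ?ltn_mod //; last by lia.
by case: (c %% 5) => [|[|[|]]] //; lia.
Qed.

End Run.
End Unfolding.

(** * Writing the output back *)

Section WriteBack.
Variables (p : ittm) (t : tape3 * nat -> bool).
Local Notation U x := (inr x : ost (unfolder p)).
Local Notation ustep := (@ostep (unfolder p)).
Local Notation running := (fun w : oconfig (unfolder p) => cstate w <> ohalt (unfolder p)).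
Local Notation out n := (t (Out, n)).
Local Notation halted := (track_tape (five_tape t)).

Lemma halted_at h i : i < 5 -> halted (5 * h + i) = five_tape t (inord i, h).
Proof. by move=> i5; rewrite mulnC track_tape_at. Qed.

Lemma halted_inner h : halted (5 * h) = (h != 0).
Proof. by rewrite -[5 * h]addn0 halted_at // five_tapeE. Qed.

Definition pad_set c := (c == 0) || halted c.

Lemma cross_column h : reaches ustep running
  (Config (U (ULeft (inord 4))) (5 * h + 4) (ntape halted))
  (Config (U (ULeft (inord 0))) (5 * h) (ntape halted)).
Proof.
apply: (reaches_walk (k := 4) (f := fun i =>
  Config (U (ULeft (inord (4 - i)))) (5 * h + (4 - i)) (ntape halted))) => [||i i4].
- by rewrite subn0.
- by rewrite addn0.
split=> //; rewrite -[4 - i]prednK ?subn_gt0 // -subnS addnS.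
by apply: (@ostep_ntape_id (unfolder p) _ _ _ _ false); rewrite /= inordK //; lia.
Qed.

Lemma walk_left h : reaches ustep running
  (Config (U (ULeft (inord 4))) (5 * h + 4) (ntape halted))
  (Config (U (UClear (inord 1))) 1 (ntape pad_set)).
Proof.
elim: h => [|h IH]; apply: reaches_trans (cross_column _) _; apply: progressesW; split=> //.
  rewrite (@ostep_ntape_left (unfolder p) _ _ _ (U (UClear (inord 1))) true true pad_set) //.
  - exact: reaches_refl.
  - by rewrite /= inordK // halted_inner.
  - by move=> c /negbTE c0; rewrite /pad_set c0.
rewrite (@ostep_ntape_id (unfolder p) _ _ _ (U (ULeft (inord 4))) false).
  by rewrite (_ : (5 * h.+1).-1 = 5 * h + 4) //; lia.
by rewrite /= inordK // halted_inner.
Qed.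

(* The pad and cell [h] are on, the first [h.-1] output bits have been written in cells
   1, ..., [h.-1], and the columns before column [h] are cleared otherwise. *)
Definition collected h c :=
  if c == 0 then true else if c < h then out c.-1 else if c == h then true
  else if c < 5 * h then false else halted c.

Definition collecting h : oconfig (unfolder p) := Config (U UFind) (5 * h) (ntape (collected h)).

Lemma clear_first_column : reaches ustep running
  (Config (U (UClear (inord 1))) 1 (ntape pad_set)) (collecting 1).
Proof.
apply: (reaches_walk (k := 4) (f := fun j =>
  Config (U (if j == 4 then UFind else UClear (inord j.+1))) j.+1
    (ntape (fun c => if 1 < c < j.+1 then false else pad_set c)))) => [||j j4].
- by congr Config; apply: eq_ntape => c; case: ifP => //; lia.
- congr Config; apply: eq_ntape => c; rewrite /collected /pad_set.
  case: c => [|[|c]] //=; by rewrite -[1]/(5 * 0 + 1) halted_at ?five_tapeE.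
rewrite ltn_eqF //; split=> //.
apply: (@ostep_ntape_left (unfolder p) _ _ _ _ (if j == 0 then pad_set 1 else false) true).
- rewrite /= inordK //; case: j j4 => [|j] j4 //=.
- by case: j j4 => [|j] j4 //=; rewrite ltnSn.
- by move=> c cj; case: ifP; case: ifP => //; lia.
Qed.

Section Collect.
Variable h : nat.
Hypothesis h_gt0 : 0 < h.

Definition between_columns (w : oconfig (unfolder p)) := running w /\ forall c,
  ctape w c = ntape (collected h) c \/ ctape w c = ntape (collected h.+1) c.

Definition erased j c := if (5 * h <= c) && (c < 5 * h + j) then false else collected h c.

Lemma collected_last c : c != h -> c != h.+1 -> collected h.+1 c = erased 5 c.
Proof.
move=> /negbTE ch /negbTE ch1; rewrite /erased /collected ch ch1 ltnS [c <= h]leq_eqVlt ch /=.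
case: ifP => c0; first by case: ifP => //; lia.
case: ifP => c1; first by case: ifP => //; lia.
by do !case: ifP => //; lia.
Qed.

Lemma between_erased s c j : j <= 5 -> s <> UMode MHalt ->
  between_columns (Config (U s) c (ntape (erased j))).
Proof.
move=> j5 not_halt; split=> [[/not_halt]|x] //; rewrite /ntape /=; move: (cell_index x) => {}c.
case e : ((5 * h <= c) && (c < 5 * h + j)); [right|by left; rewrite /erased e].
move/andP: e => [c1 c2]; rewrite collected_last /erased ?c1 ?c2 /=; try lia.
by rewrite (leq_trans c2) // leq_add2l.
Qed.

Lemma between_collected s c : s <> UMode MHalt ->
  between_columns (Config (U s) c (ntape (collected h.+1))).
Proof. by move=> not_halt; split=> [[/not_halt]|x] //; right. Qed.

Lemma erased_rest j i : j <= i < 5 -> erased j (5 * h + i) = five_tape t (inord i, h).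
Proof.
move=> /andP [ji i5]; rewrite -halted_at // /erased /collected.
by do !case: ifP => //; lia.
Qed.

Lemma erased_blank j c : h < c -> c < 5 * h + j -> erased j c = false.
Proof. by move=> hc cj; rewrite /erased /collected; do !case: ifP => //; lia. Qed.

Lemma erasedS j c : c != 5 * h + j -> erased j.+1 c = erased j c.
Proof. by move=> cj; rewrite /erased; congr (if _ then _ else _); lia. Qed.

Lemma erase_column : reaches ustep between_columns (collecting h)
  (Config (U (UErase (inord 4) (out h.-1))) (5 * h + 4) (ntape (erased 4))).
Proof.
apply: (reaches_walk (k := 4) (f := fun j =>
  Config (U (if j == 0 then UFind else UErase (inord j) (if j == 4 then out h.-1 else false)))
    (5 * h + j) (ntape (erased j)))) => //=.
  by rewrite addn0; congr Config; apply: eq_ntape => c; rewrite /erased addn0 ltnNge andbN.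
move=> j j4; split; first by apply: between_erased; [lia|case: eqP].
rewrite addnS; apply: (@ostep_ntape_left (unfolder p) _ _ _ _ false true).
- rewrite erased_rest ?leqnn ?(leq_trans j4) //; case: j j4 => [|j] j4 /=.
    by rewrite five_tapeE -lt0n h_gt0.
  rewrite inordK; last by lia.
  rewrite (_ : (j.+1 == 4) = false); last by lia.
  by rewrite !eqSS; case: eqP => [->|//]; rewrite five_tapeE; case: (h) h_gt0.
- by rewrite erased_blank //; lia.
- by move=> c /erasedS.
Qed.

Lemma start_carrying :
  ostep (Config (U (UErase (inord 4) (out h.-1))) (5 * h + 4) (ntape (erased 4))) =
  Config (U (UCarry (out h.-1))) (5 * h + 3) (ntape (erased 5)).
Proof.
rewrite [5 * h + 4]addnS; apply: (@ostep_ntape_left (unfolder p) _ _ _ _ false false).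
- by rewrite /= inordK.
- by rewrite erased_blank //; lia.
- by move=> c; rewrite -addnS => /erasedS.
Qed.

Lemma carry : reaches ustep between_columns
  (Config (U (UCarry (out h.-1))) (5 * h + 3) (ntape (erased 5)))
  (Config (U (UCarry (out h.-1))) h (ntape (erased 5))).
Proof.
apply: (reaches_walk (k := 4 * h + 3) (f := fun i =>
  Config (U (UCarry (out h.-1))) (5 * h + 3 - i) (ntape (erased 5)))) => [||i i_lt].
- by rewrite subn0.
- by congr Config; lia.
split; first exact: between_erased.
rewrite subnS; apply: (@ostep_ntape_id (unfolder p) _ _ _ _ false) => /=.
by rewrite erased_blank //; lia.
Qed.

Lemma write_bit : ostep (Config (U (UCarry (out h.-1))) h (ntape (erased 5))) =
  Config (U USkip) h.+1 (ntape (collected h.+1)).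
Proof.
apply: (@ostep_ntape (unfolder p) _ _ _ _ (out h.-1) true true) => /=.
- rewrite {1}/erased /collected eqxx ltnn (_ : h == 0 = false) ?andFb; last by lia.
  by rewrite (_ : (5 * h <= h) && _ = false) //; lia.
- by rewrite /collected ltnSn (_ : h == 0 = false) //; lia.
- by rewrite /collected ltnn eqxx.
- exact: collected_last.
Qed.

Lemma find_next_column : reaches ustep between_columns
  (Config (U USkip) h.+1 (ntape (collected h.+1))) (collecting h.+1).
Proof.
apply: progressesW; split; first exact: between_collected.
rewrite (@ostep_ntape_id (unfolder p) _ _ _ (U UFind) true) //.
apply: (reaches_walk (k := 4 * h + 3) (f := fun i =>
  Config (U UFind) (h.+2 + i) (ntape (collected h.+1)))) => [||i i_lt].
- by rewrite addn0.
- by congr Config; lia.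
split; first exact: between_collected.
rewrite addnS; apply: (@ostep_ntape_id (unfolder p) _ _ _ _ true) => /=.
by rewrite {1}/collected; do !(case: ifP => //; try lia).
Qed.

Lemma collect_column : progresses ustep between_columns (collecting h) (collecting h.+1).
Proof.
apply: reaches_progresses erase_column _; split; first exact: between_erased.
rewrite start_carrying; apply: reaches_trans carry _.
apply: progressesW; split; first exact: between_erased.
by rewrite write_bit; exact: find_next_column.
Qed.

End Collect.

Definition written_back (i : option nat) : bool := if i is Some n then out n else true.

Section Halted.
Variables (x : oconfig (unfolder p)) (h : nat).
Hypothesis reach : reaches ustep running x
  (Config (inl (TEnter 3 (ihalt p)) : ost (unfolder p)) (5 * h.+1) (ntape halted)).

Lemma reaches_collecting : reaches ustep running x (collecting 1).
Proof.
apply: reaches_trans reach _; apply: progressesW; split=> //.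
rewrite (@ostep_ntape_id (unfolder p) _ _ _ (U (ULeft (inord 4))) false).
  rewrite (_ : (5 * h.+1).-1 = 5 * h + 4); last by lia.
  exact: reaches_trans (walk_left h) clear_first_column.
by rewrite /= eqxx halted_inner.
Qed.

Let collects n z : z = collecting n.+1 ->
  exists2 z', progresses ustep (between_columns n.+1) z z' & z' = collecting n.+2.
Proof. by move=> ->; exists (collecting n.+2) => //; apply: collect_column. Qed.

Lemma write_back_never_halts t' : running (iter t' ustep x).
Proof.
case: reaches_collecting => t0 e0 run0; case: (ltnP t' t0) => [/run0 //|tt'].
by case: (waypoint_cover (R := fun n z => z = collecting n.+1) collects (n := 0) e0 tt') => n _ [].
Qed.

Lemma write_back_result i :
  infinitely_often (fun n => ctape (iter n ustep x) i) <-> written_back i.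
Proof.
case: reaches_collecting => t0 e0 _.
rewrite -(waypoint_infinitely_often (R := fun n z => z = collecting n.+1) e0 collects (j := i)
  (f := fun n => ntape (collected n.+1) i)).
- apply: (infinitely_often_eventually (m := cell_index i)) => n; rewrite /ntape /collected.
  by case: i => //= c cn; rewrite ltnS cn.
- by move=> n z ->.
- by move=> n z [].
Qed.

End Halted.
End WriteBack.

Section UnfolderRun.
Variables (p : ittm) (a : real).
Local Notation M := (imachine p a).
Local Notation M' := (omachine (unfolder p) a).
Local Notation running := (fun w : oconfig (unfolder p) => cstate w <> ohalt (unfolder p)).
Local Notation every := (fun _ : nat => True).
Variables (B B' : WO) (e : B -> B') (s : B -> iconfig p) (s' : B' -> oconfig (unfolder p)).
Hypothesis emb : startup_embedding every e.
Hypothesis run : block_run M s.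
Hypothesis run' : block_run M' s'.

Lemma unfolder_starts b : synced id unfold_link e s s' b ->
  encoded_starts M' unfold_link (@unfold_enc p) e s s' b.
Proof.
move=> sync; rewrite /encoded_starts; case: (min_or_nonmin b) => [min_b|nb].
  rewrite (unfolding_done run' emb min_b) (block_run_min run min_b).
  have inner : five_input p a (inord 0, 0) = false by rewrite /five_input five_tapeE andbF.
  have first : five_input p a (inord 1, 0).
    by rewrite /five_input five_tapeE xpair_eqE -val_eqE /= !inordK.
  apply: (@sub_reaches _ _ _ running) => [w run_w|]; first by split=> // -[v /min_b].
  apply: progressesW; split=> //; rewrite /= unfolder_enters //.
  have := five_track_enc_bounce (ilim p) inner; rewrite five_step_begin => bounce.
  by apply: sub_reaches (progressesW bounce) => w [].
have lim' := block_run_agrees run' (convex_nonmin (startup_convex emb) nb) (sync nb).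
set t := five_tape (ctape (s b)); have t0 : t (inord 0, 0) = false by rewrite /t five_tapeE.
have {}lim' : s' (e b) = Config (inr (UMode MLimit)) 0 (ntape (track_tape t)) by [].
have agr w : between id (@track_link 3) (Config (ilim p) 0 t) (Config (ilim p) 1 t) w ->
    agrees id unfold_link (s b) w by move=> btw x; case: (btw x).
apply: progressesW; split.
  by split=> [|_]; [rewrite lim'|exact: sync].
rewrite lim' /= unfolder_enters ?/t ?five_tapeE // -/t.
have := five_track_enc_bounce (ilim p) t0; rewrite five_step_bounce ?/t ?five_tapeE // -/t.
have -> : five_track_enc (Config (ilim p) 1 t) = unfold_enc (s b).
  by rewrite /unfold_enc /five_enc (block_run_limitE run nb).
by move/progressesW; apply: sub_reaches => w [run_w /agr agr_w]; split.
Qed.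

Lemma unfolder_never_halts b : (forall u, wle u b -> never_halts M (s u)) ->
  never_halts M' (s' (e b)).
Proof.
exact: (halting_simulation_never_halts (M := M) (M' := M') (@unfold_enc_agrees p)
  (@unfold_enc_step p) (startup_convex emb) run run' unfolder_starts).
Qed.

Lemma unfolder_reaches_halt b n : halts_in_block M s b n ->
  reaches (@ostep (unfolder p)) running (s' (e b)) (unfold_enc (iter n (@istep p) (s b))).
Proof.
exact: (halting_simulation_reaches (M := M) (M' := M') (@unfold_enc_agrees p)
  (@unfold_enc_step p) (startup_convex emb) run run' unfolder_starts).
Qed.

(* The pad is on at the limit after the output has been written: this is the signal to halt. *)
Lemma unfolder_halts b n b1 : halts_in_block M s b n -> is_succ (e b) b1 ->
  (forall x, wlt x (e b) -> never_halts M' (s' x)) ->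
  halts_in_block M' s' b1 1 /\
  ooutput (ostep (s' b1)) = ioutput (iter n (@istep p) (s b)).
Proof.
move=> halts bb1 before; have := unfolder_reaches_halt halts.
set y := iter n (@istep p) (s b) => reach_enc; have halted : cstate y = ihalt p by case: halts.
have reach : reaches (@ostep (unfolder p)) running (s' (e b))
    (Config (inl (TEnter 3 (ihalt p)) : ost (unfolder p)) (5 * (chead y).+1)
      (ntape (track_tape (five_tape (ctape y))))).
  by move: reach_enc; rewrite /unfold_enc /five_track_enc /track_enc /five_enc /= halted mulnC.
have lim' : s' b1 = Config (inr (UMode MLimit)) 0 (written_back (ctape y)).
  apply: (block_run_limit run'); first by exists (e b); case: bb1.
  by move=> i; rewrite (block_limsup_succ _ bb1); apply: write_back_result reach i.
split; last first.
  by apply/funext => m; rewrite lim' /ooutput /ioutput /ostep /=; case: m.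
apply: halts_in_blockI => // [|u ub1|[|m] //].
- by rewrite /= lim'.
- case: (le_pred bb1 ub1) => [<- k|/before //]; exact: write_back_never_halts reach k.
- by rewrite /= lim'.
Qed.

End UnfolderRun.

Theorem ittm_to_ottm_computes (p : ittm) (f : real -> option real) :
  ittm_computes p f -> ottm_computes (unfolder p) f.
Proof.
move=> comp a; have every_down (m : nat) : True -> True by [].
have := comp a; case: (f a) => [r|not_halts]; last first.
  exact: (startup_not_mhalts (K := fun=> True) every_down (@unfolding_never_halts p a)
    (@unfolder_never_halts p a) not_halts).
case/ittm_halts_withP => B [s [b [n [halts out]]]]; apply/ottm_halts_withP.
have [B' [e [s' [emb [v bv] run' before]]]] := startup_halts (K := fun=> True) every_down
  (@unfolding_never_halts p a) (@unfolder_never_halts p a) halts.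
have [run _ _] := halts; have [b1 bb1 _] := succ_exists bv.
have [halts' out'] := unfolder_halts emb run run' halts bb1 before.
by exists B', s', b1, 1; rewrite -out.
Qed.

Theorem mainTheorem18 :
  (forall f : real -> option real,
      (exists p : ittm, ittm_computes p f) <-> (exists q : ottm, ottm_computes q f)) /\
  (forall A : WO, ittm_clockable A <-> ottm_clockable A).
Proof.
split=> [f|A]; split.
- by move=> [p /ittm_to_ottm_computes]; exists (unfolder p).
- by move=> [q /ottm_to_ittm_computes]; exists (copier q).
- exact: ittm_to_ottm_clockable.
- exact: ottm_to_ittm_clockable.
Qed.
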